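(* Let $U:\mathbb{R}^d\to\mathbb{R}$ satisfy: (i) $U$ is twice continuously differentiable, $\nabla U(0)=0$, and $\sup_{x}\|\mathrm{D}^2U(x)\|\le \mathtt{L}$ for some $\mathtt{L}\ge0$; (ii) $U$ is three times continuously differentiable and $\sup_x\|\mathrm{D}^3U(x)\|\le \mathtt{M}$ for some $\mathtt{M}\ge 0$; (iii) there exist $\mathtt{m}>0$, $\mathtt{K}\ge 0$ such that $\mathrm{D}^2U(x)[y,y]\ge\mathtt{m}$ for all $\|x\|\ge\mathtt{K}$, $\|y\|=1$. Let $\bar\eta=\mathtt{m}/16$ and $V_{\bar\eta}(x)=\exp(\bar\eta\|x\|^2)$. Then there exist $\bar\Gamma>0$ and $\bar A_{\bar\eta}>0$ with $\pi(V_{\bar\eta})\le \bar A_{\bar\eta}$, such that for every $\bar\gamma\in(0,\bar\Gamma]$ there exist $C_{\bar\gamma}\ge0$ and $\rho_{\bar\gamma}\in[0,1)$ such that for all $x\in\mathbb{R}^d$, all $\gamma\in(0,\bar\gamma]$ and all $k\in\mathbb{N}$, $$\|\delta_xR_\gamma^k-\pi\|_{V_{\bar\eta}}\le C_{\bar\gamma}\rho_{\bar\gamma}^{\gamma k}\{V_{\bar\eta}(x)+\pi(V_{\bar\eta})\}.$$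
   Context: $\pi$ denotes the probability density proportional to $e^{-U}$ and the associated measure. For $\gamma>0$, $r_\gamma(x,y)=(4\pi\gamma)^{-d/2}\exp(-\|y-x+\gamma\nabla U(x)\|^2/(4\gamma))$, $\alpha_\gamma(x,y)=1\wedge\frac{\pi(y)r_\gamma(y,x)}{\pi(x)r_\gamma(x,y)}$, and the MALA kernel is $R_\gamma(x,A)=\int\mathbb{1}_A(y)\alpha_\gamma(x,y)r_\gamma(x,y)dy+\delta_x(A)\int\{1-\alpha_\gamma(x,y)\}r_\gamma(x,y)dy$. For $V\ge1$ measurable and a finite signed measure $\mu$, $\|\mu\|_V=\sup\{|\int f d\mu|:\sup_x|f(x)|/V(x)\le1\}$. *)

(* Defs.v *)
From HB Require Import structures.
From mathcomp Require Import all_boot all_order all_algebra.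
From mathcomp Require Import all_classical all_reals all_analysis.

Set Implicit Arguments.
Unset Strict Implicit.
Unset Printing Implicit Defensive.

Import Order.TTheory GRing.Theory Num.Theory.
Import numFieldNormedType.Exports.
Local Open Scope classical_set_scope.
Local Open Scope ring_scope.

(* Borel (= product) sigma-algebra on R^d = 'rV[R]_d : the sigma-algebra
   generated by the coordinate maps (same construction as the library's
   instance on n.-tuple R).                                             *)
Section rV_measurable.
Context (R : realType) (n : nat).

Definition rV_coord : 'I_n -> 'rV[R]_n -> R := fun i v => v ord0 i.

Let rV_set0 : g_sigma_preimage rV_coord set0.
Proof. exact: sigma_algebra0. Qed.

Let rV_setC A : g_sigma_preimage rV_coord A -> g_sigma_preimage rV_coord (~` A).
Proof. exact: sigma_algebraC. Qed.

Let rV_bigcup (F : _^nat) : (forall i, g_sigma_preimage rV_coord (F i)) ->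
  g_sigma_preimage rV_coord (\bigcup_i (F i)).
Proof. exact: sigma_algebra_bigcup. Qed.

HB.instance Definition _ := @isMeasurable.Build
  (measure_tuple_display default_measure_display)
  'rV[R]_n (g_sigma_preimage rV_coord) rV_set0 rV_setC rV_bigcup.

End rV_measurable.

Section MALA.
Context (R : realType).
Local Open Scope ereal_scope.

Definition rvcons (d : nat) (t : R) (v : 'rV[R]_d) : 'rV[R]_d.+1 :=
  \row_(i < d.+1) (if unlift ord0 i is Some j then v ord0 j else t).

(* Lebesgue measure on R^d, built as the iterated product measure
   lambda (x) lambda_{d-1} (same formula as the library's product_measure1:
   (m1 \x m2) A = \int[m1]_x m2 (xsection A x)).                        *)
Fixpoint lebRV (d : nat) : set 'rV[R]_d -> \bar R :=
  match d with
  | 0%N => fun A => (\1_A (0 : 'rV[R]_0))%:E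
  | d'.+1 => fun A =>
      \int[@lebesgue_measure R]_t @lebRV d' [set v | A (rvcons (t : R) v)]
  end.

Local Close Scope ereal_scope.

Definition enorm (d : nat) (x : 'rV[R]_d) : R :=
  Num.sqrt (\sum_(i < d) x ord0 i ^+ 2).

Definition edot (d : nat) (x y : 'rV[R]_d) : R := \sum_(i < d) x ord0 i * y ord0 i.

Definition ebasis (d : nat) (i : 'I_d) : 'rV[R]_d := delta_mx ord0 i.

Definition grad (d : nat) (U : 'rV[R]_d -> R) (x : 'rV[R]_d) : 'rV[R]_d :=
  \row_(i < d) ('d U x (ebasis i)).

Definition hess (d : nat) (U : 'rV[R]_d -> R) (x : 'rV[R]_d) : 'M[R]_d :=
  \matrix_(i < d, j < d) (('d (grad U) x (ebasis i)) ord0 j).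

Definition D2 (d : nat) (U : 'rV[R]_d -> R) (x y z : 'rV[R]_d) : R :=
  (y *m hess U x *m z^T) ord0 ord0.

Definition D3 (d : nat) (U : 'rV[R]_d -> R) (x a b c : 'rV[R]_d) : R :=
  (b *m ('d (hess U) x a) *m c^T) ord0 ord0.

Definition C2 (d : nat) (U : 'rV[R]_d -> R) : Prop :=
  (forall x, differentiable U x) /\
  (forall x, differentiable (grad U) x) /\
  continuous (hess U).

Definition C3 (d : nat) (U : 'rV[R]_d -> R) : Prop :=
  C2 U /\
  (forall x, differentiable (hess U) x) /\
  (forall a, continuous (fun x => 'd (hess U) x a)).

Definition Zconst (d : nat) (U : 'rV[R]_d -> R) : R :=
  fine (\int[@lebRV d]_x (expR (- U x))%:E)%E.

Definition pidens (d : nat) (U : 'rV[R]_d -> R) (x : 'rV[R]_d) : R :=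
  expR (- U x) / Zconst U.

Definition piM (d : nat) (U : 'rV[R]_d -> R) : set 'rV[R]_d -> \bar R :=
  fun A => (\int[@lebRV d]_(x in A) (pidens U x)%:E)%E.

Definition rprop (d : nat) (U : 'rV[R]_d -> R) (gamma : R) (x y : 'rV[R]_d) : R :=
  powR (4 * pi * gamma) (- (d%:R / 2)) *
  expR (- (enorm (y - x + gamma *: grad U x) ^+ 2) / (4 * gamma)).

Definition accept (d : nat) (U : 'rV[R]_d -> R) (gamma : R) (x y : 'rV[R]_d) : R :=
  Num.min 1 ((pidens U y * rprop U gamma y x) / (pidens U x * rprop U gamma x y)).

Definition malaK (d : nat) (U : 'rV[R]_d -> R) (gamma : R) (x : 'rV[R]_d)
    (A : set 'rV[R]_d) : \bar R :=
  (\int[@lebRV d]_(y in A) (accept U gamma x y * rprop U gamma x y)%:E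
   + (\1_A x)%:E * \int[@lebRV d]_y ((1 - accept U gamma x y) * rprop U gamma x y)%:E)%E.

Fixpoint malaIter (d : nat) (U : 'rV[R]_d -> R) (gamma : R) (x : 'rV[R]_d)
    (k : nat) : set 'rV[R]_d -> \bar R :=
  match k with
  | 0%N => \d_x
  | k'.+1 => fun A => (\int[@malaIter d U gamma x k']_y malaK U gamma y A)%E
  end.

Definition Vnorm (d : nat) (V : 'rV[R]_d -> R)
    (mu nu : set 'rV[R]_d -> \bar R) : \bar R :=
  ereal_sup [set (`| \int[mu]_y (f y)%:E - \int[nu]_y (f y)%:E |)%E
            | f in [set f : 'rV[R]_d -> R |
                     measurable_fun setT f /\ forall y, `|f y| <= V y]].

Definition Vexp (d : nat) (eta : R) (x : 'rV[R]_d) : R := expR (eta * enorm x ^+ 2).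

End MALA.

(* Main.v *)
Require Import Defs.
From HB Require Import structures.
From mathcomp Require Import all_boot all_order all_algebra.
From mathcomp Require Import all_classical all_reals all_analysis.
From mathcomp Require Import measurable_realfun ring lra.

Set Implicit Arguments.
Unset Strict Implicit.
Unset Printing Implicit Defensive.

Import Order.TTheory GRing.Theory Num.Theory.
Import numFieldNormedType.Exports.
Local Open Scope classical_set_scope.
Local Open Scope ring_scope.

(* Idea. In the tails the Bregman form of the acceptance ratio, and globally
   its trapezoid form (which uses the third derivative), bound the probability
   of rejection by [C gamma] uniformly and by [C gamma^(3/2) V]. The first
   bound and the Lyapunov inequality of the Langevin proposal give a drift
   [R V <= (1 - gamma) V + gamma b]. For the unadjusted chain, shifting the
   Gaussian noise by [1/n]-th of the distance between two starting points at
   each step yields a Harnack inequality after [n ~ 1/gamma] steps, hence an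
   overlap independent of [gamma]. By the second bound the [n]-step
   kernels of both chains differ by [O(sqrt gamma)] on sublevel sets of [V], so
   the overlap is inherited by the adjusted chain; drift and overlap give the
   geometric contraction of [R^n] by Harris' theorem. Detailed balance makes pi
   invariant, and integrating the contraction over one of the two starting
   points concludes.
   Throughout, kernels are operators on functions dominated by a multiple of
   [V], so that no duality with the weighted norm is needed. *)

(** * Lebesgue measure on row vectors *)

(** Two rejection bounds are used because each fails where the other works. The one of order
    [gamma^(3/2)] carries a factor [V], so in the drift of [V] it would produce [V^2]. The one of
    order [gamma] is uniform, but summed over the [1/gamma] steps of a block it leaves an error of
    order one, which could exceed the overlap. The uniform bound is enough for the drift because the
    proposal multiplies [V] by at most [exp (- gamma (m^2 |x|^2 / 16 - b0))], whose decay outgrows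
    any constant multiple of [gamma] in the tails. The Bregman form says nothing near the ball of
    radius [K], where convexity may fail; there [V] is bounded and the trapezoid form takes over.
    Drift, overlap and the weight of the oscillation are all fixed before [gamma], which enters only
    through a block length [n] with [1 <= gamma n <= 2]. This turns a fixed contraction per block
    into the rate [rho^(gamma k)]. *)

Lemma measurable_fun_rVP (R : realType) d0 (T : measurableType d0) n (f : T -> 'rV[R]_n) :
  measurable_fun [set: T] f <-> forall i, measurable_fun [set: T] (fun x => f x ord0 i).
Proof.
apply: (@iff_trans _ (g_sigma_preimage
    (fun i => @rV_coord R n i \o f) `<=` measurable)).
  rewrite g_sigma_preimage_comp; split=> [mf A [/= C preC <-]|prefS].
    exact: mf.
  by move=> _ A mA; apply: prefS; exists A.
split=> [coordS i|mf].
- move=> _ A mA.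
  apply: coordS; apply: sub_sigma_algebra.
  case: n i => [[] []//|n i] in f *.
  rewrite -bigcup_mkord_ord.
  exists i; first exact: ltn_ord.
  by exists A => //; rewrite inord_val.
- apply: smallest_sub; first exact: sigma_algebra_measurable.
  case: n => [|n] in f mf *; first by rewrite big_ord0.
  rewrite -bigcup_mkord_ord; apply: bigcup_sub => i Ii.
  by move=> A [B mB <-]; exact: mf.
Qed.

Lemma measurable_coord (R : realType) n i : measurable_fun [set: 'rV[R]_n] (fun x => x ord0 i).
Proof. by have /measurable_fun_rVP := @measurable_id _ 'rV[R]_n setT. Qed.

(* Every open set is a countable union of rational boxes. *)
Lemma measurable_open_rV (R : realType) n (A : set 'rV[R]_n) : open A -> measurable A.
Proof.
move=> oA.
pose box (c : 'rV[rat]_n * nat) :=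
  [set x : 'rV[R]_n | forall i, `|x ord0 i - ratr (c.1 ord0 i)| < c.2.+1%:R^-1].
have mbox c : measurable (box c).
  have -> : box c = \bigcap_(i in [set: 'I_n])
      [set x : 'rV[R]_n | `|x ord0 i - ratr (c.1 ord0 i)| < c.2.+1%:R^-1].
    by apply/seteqP; split => x /= h i; [move=> _|]; exact: h.
  apply: fin_bigcap_measurable => [|i _]; first exact: finite_finset.
  have mi : measurable_fun [set: 'rV[R]_n] (fun x => `|x ord0 i - ratr (c.1 ord0 i)|).
    apply: measurableT_comp => //; apply: measurable_funB => //; exact: measurable_coord.
  rewrite (_ : [set x | _] =
     [set: 'rV[R]_n] `&` (fun x => `|x ord0 i - ratr (c.1 ord0 i)|) @^-1` `]-oo, c.2.+1%:R^-1[).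
    by apply: mi => //; exact: measurable_itv.
  by rewrite setTI; apply/seteqP; split => x /=; rewrite in_itv.
have -> : A = \bigcup_c (if `[< box c `<=` A >] then box c else set0).
  apply/seteqP; split=> [x Ax|x [c _]]; last by case: asboolP => // /[apply].
  have /nbhs_ballP[e /= e0 eA] : nbhs x A by exact: open_nbhs_nbhs.
  have [N Ne] : exists N : nat, N.+1%:R^-1 < e / 2.
    have [N _ /(_ N (leqnn N)) HN] :=
      (near_infty_natSinv_lt (PosNum (divr_gt0 e0 (ltr0n R 2)))).
    by exists N.
  have /choice[q Hq] : forall i : 'I_n, exists q : rat, `|x ord0 i - ratr q| < N.+1%:R^-1.
    move=> i; have : x ord0 i - N.+1%:R^-1 < x ord0 i + N.+1%:R^-1.
      by rewrite ltrD2l gtrN// invr_gt0.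
    move=> /rat_in_itvoo[q]; rewrite in_itv/= => /andP[q1 q2]; exists q.
    by rewrite ltr_distlC; apply/andP; split=> //.
  exists (\row_i q i, N) => //.
  case: asboolP => [_ i /=|]; first by rewrite mxE.
  case=> y /= hy; apply: eA; split => // i j; rewrite ord1.
  rewrite -ball_normE/=; have := hy j; have := Hq j; rewrite mxE => h1 h2.
  rewrite (le_lt_trans (ler_distD (ratr (q j)) _ _))//.
  by rewrite (distrC (ratr _)) (splitr e) ltrD// (lt_trans _ Ne).
apply: countable_bigcupT_measurable => // c.
by case: asboolP.
Qed.

Lemma continuous_measurable_rV (R : realType) n (f : 'rV[R]_n -> R) :
  continuous f -> measurable_fun [set: 'rV[R]_n] f.
Proof.
move=> cf; apply: (measurability _ (RGenOpens.measurableE R)).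
move=> _ [_ [a [b ->] <-]]; rewrite setTI.
by apply: measurable_open_rV; apply: open_comp => //; exact: interval_open.
Qed.

Section rvcons.
Context (R : realType).

Lemma rvcons0 d t (v : 'rV[R]_d) : rvcons t v ord0 ord0 = t.
Proof. by rewrite mxE unlift_none. Qed.

Lemma rvconsS d t (v : 'rV[R]_d) i : rvcons t v ord0 (lift ord0 i) = v ord0 i.
Proof. by rewrite mxE liftK. Qed.

Definition rvtail d (x : 'rV[R]_d.+1) : 'rV[R]_d := \row_i x ord0 (lift ord0 i).

Lemma rvcons_tail d (x : 'rV[R]_d.+1) : rvcons (x ord0 ord0) (rvtail x) = x.
Proof.
by apply/rowP => i; rewrite mxE; case: unliftP => [j|] ->; rewrite ?mxE.
Qed.

Lemma rvtail_cons d t (v : 'rV[R]_d) : rvtail (rvcons t v) = v.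
Proof. by apply/rowP => i; rewrite mxE rvconsS. Qed.

Definition rvc d (p : measurableTypeR R * 'rV[R]_d) : 'rV[R]_d.+1 := rvcons p.1 p.2.

Lemma measurable_rvc d : measurable_fun setT (@rvc d).
Proof.
apply/measurable_fun_rVP => i; case: (unliftP ord0 i) => [j|] ->.
  rewrite (_ : (fun x => _) = (fun v : 'rV[R]_d => v ord0 j) \o snd).
    by apply: measurableT_comp => //; exact: measurable_coord.
  by apply/funext => x; rewrite /= rvconsS.
rewrite (_ : (fun x => _) = fst)//.
by apply/funext => x; rewrite /= rvcons0.
Qed.

Lemma measurable_rvtail d : measurable_fun setT (@rvtail d).
Proof.
apply/measurable_fun_rVP => i.
rewrite (_ : (fun x => _) = (fun v : 'rV[R]_d.+1 => v ord0 (lift ord0 i))).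
  exact: measurable_coord.
by apply/funext => x; rewrite mxE.
Qed.


End rvcons.

Section sf_measure_of.
Context d (T : measurableType d) (R : realType) (mu : set T -> \bar R).
Local Open Scope ereal_scope.

(** A copy of [mu] that takes the proofs of its properties as arguments: inside the induction on the
    dimension, [lebRV d] can be bundled as a sigma-finite measure before an instance is declared for
    it. *)
Definition sf_measure_of (h0 : mu set0 = 0) (hge0 : forall A, 0 <= mu A)
  (hadd : semi_sigma_additive mu) (hsf : sigma_finite setT mu) := mu.

Context (h0 : mu set0 = 0) (hge0 : forall A, 0 <= mu A)
  (hadd : semi_sigma_additive mu) (hsf : sigma_finite setT mu).

HB.instance Definition _ :=
  isMeasure.Build _ _ _ (sf_measure_of h0 hge0 hadd hsf) h0 hge0 hadd.
HB.instance Definition _ :=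
  Measure_isSigmaFinite.Build _ _ _ (sf_measure_of h0 hge0 hadd hsf) hsf.
End sf_measure_of.

Section lebRV_measure.
Context (R : realType).
Local Open Scope ereal_scope.

Lemma lebRVS d (A : set 'rV[R]_d.+1) :
  lebRV A = (@lebesgue_measure R \x @lebRV R d) (@rvc R d @^-1` A).
Proof.
apply: eq_integral => t _ /=; congr lebRV.
by apply/seteqP; split => v; rewrite /xsection/= inE.
Qed.

(** The four properties go through the induction together: the product formula in dimension [d.+1]
    defines a measure once [lebRV d] is known to be a sigma-finite one. *)
Lemma lebRV_subproof d : [/\ @lebRV R d set0 = 0, forall A, 0 <= @lebRV R d A,
  semi_sigma_additive (@lebRV R d) & sigma_finite setT (@lebRV R d)].
Proof.
elim: d => [|d [h0 hge0 hadd hsf]].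
  have -> : @lebRV R 0 = \d_(0%R : 'rV[R]_0) by [].
  split; [exact: measure0|by move=> A; exact: measure_ge0|
    exact: measure_semi_sigma_additive|exact: (sigma_finiteT (\d_(0%R : 'rV[R]_0)))].
pose m : {sigma_finite_measure set 'rV[R]_d -> \bar R} := sf_measure_of h0 hge0 hadd hsf.
pose pm : {measure set (measurableTypeR R * 'rV[R]_d)%type -> \bar R} := (@lebesgue_measure R \x m).
have mrvc := @measurable_rvc R d.
have E A : lebRV A = pm (@rvc R d @^-1` A) by exact: lebRVS.
split.
- by rewrite E preimage_set0 measure0.
- by move=> A; rewrite E; apply: integral_ge0 => t _; exact: hge0.
- move=> F mF tF mUF.
  rewrite E preimage_bigcup (_ : (fun n => _) = (fun n => \sum_(0 <= i < n) pm (@rvc R d @^-1` F i))); last first.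
    by apply/funext => n; apply: eq_bigr => i _; rewrite E.
  apply: measure_semi_sigma_additive.
  + by move=> n; rewrite -[X in measurable X]setTI; exact: mrvc.
  + apply/trivIsetP => /= i j _ _ ij; rewrite -preimage_setI.
    by move/trivIsetP : tF => /(_ _ _ _ _ ij) ->//; rewrite preimage_set0.
  + by rewrite -preimage_bigcup -[X in measurable X]setTI; exact: mrvc.
(* The exhausting sets are the rectangles of [F n] and [G n], pulled back along the inverse [g] of
   [rvc]. *)
- have /sigma_finiteP[F [TF ndF Foo]] := sigma_finiteT (@lebesgue_measure R).
  have /sigma_finiteP[G [TG ndG Goo]] := sigma_finiteT m.
  pose g (x : 'rV[R]_d.+1) : measurableTypeR R * 'rV[R]_d := (x ord0 ord0, rvtail x).
  have mg : measurable_fun setT g.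
    by apply: measurable_fun_pair; [exact: measurable_coord|exact: measurable_rvtail].
  exists (fun n => g @^-1` (F n `*` G n)) => [|n].
    rewrite -preimage_bigcup (_ : \bigcup_n _ = setT) ?preimage_setT//.
    rewrite -setXTT TF TG predeqE => -[x y]; split.
      by move=> [n _ []/= ? ?]; split; exists n.
    move=> [/= [n _ Fnx] [k _ Gky]]; exists (maxn n k) => //; split.
    + by move: x Fnx; exact/subsetPset/ndF/leq_maxl.
    + by move: y Gky; exact/subsetPset/ndG/leq_maxr.
  have [? ?] := Foo n; have [? ?] := Goo n.
  split; first by rewrite -[X in measurable X]setTI; apply: mg => //; exact: measurableX.
  rewrite E -comp_preimage (_ : g \o _ = id) ?preimage_id//.
    by rewrite [X in X < _]product_measure1E// lte_mul_pinfty// ge0_fin_numE.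
  by apply/funext => -[t v]; rewrite /g/rvc/= rvcons0 rvtail_cons.
Qed.

HB.instance Definition _ d := isMeasure.Build _ _ _ (@lebRV R d)
  (let: And4 h _ _ _ := lebRV_subproof d in h)
  (let: And4 _ h _ _ := lebRV_subproof d in h)
  (let: And4 _ _ h _ := lebRV_subproof d in h).

HB.instance Definition _ d := Measure_isSigmaFinite.Build _ _ _ (@lebRV R d)
  (let: And4 _ _ _ h := lebRV_subproof d in h).

Lemma lebRV_fubini d (f : 'rV[R]_d.+1 -> \bar R) :
  measurable_fun setT f -> (forall x, 0 <= f x) ->
  \int[@lebRV R d.+1]_x f x = \int[@lebesgue_measure R]_t \int[@lebRV R d]_v f (rvcons t v).
Proof.
move=> mf f0.
have mrvc := @measurable_rvc R d.
rewrite (eq_measure_integral (pushforward (@lebesgue_measure R \x @lebRV R d) (@rvc R d))); last first.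
  by move=> A mA _; first [exact: lebRVS | exact/esym/lebRVS].
rewrite ge0_integral_pushforward// preimage_setT.
rewrite fubini_tonelli1//; first exact: (measurableT_comp mf mrvc).
by move=> x; exact: f0.
Qed.

End lebRV_measure.

(** * Translation invariance and products over coordinates *)

Lemma lebesgue_measure_shift (R : realType) (a : R) (A : set (measurableTypeR R)) :
  measurable A ->
  pushforward (@lebesgue_measure R) ((fun t => t + a) : measurableTypeR R -> measurableTypeR R) A
  = lebesgue_measure A.
Proof.
have msh : measurable_fun setT ((fun t => t + a) : measurableTypeR R -> measurableTypeR R).
  by apply: measurable_funD.
move=> mA; apply/esym/lebesgue_measure_unique => //= _ [[b c]] _ <-.
rewrite /pushforward (_ : _ @^-1` _ = `](b - a), (c - a)]%classic); last first.
  by apply/seteqP; split => t /=; rewrite !in_itv/= ltrBlDr lerBrDr.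
rewrite !lebesgue_measure_itv/= !lte_fin ltrD2r -!EFinD; case: ifP => // _.
by congr (_%:E); ring.
Qed.

Section shift_integral.
Context (R : realType).
Local Open Scope ereal_scope.

Lemma integral_shift1 (a : R) (f : measurableTypeR R -> \bar R) :
  measurable_fun setT f -> (forall x, 0 <= f x) ->
  \int[@lebesgue_measure R]_t f (t + a)%R = \int[@lebesgue_measure R]_t f t.
Proof.
move=> mf f0.
pose sh := ((fun t => t + a)%R : measurableTypeR R -> measurableTypeR R).
have msh : measurable_fun setT sh by apply: measurable_funD.
rewrite [RHS](eq_measure_integral (pushforward (@lebesgue_measure R) sh)); last first.
  by move=> A mA _; exact/esym/(lebesgue_measure_shift a mA).
by rewrite ge0_integral_pushforward// preimage_setT.
Qed.

Lemma rvconsD d t s (u v : 'rV[R]_d) : (rvcons t u + rvcons s v)%R = rvcons (t + s)%R (u + v)%R.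
Proof. by apply/rowP => i; rewrite !mxE; case: unliftP => [j|] _; rewrite ?mxE. Qed.

Lemma measurable_rv_shift d (a : 'rV[R]_d) : measurable_fun setT (fun x : 'rV[R]_d => x + a)%R.
Proof.
apply/measurable_fun_rVP => i.
under eq_fun do rewrite mxE.
by apply: measurable_funD => //; exact: measurable_coord.
Qed.

Lemma integral_shift d (a : 'rV[R]_d) (f : 'rV[R]_d -> \bar R) :
  measurable_fun setT f -> (forall x, 0 <= f x) ->
  \int[@lebRV R d]_x f (x + a)%R = \int[@lebRV R d]_x f x.
Proof.
elim: d a f => [|d IH] a f mf f0.
  by apply: eq_integral => x _; congr f; apply/rowP => -[].
rewrite !lebRV_fubini//; last exact: (measurableT_comp mf (measurable_rv_shift a)).
have mrvc := @measurable_rvc R d.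
pose h t := \int[@lebRV R d]_v f (rvcons t v).
have mh : measurable_fun setT (h : measurableTypeR R -> _).
  apply: (@measurable_fun_fubini_tonelli_F _ _ _ _ _ (@lebRV R d) (f \o @rvc R d)) => [|x]; last exact: f0.
  exact: (measurableT_comp mf mrvc).
rewrite -[RHS](integral_shift1 (a ord0 ord0) mh); last first.
  by move=> t; exact: integral_ge0.
apply: eq_integral => t _; rewrite /h -[RHS](IH (rvtail a)).
- by apply: eq_integral => v _; congr f; rewrite -[X in (_ + X)%R](rvcons_tail a) rvconsD.
- apply: (measurableT_comp mf).
  exact: (measurableT_comp mrvc (pair1_measurable _)).
- by move=> x.
Qed.

Lemma integral_prod_coord d (f : 'I_d -> R -> R) :
  (forall i, measurable_fun setT (f i)) -> (forall i x, (0 <= f i x)%R) ->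
  \int[@lebRV R d]_x (\prod_(i < d) f i (x ord0 i))%:E =
  \prod_(i < d) \int[@lebesgue_measure R]_t (f i t)%:E.
Proof.
elim: d f => [|d IH] f mf f0.
  under eq_integral do rewrite big_ord0.
  by rewrite integral_cst// big_ord0 mul1e /= indicE in_setT.
have mprod n (g : 'I_n -> R -> R) : (forall i, measurable_fun setT (g i)) ->
    measurable_fun setT (fun x : 'rV[R]_n => (\prod_(i < n) g i (x ord0 i))%:E).
  move=> mg; apply/measurable_EFinP; apply: measurable_prod => i _.
  exact: (measurableT_comp (mg i) (measurable_coord i)).
rewrite lebRV_fubini//; last 2 first.
- exact: mprod.
- by move=> x; rewrite lee_fin prodr_ge0.
rewrite big_ord_recl.
pose c := \prod_(i < d) \int[@lebesgue_measure R]_t (f (lift ord0 i) t)%:E.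
transitivity (\int[@lebesgue_measure R]_t ((f ord0 t)%:E * c)).
  apply: eq_integral => t _.
  under eq_integral do
    (rewrite big_ord_recl rvcons0; under eq_bigr do rewrite rvconsS; rewrite EFinM).
  rewrite ge0_integralZl_EFin//.
  - by rewrite (IH (fun i => f (lift ord0 i))).
  - by move=> x _; rewrite lee_fin prodr_ge0.
  - exact: (mprod _ (fun i => f (lift ord0 i))).
rewrite ge0_integralZr//.
- exact: (iffRL (measurable_EFinP setT (f ord0 : measurableTypeR R -> R)) (mf ord0)).
- by move=> x _; rewrite lee_fin.
- by apply: prode_ge0 => i _; apply: integral_ge0 => x _; rewrite lee_fin.
Qed.

End shift_integral.

(** * Euclidean norm and Gaussian densities *)

Section euclid.
Context (R : realType) (d : nat).
Implicit Types x y z : 'rV[R]_d.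

Lemma edotC x y : edot x y = edot y x.
Proof. by apply: eq_bigr => i _; rewrite mulrC. Qed.

Lemma edotDl x y z : edot (x + y) z = edot x z + edot y z.
Proof. by rewrite -big_split; apply: eq_bigr => i _; rewrite mxE mulrDl. Qed.

Lemma edotZl a x z : edot (a *: x) z = a * edot x z.
Proof. by rewrite mulr_sumr; apply: eq_bigr => i _; rewrite mxE mulrA. Qed.

Lemma edotNl x z : edot (- x) z = - edot x z.
Proof. by rewrite -scaleN1r edotZl mulN1r. Qed.

Lemma edotDr x y z : edot z (x + y) = edot z x + edot z y.
Proof. by rewrite edotC edotDl !(edotC z). Qed.

Lemma edotZr a x z : edot z (a *: x) = a * edot z x.
Proof. by rewrite edotC edotZl edotC. Qed.

Lemma edotNr x z : edot z (- x) = - edot z x.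
Proof. by rewrite edotC edotNl edotC. Qed.

Definition edotE := (edotDl, edotDr, edotZl, edotZr, edotNl, edotNr).

Lemma edot_ge0 x : 0 <= edot x x.
Proof. by apply: sumr_ge0 => i _; rewrite -expr2 sqr_ge0. Qed.

Lemma enormE x : enorm x ^+ 2 = edot x x.
Proof.
rewrite sqr_sqrtr; first by apply: eq_bigr => i _; rewrite expr2.
by apply: sumr_ge0 => i _; exact: sqr_ge0.
Qed.

Lemma enorm_ge0 x : 0 <= enorm x. Proof. exact: sqrtr_ge0. Qed.

Lemma enorm_eq0 x : enorm x = 0 -> x = 0.
Proof.
move=> x0; have /eqP : edot x x = 0 by rewrite -enormE x0 expr0n.
rewrite psumr_eq0 => [/allP h|i _]; last by rewrite -expr2 sqr_ge0.
apply/rowP => i; have /(_ (mem_index_enum _)) := h i.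
by rewrite mulf_eq0 orbb mxE => /eqP.
Qed.

Lemma edot_le x y : edot x y <= enorm x * enorm y.
Proof.
have [/eqP/enorm_eq0 ->|x0] := boolP (enorm x == 0).
  by rewrite /edot big1 ?mulr_ge0 ?enorm_ge0// => i _; rewrite mxE mul0r.
have [/eqP/enorm_eq0 ->|y0] := boolP (enorm y == 0).
  by rewrite /edot big1 ?mulr_ge0 ?enorm_ge0// => i _; rewrite mxE mulr0.
have xp : 0 < enorm x by rewrite lt0r x0 enorm_ge0.
have yp : 0 < enorm y by rewrite lt0r y0 enorm_ge0.
have := edot_ge0 (enorm y *: x - enorm x *: y).
rewrite !edotE (edotC y x) -!enormE => h.
have {}h : 0 <= (enorm x * enorm y) * (enorm x * enorm y - edot x y) by nra.
by rewrite pmulr_rge0 ?mulr_gt0// subr_ge0 in h.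
Qed.

Lemma enormN x : enorm (- x) = enorm x.
Proof. by congr Num.sqrt; apply: eq_bigr => i _; rewrite mxE sqrrN. Qed.

Lemma enormZ a x : enorm (a *: x) = `|a| * enorm x.
Proof.
rewrite /enorm -sqrtr_sqr -sqrtrM ?sqr_ge0// mulr_sumr; congr Num.sqrt.
by apply: eq_bigr => i _; rewrite mxE exprMn.
Qed.

Lemma enormD x y : enorm (x + y) <= enorm x + enorm y.
Proof.
rewrite -(@ler_pXn2r _ 2) ?nnegrE ?addr_ge0 ?enorm_ge0// enormE !edotE.
by rewrite (edotC y x) -!enormE; have := edot_le x y; nra.
Qed.

Lemma enormB x y : enorm (x - y) = enorm (y - x).
Proof. by rewrite -enormN opprB. Qed.

Lemma enorm0 : enorm (0 : 'rV[R]_d) = 0.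
Proof. by rewrite -(scale0r 0) enormZ normr0 mul0r. Qed.

Lemma measurable_edot d0 (T : measurableType d0) (f g : T -> 'rV[R]_d) :
  measurable_fun setT f -> measurable_fun setT g ->
  measurable_fun setT (fun t => edot (f t) (g t)).
Proof.
move=> /measurable_fun_rVP mf /measurable_fun_rVP mg.
by apply: measurable_sum => i; apply: measurable_funM.
Qed.

Lemma measurable_enorm d0 (T : measurableType d0) (f : T -> 'rV[R]_d) :
  measurable_fun setT f -> measurable_fun setT (fun t => enorm (f t) ^+ 2).
Proof. by move=> mf; under eq_fun do rewrite enormE; exact: measurable_edot. Qed.

Lemma measurable_rvD d0 (T : measurableType d0) (f g : T -> 'rV[R]_d) :
  measurable_fun setT f -> measurable_fun setT g ->
  measurable_fun setT (fun t => f t + g t).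
Proof.
move=> /measurable_fun_rVP mf /measurable_fun_rVP mg.
apply/measurable_fun_rVP => i; under eq_fun do rewrite mxE.
exact: measurable_funD.
Qed.

Lemma measurable_rvZ d0 (T : measurableType d0) a (f : T -> 'rV[R]_d) :
  measurable_fun setT f -> measurable_fun setT (fun t => a *: f t).
Proof.
move=> /measurable_fun_rVP mf.
apply/measurable_fun_rVP => i; under eq_fun do rewrite mxE.
exact: measurable_funM.
Qed.

End euclid.

Section gauss.
Context (R : realType) (d : nat).

(** Density of the noise [sqrt (2 gamma) Z] of the proposal, with [Z] a standard Gaussian. *)
Definition gdens (gamma : R) (w : 'rV[R]_d) : R :=
  powR (4 * pi * gamma) (- (d%:R / 2)) * expR (- (enorm w ^+ 2) / (4 * gamma)).

Lemma rpropE U gamma x y : rprop U gamma x y = gdens gamma (y - x + gamma *: @grad R d U x).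
Proof. by []. Qed.

Lemma gdens_gt0 gamma w : 0 < gamma -> 0 < gdens gamma w.
Proof.
by move=> g0; rewrite mulr_gt0 ?expR_gt0// powR_gt0// !mulr_gt0// pi_gt0.
Qed.

Lemma measurable_gdens d0 (T : measurableType d0) (f : T -> 'rV[R]_d) gamma :
  measurable_fun setT f -> measurable_fun setT (fun x => gdens gamma (f x)).
Proof.
move=> mf; apply: measurable_funM => //.
apply: (measurableT_comp (@measurable_expR R)).
apply: measurable_funM => //; apply: measurableT_comp => //.
exact: measurable_enorm.
Qed.

Lemma gdens_prod gamma w : 0 < gamma ->
  gdens gamma w = \prod_(i < d) normal_pdf 0 (Num.sqrt (2 * gamma)) (w ord0 i).
Proof.
move=> g0; have s0 : Num.sqrt (2 * gamma) != 0.
  by rewrite gt_eqF// sqrtr_gt0 mulr_gt0.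
have pg0 : 0 < 4 * pi * gamma by rewrite !mulr_gt0// pi_gt0.
rewrite normal_pdfE// big_split/= prodr_const card_ord /gdens; congr (_ * _).
  rewrite /normal_peak sqr_sqrtr ?mulr_ge0 1?ltW//.
  rewrite (_ : 2 * gamma * pi *+ 2 = 4 * pi * gamma); last by rewrite mulr2n; ring.
  by rewrite powRN (mulrC d%:R) powRrM powR12_sqrt ?ltW// powR_mulrn ?sqrtr_ge0// exprVn.
rewrite /normal_fun -expR_sum; congr expR.
rewrite enormE -sumrN mulr_suml; apply: eq_bigr => i _.
rewrite subr0 sqr_sqrtr ?mulr_ge0 1?ltW// mulNr -expr2.
by rewrite (_ : 4 * gamma = 2 * gamma *+ 2) // mulr2n; ring.
Qed.

Lemma integral_gdens gamma (a : 'rV[R]_d) : 0 < gamma ->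
  (\int[@lebRV R d]_w (gdens gamma (w + a))%:E = 1)%E.
Proof.
move=> g0; rewrite (integral_shift a (f := fun w => (gdens gamma w)%:E)); last 2 first.
- by apply/measurable_EFinP; exact: measurable_gdens.
- by move=> w; rewrite lee_fin ltW// gdens_gt0.
under eq_integral do rewrite gdens_prod//.
rewrite (integral_prod_coord (f := fun i => normal_pdf 0 (Num.sqrt (2 * gamma)))).
- rewrite big1// => i _; apply: integral_normal_pdf.
- by move=> i; exact: measurable_normal_pdf.
- by move=> i x; exact: normal_pdf_ge0.
Qed.

End gauss.

(** * Regularity of the potential *)

Section line_derivative.
Context (R : realType) (d : nat).
Implicit Types x h : 'rV[R]_d.

Lemma is_diff_line x h (t : R) :
  is_diff t (fun s : R => x + s *: h) (fun s : R => s *: h).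
Proof.
have := @is_diffD _ _ _ (cst x) (fun s : R => s *: h) (cst 0) (fun s => s *: h) t
  (is_diff_cst _ _) (is_diff_scalel _ _).
by rewrite add0r.
Qed.

Lemma is_derive_line (W : normedModType R) (F : 'rV[R]_d -> W) x h (t : R) :
  differentiable F (x + t *: h) ->
  is_derive t 1 (fun s : R => F (x + s *: h)) ('d F (x + t *: h) h).
Proof.
move=> dF; have dl := is_diff_line x h t.
have dd : is_diff t (F \o (fun s : R => x + s *: h)) ('d F (x + t *: h) \o (fun s : R => s *: h)).
  by apply: is_diff_comp => //; exact: differentiableP.
split; first by apply: diff_derivable; exact: ex_diff.
by rewrite deriveE ?diff_val/= ?scale1r//; exact: ex_diff.
Qed.

(** Here [c] encodes an arbitrary linear form on matrices, so that one statement serves both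
    [is_derive_g] (a one-row matrix paired with [v]) and [is_derive_D2] (the quadratic form at
    [v]). *)
Lemma is_derive_line_lin (n p : nat) (F : 'rV[R]_d -> 'M[R]_(n, p)) (c : 'I_n -> 'I_p -> R) x h (t : R) :
  differentiable F (x + t *: h) ->
  is_derive t 1 (fun s : R => \sum_i \sum_j c i j * F (x + s *: h) i j)
    (\sum_i \sum_j c i j * ('d F (x + t *: h) h) i j).
Proof.
move=> /is_derive_line [dF vF].
have Hij i j : is_derive t 1 (fun s : R => c i j * F (x + s *: h) i j)
    (c i j * ('d F (x + t *: h) h) i j).
  have Dij : is_derive t 1 (fun s : R => F (x + s *: h) i j) (('d F (x + t *: h) h) i j).
    split; first by move/derivable_mxP : dF => /(_ i j).
    by rewrite -vF derive_mx// mxE.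
  exact: is_deriveZ.
have -> : (fun s : R => \sum_i \sum_j c i j * F (x + s *: h) i j) =
    \sum_i \sum_j (fun s : R => c i j * F (x + s *: h) i j).
  by apply/funext => s; rewrite fct_sumE; apply: eq_bigr => i _; rewrite fct_sumE.
by apply: is_derive_sum => i; exact: is_derive_sum.
Qed.

Lemma mvt (f df : R -> R) (a b : R) : a < b -> (forall t : R, is_derive t 1 f (df t)) ->
  exists c, [/\ a < c, c < b & f b - f a = df c * (b - a)].
Proof.
move=> ab Hf.
have cf : {within `[a, b], continuous f}.
  apply: continuous_subspaceT => t.
  by apply: differentiable_continuous; apply/derivable1_diffP; have [] := Hf t.
have [c] := MVT ab (fun t _ => Hf t) cf.
by rewrite in_itv/= => /andP[ac cb] E; exists c.
Qed.

Lemma is_derive_poly (f f' : R -> R) (a b t : R) :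
  is_derive t 1 f (f' t) ->
  is_derive t 1 (fun s => f s + a * s + b * s ^+ 2) (f' t + a + b * 2 * t).
Proof.
move=> df.
have d1 : is_derive t 1 (fun s : R => a * s) (a *: 1) by exact: is_deriveZ.
have d2 : is_derive t 1 (fun s : R => b * s ^+ 2) (b *: (2 * t)).
  apply: is_deriveZ; have /is_derive_eq := @is_deriveX R R id 2 t 1 1 (is_derive_id t 1).
  by apply; rewrite expr1 /GRing.scale/=; ring.
have /is_derive_eq := is_deriveD (is_deriveD df d1) d2.
by apply; rewrite /GRing.scale/=; ring.
Qed.

Lemma is_derive_idM (f f' : R -> R) (t : R) :
  is_derive t 1 f (f' t) -> is_derive t 1 (fun s => s * f s) (f t + t * f' t).
Proof.
move=> df; have /is_derive_eq := is_deriveM (is_derive_id t 1) df.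
by apply; rewrite /GRing.scale/=; ring.
Qed.

Lemma taylor_convex (f f' f'' : R -> R) (q : R) :
  (forall t : R, is_derive t 1 f (f' t)) -> (forall t : R, is_derive t 1 f' (f'' t)) ->
  (forall t, 0 <= t <= 1 -> q <= f'' t) -> q / 2 <= f 0 - f 1 + f' 1.
Proof.
move=> df df' hq.
(* [k 0 - k 1] is the quantity to bound minus [q / 2], and [k' t = t (q - f'' t)] is nonpositive on
   [0, 1]. The term with coefficient 0 fits [k] to the shape of [is_derive_poly]. *)
pose k t := f t - t * f' t + 0 * t + q / 2 * t ^+ 2.
have dk (t : R) : is_derive t 1 k (t * (q - f'' t)).
  have df0 : is_derive t 1 (fun s => f s - s * f' s) (f' t - (f' t + t * f'' t)).
    exact: is_deriveB (df t) (is_derive_idM (df' t)).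
  have /is_derive_eq := is_derive_poly (f' := fun t => f' t - (f' t + t * f'' t)) 0 (q / 2) df0.
  by apply; rewrite /=; field.
have [c [c0 c1]] := mvt ltr01 dk.
rewrite /k => E; have := hq c; rewrite (ltW c0) (ltW c1) => /(_ isT); nra.
Qed.

Lemma trapezoid (f f' f'' : R -> R) (B : R) :
  (forall t : R, is_derive t 1 f (f' t)) -> (forall t : R, is_derive t 1 f' (f'' t)) ->
  (forall s t, 0 <= s <= 1 -> 0 <= t <= 1 -> `|f'' s - f'' t| <= B) ->
  `|f 0 - f 1 + (f' 0 + f' 1) / 2| <= B / 2.
Proof.
move=> df df' hB.
(* [k 0 - k 1] is the error of the trapezoidal rule. A second mean value theorem, on [f'], turns
   [k' c] into [c (f'' s - f'' c) / 2] with [0 < s < c < 1], so only the oscillation of [f'']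
   enters. *)
pose k t := f t - (2^-1 * (t * f' t)) + (- (f' 0 / 2)) * t + 0 * t ^+ 2.
have dk (t : R) : is_derive t 1 k ((f' t - f' 0 - t * f'' t) / 2).
  have df0 : is_derive t 1 (fun s => f s - 2^-1 * (s * f' s)) (f' t - 2^-1 * (f' t + t * f'' t)).
    exact: is_deriveB (df t) (is_deriveZ 2^-1 (is_derive_idM (df' t))).
  have /is_derive_eq := is_derive_poly (f' := fun t => f' t - 2^-1 * (f' t + t * f'' t))
    (- (f' 0 / 2)) 0 df0.
  by apply; rewrite /GRing.scale/=; field.
have [c [c0 c1 E]] := mvt ltr01 dk.
have [s [s0 sc Es]] := mvt c0 df'.
have := hB s c; rewrite (ltW s0) (ltW c0) (ltW c1) ltW ?(lt_trans sc)// => /(_ isT isT).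
rewrite (_ : f 0 - _ + _ = - (k 1 - k 0)); last by rewrite /k; field.
rewrite E Es !subr0 mulr1 normrN normrM normfV (ger0_norm (ler0n R 2)) ler_pM2r// => h.
rewrite (_ : _ - _ = c * (f'' s - f'' c)); last by ring.
by rewrite normrM (ger0_norm (ltW c0)) (le_trans _ h)// ler_piMl// ltW.
Qed.

End line_derivative.

Section potential.
Context (R : realType) (d : nat) (U : 'rV[R]_d -> R) (L M m K : R).
Hypothesis U2 : C2 U.
Hypothesis gU0 : grad U 0 = 0.
Hypothesis L0 : 0 <= L.
Hypothesis UL : forall x y z, `| D2 U x y z | <= L * enorm y * enorm z.
Hypothesis U3 : C3 U.
Hypothesis M0 : 0 <= M.
Hypothesis UM : forall x a b c, `| D3 U x a b c | <= M * enorm a * enorm b * enorm c.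
Hypothesis m0 : 0 < m.
Hypothesis K0 : 0 <= K.
Hypothesis Um : forall x y, K <= enorm x -> enorm y = 1 -> m <= D2 U x y y.
Implicit Types x y z h v : 'rV[R]_d.

Local Notation g := (grad U).

Lemma D2_ge x y : K <= enorm x -> m * enorm y ^+ 2 <= D2 U x y y.
Proof.
move=> Kx; have [y0|y0] := eqVneq (enorm y) 0.
  rewrite y0 (enorm_eq0 y0) /D2 !mul0mx mxE expr0n mulr0//.
have yp : 0 < enorm y by rewrite lt0r y0 enorm_ge0.
have := Um Kx (_ : enorm ((enorm y)^-1 *: y) = 1).
rewrite enormZ ger0_norm ?invr_ge0 ?enorm_ge0// mulVf// => /(_ erefl).
rewrite /D2 linearZ/= -!scalemxAl -scalemxAr !mxE mulrA -invfM -expr2.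
by rewrite mulrC ler_pdivlMr// exprn_gt0.
Qed.

Lemma diff_edot x h : 'd U x h = edot (g x) h.
Proof.
rewrite [in LHS](row_sum_delta h) linear_sum; apply: eq_bigr => i _.
by rewrite linearZ mxE mulrC.
Qed.

Lemma dgrad_edot x h v : edot ('d g x h) v = D2 U x h v.
Proof.
rewrite /D2 mxE; apply: eq_bigr => j _; rewrite [v^T _ _]mxE; congr (_ * _).
rewrite mxE [in LHS](row_sum_delta h) linear_sum summxE; apply: eq_bigr => i _.
by rewrite linearZ !mxE.
Qed.

Lemma is_derive_U x h (t : R) :
  is_derive t 1 (fun s : R => U (x + s *: h)) (edot (g (x + t *: h)) h).
Proof. by rewrite -diff_edot; apply: is_derive_line; have [] := U2. Qed.

Lemma is_derive_g x h v (t : R) :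
  is_derive t 1 (fun s : R => edot (g (x + s *: h)) v) (D2 U (x + t *: h) h v).
Proof.
have [_ [dg _]] := U2.
have := is_derive_line_lin (fun _ : 'I_1 => fun j => v ord0 j) (dg (x + t *: h)).
rewrite big_ord1 (_ : \sum_j _ = D2 U (x + t *: h) h v); last first.
  by rewrite -dgrad_edot; apply: eq_bigr => j _; rewrite mulrC.
rewrite (_ : (fun s => _) = (fun s : R => edot (g (x + s *: h)) v))//.
by apply/funext => s; rewrite big_ord1; apply: eq_bigr => j _; rewrite mulrC.
Qed.

Lemma is_derive_D2 x h v (t : R) :
  is_derive t 1 (fun s : R => D2 U (x + s *: h) v v) (D3 U (x + t *: h) h v v).
Proof.
have [_ [dh _]] := U3.
have E (A : 'M[R]_d) : (v *m A *m v^T) ord0 ord0 = \sum_i \sum_j (v ord0 i * v ord0 j) * A i j.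
  rewrite exchange_big mxE; apply: eq_bigr => j _; rewrite !mxE mulr_suml.
  by apply: eq_bigr => i _; rewrite mulrAC.
have := is_derive_line_lin (fun i j => v ord0 i * v ord0 j) (dh (x + t *: h)).
rewrite -E (_ : (fun s => _) = (fun s : R => D2 U (x + s *: h) v v))//.
by apply/funext => s; rewrite -E.
Qed.

(** The mean value theorem is applied to the scalar function [<grad U (x + s (y - x)), D>], where
    [D] is the increment of the gradient itself; dividing by [|D|] gives the Euclidean bound. *)
Lemma grad_lip x y : enorm (g y - g x) <= L * enorm (y - x).
Proof.
set D := g y - g x.
have [D0|D0] := eqVneq (enorm D) 0; first by rewrite D0 mulr_ge0 ?enorm_ge0.
have Dp : 0 < enorm D by rewrite lt0r D0 enorm_ge0.
have [c [_ _]] := mvt ltr01 (is_derive_g x (y - x) D).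
rewrite scale1r scale0r addr0 (addrC x) subrK subr0 mulr1 -edotNl -edotDl -/D -enormE => E.
by rewrite -(ler_pM2r Dp) -expr2 E; exact: le_trans (ler_norm _) (UL _ _ _).
Qed.

Lemma grad_le x : enorm (g x) <= L * enorm x.
Proof. by have := grad_lip 0 x; rewrite gU0 !subr0. Qed.

Local Notation c1 := ((L + m) * K).

(** Along the ray to [x], [s -> <grad U (s x), x>] has slope at least [- L |x|^2] and, once
    [s |x| >= K], at least [m |x|^2]. Cutting at [s = K / |x|] loses at most [(L + m) K |x|] with
    respect to strong convexity everywhere. *)
Lemma grad_dissip x : m * enorm x ^+ 2 - c1 * enorm x <= edot (g x) x.
Proof.
have [phi [D [phi0 phi1 dphi lowL lowm]]] : exists phi D : R -> R, [/\ phi 0 = 0,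
    phi 1 = edot (g x) x, forall t : R, is_derive t 1 phi (D t),
    forall t, - (L * enorm x ^+ 2) <= D t &
    forall t, 0 < t -> K <= t * enorm x -> m * enorm x ^+ 2 <= D t].
  exists (fun s => edot (g (0 + s *: x)) x), (fun s => D2 U (0 + s *: x) x x); split.
  - by rewrite scale0r addr0 gU0 /edot big1// => i _; rewrite mxE mul0r.
  - by rewrite scale1r add0r.
  - exact: is_derive_g.
  - by move=> t; have := UL (0 + t *: x) x x; rewrite ler_norml -mulrA -expr2 => /andP[].
  - by move=> t t0 Kt; apply: D2_ge; rewrite add0r enormZ ger0_norm// ltW.
move: (enorm_ge0 x) phi1 lowL lowm.
move: (enorm x) (edot _ _) => X B X0 phi1 lowL lowm.
have [xK|Kx] := leP X K.
  have [c [_ _]] := mvt ltr01 dphi; rewrite phi0 phi1 !subr0 mulr1 => ->.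
  apply: le_trans (lowL c).
  have : 0 <= (L + m) * (X * (K - X)).
    apply: mulr_ge0; first exact: addr_ge0 L0 (ltW m0).
    by apply: mulr_ge0; rewrite ?subr_ge0.
  by lra.
have xp : 0 < X by exact: le_lt_trans Kx.
pose t0 := K / X.
have t00 : 0 <= t0 by rewrite divr_ge0.
have t01 : t0 < 1 by rewrite ltr_pdivrMr// mul1r.
have t0x : t0 * X = K by rewrite /t0 divfK// gt_eqF.
move: t0 t00 t01 t0x => t0 t00 t01 t0x.
have A1 : - (L * X * K) <= phi t0.
  move: t00; rewrite le_eqVlt => /predU1P[t0E|t0p].
    by rewrite -t0E phi0 -t0x -t0E mul0r mulr0 oppr0.
  have [c [_ _]] := mvt t0p dphi; rewrite phi0 !subr0 => ->.
  have := ler_wpM2r (ltW t0p) (lowL c); rewrite -t0x; lra.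
have [c [ct0 c1']] := mvt t01 dphi; rewrite phi1 => E.
have : m * X ^+ 2 <= D c.
  apply: lowm; first exact: le_lt_trans ct0.
  by rewrite -t0x ler_pM2r// ltW.
move/(ler_wpM2r (_ : 0 <= 1 - t0)); rewrite subr_ge0 (ltW t01) -E => /(_ isT).
by rewrite -t0x in A1 *; lra.
Qed.

Lemma U_ub x : U x <= U 0 + L * enorm x ^+ 2.
Proof.
have [c [c0 c1' E]] := mvt ltr01 (is_derive_U 0 x).
have := edot_le (g (0 + c *: x)) x; rewrite -lerBlDl.
move: E; rewrite scale1r scale0r !add0r subr0 mulr1 => ->.
move=> /le_trans; apply; rewrite expr2 mulrA ler_wpM2r ?enorm_ge0//.
rewrite (le_trans (grad_le _))// ler_wpM2l// enormZ (ger0_norm (ltW c0))//.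
by rewrite ler_piMl ?enorm_ge0// ltW.
Qed.

Lemma U_lb x : U 0 + m / 2 * enorm x ^+ 2 - c1 * enorm x <= U x.
Proof.
have := @grad_dissip; set C := c1 => dissip.
(* The function is [U (t x) + C |x| t - m |x|^2 t^2 / 2]; its derivative at [c], multiplied by [c],
   is the dissipativity gap at the point [c x]. *)
have dk (t : R) := is_derive_poly (f' := fun t => edot (g (0 + t *: x)) x) (C * enorm x) (- (m / 2 * enorm x ^+ 2)) (is_derive_U 0 x t).
have [c [c0 c1' E]] := mvt ltr01 dk.
move: E; rewrite scale1r scale0r !add0r subr0 mulr1 mulr0 expr1n expr0n/= !mulr0 => E.
have := dissip (c *: x); rewrite enormZ (ger0_norm (ltW c0))// edotZr => h.
have {}h : 0 <= c * (edot (g (c *: x)) x + C * enorm x + - (m / 2 * enorm x ^+ 2) * 2 * c).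
  by move: h; move: (edot _ _) (enorm x) => B X; nra.
move: h E; rewrite pmulr_rge0//; move: (edot _ _) (enorm x) (U x) (U 0) => B X Ux U00; lra.
Qed.

Lemma bregman_ge x h : (forall t, 0 <= t <= 1 -> K <= enorm (x + t *: h)) ->
  m / 2 * enorm h ^+ 2 <= U x - U (x + h) + edot (g (x + h)) h.
Proof.
move=> hK.
have := taylor_convex (is_derive_U x h) (is_derive_g x h h)
  (fun t t01 => D2_ge h (hK t t01)).
by rewrite scale0r scale1r addr0 mulrAC.
Qed.

(** By the third-derivative bound, [D2 U _ h h] oscillates by at most [M |h|^3] along the
    segment. *)
Lemma trapezoid_le x h :
  `|U x - U (x + h) + edot (g x + g (x + h)) h / 2| <= M * enorm h ^+ 3.
Proof.
have hB s t : 0 <= s <= 1 -> 0 <= t <= 1 ->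
    `|D2 U (x + s *: h) h h - D2 U (x + t *: h) h h| <= M * enorm h ^+ 3.
  have W a b : a < b -> 0 <= a -> b <= 1 ->
      `|D2 U (x + b *: h) h h - D2 U (x + a *: h) h h| <= M * enorm h ^+ 3.
    move=> ab a0 b1; have [c [_ _ ->]] := mvt ab (is_derive_D2 x h h).
    rewrite normrM (le_trans (ler_wpM2r (normr_ge0 _) (UM _ _ _ _)))//.
    rewrite (_ : M * _ * _ * _ = M * enorm h ^+ 3); last by ring.
    have ba : 0 <= b - a by rewrite subr_ge0 ltW.
    rewrite (ger0_norm ba) ler_piMr//; last by lra.
    by rewrite mulr_ge0// exprn_ge0// enorm_ge0.
  move=> /andP[s0 s1] /andP[t0 t1]; have [st|ts|->] := ltgtP s t; last first.
  - by rewrite subrr normr0 mulr_ge0// exprn_ge0// enorm_ge0.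
  - exact: W.
  - by rewrite distrC; exact: W.
have := trapezoid (is_derive_U x h) (is_derive_g x h h) hB.
rewrite scale0r scale1r addr0 edotDl => /le_trans; apply.
have : 0 <= M * enorm h ^+ 3 by rewrite mulr_ge0// exprn_ge0// enorm_ge0.
by lra.
Qed.

Lemma continuous_U : continuous U.
Proof. by move=> x; apply: differentiable_continuous; have [] := U2. Qed.

Lemma measurable_U : measurable_fun setT U.
Proof. by apply: continuous_measurable_rV; exact: continuous_U. Qed.

Lemma measurable_grad : measurable_fun setT g.
Proof.
apply/measurable_fun_rVP => i; apply: continuous_measurable_rV => x.
have [_ [dg _]] := U2.
apply: (continuous_comp (g := fun y : 'rV[R]_d => y ord0 i)).
  exact/differentiable_continuous/dg.
exact: coord_continuous.
Qed.

End potential.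

(** * Harris' theorem for operators on weighted functions *)

Lemma harris_arith (R : realType) (eps p1 p2 p3 p4 W : R) :
  0 < eps -> 0 <= W -> 0 <= W * (2^-1 - eps) -> p1 - p2 <= 2 * (1 - eps) ->
  p3 - p1 - (p4 - p2) <= W / 2 + eps -> p3 - p4 <= (1 - eps / 4) * (2 + W).
Proof. by move=> *; lra. Qed.

Section weighted.
Context d (T : measurableType d) (R : realType) (V : T -> R).
Hypothesis mV : measurable_fun setT V.
Hypothesis V1 : forall x, 1 <= V x.

Definition adm (f : T -> R) := measurable_fun setT f /\ exists C, forall x, `|f x| <= C * V x.

Lemma V_gt0 x : 0 < V x. Proof. exact: lt_le_trans (V1 x). Qed.

Lemma adm_V : adm V.
Proof. by split => //; exists 1 => x; rewrite mul1r ger0_norm// ltW// V_gt0. Qed.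

Lemma adm_cst c : adm (fun _ => c).
Proof. by split => //; exists `|c| => x; rewrite ler_peMr. Qed.

Lemma adm_lin a f g : adm f -> adm g -> adm (fun x => a * f x + g x).
Proof.
move=> [mf [C Cf]] [mg [D Dg]]; split.
  by apply: measurable_funD => //; exact: measurable_funM.
exists (`|a| * C + D) => x; rewrite (le_trans (ler_normD _ _))// mulrDl lerD//.
by rewrite normrM -mulrA ler_wpM2l.
Qed.

Lemma adm_le (f g : T -> R) C : measurable_fun setT f -> adm g -> (forall x, `|f x| <= C * `|g x|) -> adm f.
Proof.
move=> mf [_ [D Dg]] fg; split=> //; exists (`|C| * D) => x.
rewrite (le_trans (fg x))// -mulrA (le_trans (ler_wpM2r (normr_ge0 _) (ler_norm C)))//.
exact: ler_wpM2l.
Qed.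

Lemma adm_bounded (f : T -> R) C : measurable_fun setT f -> (forall x, `|f x| <= C) -> adm f.
Proof.
move=> mf Cf; apply: (adm_le (C := C) mf (adm_cst 1)) => x.
by rewrite normr1 mulr1.
Qed.

Definition markov_op (P : (T -> R) -> T -> R) := [/\ forall f, adm f -> adm (P f),
  forall a f g, adm f -> adm g -> forall x, P (fun y => a * f y + g y) x = a * P f x + P g x,
  forall f g, adm f -> adm g -> (forall x, f x <= g x) -> forall x, P f x <= P g x
  & forall x, P (fun _ => 1) x = 1].

Section markov_theory.
Context (P : (T -> R) -> T -> R).
Hypothesis mkP : markov_op P.

Lemma markov_adm f : adm f -> adm (P f). Proof. by have [h _ _ _] := mkP; exact: h. Qed.

Lemma markov_lin a f g : adm f -> adm g ->
  forall x, P (fun y => a * f y + g y) x = a * P f x + P g x.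
Proof. by have [_ h _ _] := mkP; exact: h. Qed.

Lemma markov_le f g : adm f -> adm g -> (forall x, f x <= g x) -> forall x, P f x <= P g x.
Proof. by have [_ _ h _] := mkP; exact: h. Qed.

Lemma markov_1 x : P (fun _ => 1) x = 1. Proof. by have [_ _ _ ->] := mkP. Qed.

Lemma markov_0 x : P (fun _ => 0) x = 0.
Proof.
have E : (fun _ : T => 0 : R) = (fun y => (-1) * 1 + 1) by apply/funext => y; ring.
by rewrite E (markov_lin _ (adm_cst 1) (adm_cst 1)) markov_1; ring.
Qed.

Lemma markov_Z a f x : adm f -> P (fun y => a * f y) x = a * P f x.
Proof.
move=> hf; have E : (fun y => a * f y) = (fun y => a * f y + 0) by apply/funext => y; rewrite addr0.
by rewrite E (markov_lin _ hf (adm_cst 0)) markov_0 addr0.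
Qed.

Lemma markov_cst c x : P (fun _ => c) x = c.
Proof.
have E : (fun _ : T => c) = (fun y => c * 1) by apply/funext => y; rewrite mulr1.
by rewrite E markov_Z ?markov_1 ?mulr1//; exact: adm_cst.
Qed.

Lemma markov_D f g x : adm f -> adm g -> P (fun y => f y + g y) x = P f x + P g x.
Proof.
move=> hf hg; have E : (fun y => f y + g y) = (fun y => 1 * f y + g y).
  by apply/funext => y; rewrite mul1r.
by rewrite E markov_lin// mul1r.
Qed.

Lemma markov_B f g x : adm f -> adm g -> P (fun y => f y - g y) x = P f x - P g x.
Proof.
move=> hf hg; have E : (fun y => f y - g y) = (fun y => (-1) * g y + f y).
  by apply/funext => y; ring.
by rewrite E markov_lin//; ring.
Qed.

Lemma adm_D f g : adm f -> adm g -> adm (fun x => f x + g x).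
Proof.
move=> hf hg; have := adm_lin 1 hf hg.
by rewrite (_ : (fun _ => _) = (fun x => f x + g x))//; apply/funext => x; rewrite mul1r.
Qed.

Lemma adm_Z a f : adm f -> adm (fun x => a * f x).
Proof.
move=> hf; have := adm_lin a hf (adm_cst 0).
by rewrite (_ : (fun _ => _) = (fun x => a * f x))//; apply/funext => x; rewrite addr0.
Qed.

Lemma adm_B f g : adm f -> adm g -> adm (fun x => f x - g x).
Proof.
move=> hf hg; have := adm_lin (-1) hg hf.
by rewrite (_ : (fun _ => _) = (fun x => f x - g x))//; apply/funext => x; ring.
Qed.

Lemma iterS_fun n f : iter n.+1 P f = P (iter n P f). Proof. by []. Qed.

Lemma markov_iter n : markov_op (iter n P).
Proof.
elim: n => [|n [h1 h2 h3 h4]]; first by split.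
split => //=.
- by move=> f hf; apply: markov_adm; exact: h1.
- move=> a f g hf hg x.
  rewrite (_ : iter n P _ = (fun y => a * iter n P f y + iter n P g y)).
    by rewrite markov_lin//; exact: h1.
  by apply/funext => y; exact: h2.
- move=> f g hf hg fg x; apply: markov_le; [exact: h1|exact: h1|].
  by apply: h3.
- move=> x; rewrite (_ : iter n P _ = fun _ => 1) ?markov_1//.
  by apply/funext => y; exact: h4.
Qed.

End markov_theory.

(* The functional form of the Hairer-Mattingly argument: a function whose
   oscillation is controlled by [2 + beta (V x + V y)] is, up to a constant,
   bounded by [1 + beta V], hence splits into a part bounded by 1, contracted
   by the minorization, and a part bounded by [beta V], contracted by the
   drift. *)
Section harris.
Context (P : (T -> R) -> T -> R) (b eps : R).
Hypothesis mkP : markov_op P.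
Hypotheses (b0 : 0 < b) (eps0 : 0 < eps) (eps2 : eps <= 2^-1).
Hypothesis drift : forall x, P V x <= V x / 2 + b.
Hypothesis minor : forall x y f, V x + V y <= 8 * b -> adm f -> (forall z, 0 <= f z <= 1) ->
  P f x - P f y <= 1 - eps.

(** With this weight the additive constant of the drift, paid at both points, costs
    [2 beta b = eps], half of the gain [2 eps] of the minorization. *)
Let beta := eps / (2 * b).

Let beta_gt0 : 0 < beta. Proof. by rewrite divr_gt0// mulr_gt0. Qed.

Let beta_b : beta * b = eps / 2. Proof. by rewrite /beta; field; rewrite gt_eqF. Qed.

Lemma harris_step (phi : T -> R) : adm phi ->
  (forall x y, phi x - phi y <= 2 + beta * (V x + V y)) ->
  forall x y, P phi x - P phi y <= (1 - eps / 4) * (2 + beta * (V x + V y)).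
Proof.
move=> aphi osc x y.
have [c hc] : exists c, forall z, `|phi z + c| <= 1 + beta * V z.
  (* The oscillation bound places every [- (1 + beta V z) - phi z] below every
     [1 + beta V w - phi w]; the infimum [c] of the latter separates the two families. *)
  pose S := [set 1 + beta * V z - phi z | z in [set: T]].
  have S0 : S !=set0 by exists (1 + beta * V x - phi x); exists x.
  have lbS z : lbound S (- (1 + beta * V z) - phi z).
    by move=> _ [w _ <-]; have := osc w z; lra.
  exists (inf S) => z; rewrite ler_norml; apply/andP; split.
    by have := lb_le_inf S0 (lbS z); lra.
  have : inf S <= 1 + beta * V z - phi z.
    by apply: ge_inf; [exists (- (1 + beta * V x) - phi x)|exists z].
  by lra.
pose psi z := phi z + c.
have apsi : adm psi by apply: adm_D => //; exact: adm_cst.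
have -> : P phi x - P phi y = P psi x - P psi y.
  by rewrite !(markov_D mkP)//; [rewrite !(markov_cst mkP); ring|exact: adm_cst|exact: adm_cst].
have aW k : adm (fun z => k + beta * V z).
  by apply: adm_D; [exact: adm_cst|apply: adm_Z; exact: adm_V].
have PW k z : P (fun z => k + beta * V z) z = k + beta * P V z.
  rewrite (markov_D mkP) ?(markov_cst mkP) ?(markov_Z mkP)//.
  - exact: adm_V.
  - exact: adm_cst.
  - by apply: adm_Z; exact: adm_V.
have bound k f : adm f -> (forall z, `|f z| <= k + beta * V z) -> 
    P f x - P f y <= 2 * k + beta * ((V x + V y) / 2 + 2 * b).
  move=> af hf.
  have h1 : P f x <= k + beta * P V x.
    by rewrite -PW; apply: markov_le => // z; have := hf z; rewrite ler_norml => /andP[].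
  have h2 : - (k + beta * P V y) <= P f y.
    have := markov_Z mkP (-1) y (aW k); rewrite PW mulN1r => <-.
    apply: markov_le => //; first exact: adm_Z.
    by move=> z; have := hf z; rewrite ler_norml mulN1r => /andP[].
  have h3 : beta * P V x <= beta * (V x / 2 + b) by rewrite ler_pM2l.
  have h4 : beta * P V y <= beta * (V y / 2 + b) by rewrite ler_pM2l.
  by lra.
have Vx := V_gt0 x; have Vy := V_gt0 y.
have bE : beta * ((V x + V y) / 2 + 2 * b) = beta * (V x + V y) / 2 + eps.
  rewrite (_ : beta * _ = beta * (V x + V y) / 2 + 2 * (beta * b)); last by ring.
  by rewrite beta_b; field.
have W0 : 0 <= beta * (V x + V y) by rewrite mulr_ge0// ltW// addr_gt0.
have We : 0 <= beta * (V x + V y) * (2^-1 - eps) by rewrite mulr_ge0// subr_ge0.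
(* For [V x + V y > 8 b] one has [beta (V x + V y) >= 4 eps]: halving this term pays both for the
   additive [eps] and for the contraction of the constant 2. *)
have [S8|S8] := leP (V x + V y) (8 * b); last first.
  apply: le_trans (bound 1 psi apsi hc) _.
  have : 4 * eps <= beta * (V x + V y).
    have := ltW S8; rewrite -(ler_pM2l beta_gt0); move: beta_b; lra.
  by rewrite bE; lra.
(* Truncation to [-1, 1]. As [|psi| <= 1 + beta V], the part cut off is at most [beta V]. *)
pose psi1 z := Num.max (-1) (Num.min 1 (psi z)).
have apsi1 : measurable_fun setT psi1.
  by apply: measurable_maxr => //; apply: measurable_minr => //; case: apsi.
have psi11 z : -1 <= psi1 z <= 1.
  by rewrite /psi1 le_max lexx/= ge_max ge_min lexx/= andbT; lra.
have {}apsi1 : adm psi1.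
  by apply: (adm_bounded (C := 1)) => // z; rewrite ler_norml psi11.
have psi2 z : `|psi z - psi1 z| <= 0 + beta * V z.
  have bV : 0 <= beta * V z by rewrite mulr_ge0// ltW// V_gt0.
  have := hc z; rewrite -/(psi z) /psi1 !ler_norml => /andP[h1 h2].
  have [h3|h3] := leP 1 (psi z).
    by have [|] := leP (-1) 1; lra.
  by have [|] := leP (-1) (psi z); lra.
have h1 : P psi1 x - P psi1 y <= 2 * (1 - eps).
  (* [minor] is about values in [0, 1]; undoing the affine rescaling doubles its bound. *)
  have e2 : adm (fun z => 2^-1 * psi1 z + 2^-1).
    by apply: adm_lin => //; exact: adm_cst.
  have := minor S8 e2; rewrite !(markov_lin mkP)//; [|exact: adm_cst|exact: adm_cst].
  rewrite !(markov_cst mkP) => h.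
  have : 2^-1 * P psi1 x + 2^-1 - (2^-1 * P psi1 y + 2^-1) <= 1 - eps.
    by apply: h => z; have := psi11 z; lra.
  by lra.
have h2 := bound 0 _ (adm_B apsi apsi1) psi2.
rewrite !(markov_B mkP)// in h2.
have {}h2 : P psi x - P psi1 x - (P psi y - P psi1 y) <= beta * (V x + V y) / 2 + eps.
  by rewrite bE mulr0 add0r in h2; exact: h2.
exact: harris_arith eps0 W0 We h1 h2.
Qed.

Lemma harris q (f : T -> R) a : 0 < a -> adm f ->
  (forall x y, f x - f y <= a * (2 + beta * (V x + V y))) ->
  forall x y, iter q P f x - iter q P f y <= a * (1 - eps / 4) ^+ q * (2 + beta * (V x + V y)).
Proof.
move=> a0 af osc; elim: q => [|q IH] x y; first by rewrite mulr1.
have r0 : 0 < 1 - eps / 4 by move: eps2; lra.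
have k0 : 0 < a * (1 - eps / 4) ^+ q by rewrite mulr_gt0// exprn_gt0.
have aq : adm (iter q P f) by have [h _ _ _] := markov_iter mkP q; exact: h.
(* Dividing by the current factor restores the normalized oscillation bound that [harris_step]
   expects. *)
have := @harris_step (fun z => (a * (1 - eps / 4) ^+ q)^-1 * iter q P f z) (adm_Z _ aq).
move: k0; rewrite exprSr mulrA; move: (a * _) IH => k IH k0 /(_ _ x y).
rewrite !(markov_Z mkP)// -mulrBr ler_pdivrMl// mulrA; apply => x' y'.
by rewrite -mulrBr ler_pdivrMl.
Qed.

End harris.
End weighted.

(** * Operators with a density *)

Section real_integral.
Context d (T : measurableType d) (R : realType) (mu : {measure set T -> \bar R}).
Implicit Types f g : T -> R.
Local Open Scope ereal_scope.

Lemma le_integral_real f g : measurable_fun setT f -> measurable_fun setT g ->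
  (forall x, 0 <= f x)%R -> (forall x, f x <= g x)%R ->
  \int[mu]_x (f x)%:E <= \int[mu]_x (g x)%:E.
Proof.
move=> mf mg f0 fg; apply: ge0_le_integral => //.
- by move=> x _; rewrite lee_fin.
- exact/measurable_EFinP.
- exact/measurable_EFinP.
- by move=> x _; rewrite lee_fin.
Qed.

Lemma integral_scale c f : (0 <= c)%R -> measurable_fun setT f -> (forall x, 0 <= f x)%R ->
  \int[mu]_x (c * f x)%:E = c%:E * \int[mu]_x (f x)%:E.
Proof.
move=> c0 mf f0; under eq_integral do rewrite EFinM.
rewrite ge0_integralZl_EFin//.
- by move=> x _; rewrite lee_fin.
- exact/measurable_EFinP.
Qed.

End real_integral.

Section kernel_operator.
Context d (T : measurableType d) (R : realType) (mu : {sigma_finite_measure set T -> \bar R}).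
Context (V : T -> R).
Hypothesis mV : measurable_fun setT V.
Hypothesis V1 : forall x, 1 <= V x.

Definition kop (p : T -> T -> R) (f : T -> R) (x : T) : R := \int[mu]_y (p x y * f y).

(** The last clause is boundedness on the space weighted by [V]: it makes the integrals of
    admissible functions finite and [adm V] stable under [kop p]. *)
Definition kgood (p : T -> T -> R) := [/\ measurable_fun setT (fun z : T * T => p z.1 z.2),
  forall x y, 0 <= p x y & exists C, forall x, (\int[mu]_y (p x y * V y)%:E <= (C * V x)%:E)%E].

Lemma measurable_section (p : T -> T -> R) x :
  measurable_fun setT (fun z : T * T => p z.1 z.2) -> measurable_fun setT (p x).
Proof. by move=> mp; exact: (measurableT_comp mp (pair1_measurable x)). Qed.

Lemma kgood_le (p q : T -> T -> R) : kgood p -> measurable_fun setT (fun z : T * T => q z.1 z.2) ->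
  (forall x y, 0 <= q x y <= p x y) -> kgood q.
Proof.
move=> [mp p0 [C pC]] mq qp; split => //; first by move=> x y; have /andP[] := qp x y.
exists C => x; apply: le_trans (pC x); apply: ge0_le_integral => //.
- by move=> y _; rewrite lee_fin mulr_ge0//; [have /andP[] := qp x y|rewrite ltW// (V_gt0 V1)].
- by apply/measurable_EFinP; apply: measurable_funM => //; exact: (@measurable_section q x).
- by apply/measurable_EFinP; apply: measurable_funM => //; exact: (@measurable_section p x).
- move=> y _; rewrite lee_fin ler_wpM2r//; first by rewrite ltW// (V_gt0 V1).
  by have /andP[] := qp x y.
Qed.

Section fixed_kernel.
Context (p : T -> T -> R).
Hypothesis gp : kgood p.

Let mp x : measurable_fun setT (p x).
Proof. by apply: measurable_section; case: gp. Qed.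

Lemma kop_integrable f x : adm V f -> mu.-integrable setT (EFin \o (fun y => p x y * f y)).
Proof.
move=> [mf [C fC]]; have [_ p0 [D pD]] := gp.
have iV : mu.-integrable setT (EFin \o (fun y => p x y * V y)).
  apply/integrableP; split; first by apply/measurable_EFinP; exact: measurable_funM.
  under eq_integral => y _ do rewrite /= ger0_norm ?mulr_ge0// ?(ltW (V_gt0 V1 _))//.
  exact: le_lt_trans (pD x) (ltry _).
have iCV := integrableZl measurableT C iV.
apply: (le_integrable measurableT _ _ iCV).
  by apply/measurable_EFinP; exact: measurable_funM.
move=> y _ /=; rewrite lee_fin.
rewrite mulrCA !normrM ler_wpM2l// (le_trans (fC y))//.
by rewrite -normrM ler_norm.
Qed.

Lemma kopE f x : adm V f -> (\int[mu]_y (p x y * f y)%:E)%E = (kop p f x)%:E.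
Proof.
by move=> af; rewrite /kop /Rintegral fineK//; apply: integrable_fin_num => //; exact: kop_integrable.
Qed.

Lemma kop_lin a f g x : adm V f -> adm V g ->
  kop p (fun y => a * f y + g y) x = a * kop p f x + kop p g x.
Proof.
move=> af ag; rewrite /kop.
rewrite -(RintegralZl _ measurableT (kop_integrable x af)) -RintegralD//; last 2 first.
- have := integrableZl measurableT a (kop_integrable x af).
  by apply: eq_integrable.
- exact: kop_integrable.
by apply: eq_Rintegral => y _; ring.
Qed.

Lemma kop_le f g x : adm V f -> adm V g -> (forall y, f y <= g y) -> kop p f x <= kop p g x.
Proof.
move=> af ag fg; apply: le_Rintegral => //; [exact: kop_integrable|exact: kop_integrable|].
by move=> y _; apply: ler_wpM2l => //; case: gp.
Qed.

Lemma kop_ub f x c : adm V f -> (\int[mu]_y (p x y * f y)%:E <= c%:E)%E -> kop p f x <= c.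
Proof. by move=> af; rewrite kopE// lee_fin. Qed.

Lemma measurable_kop_ge0 f : adm V f -> (forall x, 0 <= f x) -> measurable_fun setT (kop p f).
Proof.
move=> [mf _] f0; have [mp2 p0 _] := gp.
apply: (measurableT_comp (fine_measurable _)) => //.
apply: (@measurable_fun_fubini_tonelli_F _ _ _ _ _ mu (fun z : T * T => (p z.1 z.2 * f z.2)%:E)) => [|z].
  by apply/measurable_EFinP; apply: measurable_funM => //; exact: measurableT_comp.
by rewrite lee_fin mulr_ge0.
Qed.

Lemma kop_adm f : adm V f -> adm V (kop p f).
Proof.
move=> af; have [mf [C0 fC0]] := af; have [_ p0 [D pD]] := gp.
have [C [C_ge0 fC]] : exists C, 0 <= C /\ forall x, `|f x| <= C * V x.
  exists `|C0|; split=> // x; rewrite (le_trans (fC0 x))// ler_wpM2r ?ler_norm//.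
  by rewrite ltW// (V_gt0 V1).
have aV := adm_V mV V1.
have aCV : adm V (fun y => C * V y) by exact: adm_Z.
have hD x : kop p V x <= D * V x by apply: kop_ub.
have KZ c x : kop p (fun y => c * V y) x = c * kop p V x.
  rewrite /kop -(RintegralZl _ measurableT (kop_integrable x aV)).
  by apply: eq_Rintegral => y _; rewrite mulrCA.
split.
(* Tonelli gives measurability in [x] for nonnegative integrands, so [C V] is added and then
   subtracted. *)
- have a1 : adm V (fun y => 1 * f y + C * V y) by exact: adm_lin.
  have -> : kop p f = (fun x => kop p (fun y => 1 * f y + C * V y) x - C * kop p V x).
    by apply/funext => x; rewrite kop_lin// KZ; ring.
  apply: measurable_funB.
    apply: measurable_kop_ge0 => // x.
    by have := fC x; rewrite ler_norml => /andP[]; lra.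
  apply: measurable_funM => //; apply: measurable_kop_ge0 => // x.
  by rewrite ltW// (V_gt0 V1).
- exists (C * D) => x; rewrite ler_norml; apply/andP; split.
    have h : - C * kop p V x <= kop p f x.
      rewrite -KZ; apply: kop_le => //; first exact: adm_Z.
      by move=> y; have := fC y; rewrite mulNr ler_norml => /andP[].
    have := ler_wpM2l C_ge0 (hD x); lra.
  have h : kop p f x <= C * kop p V x.
    by rewrite -KZ; apply: kop_le => // y; have := fC y; rewrite ler_norml => /andP[].
  by have := ler_wpM2l C_ge0 (hD x); lra.
Qed.

End fixed_kernel.
End kernel_operator.

(** * Gaussian exponential moments *)

Section gauss_exp.
Context (R : realType) (d : nat).
Implicit Types (y a w : 'rV[R]_d).

(** Completing the square: the quadratic weight turns the Gaussian into another Gaussian density,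
    with rescaled variance and mean, times its moment. *)
Lemma gdens_exp gamma k y a : 0 < gamma -> 4 * k * gamma < 1 ->
  gdens gamma (y - a) * expR (k * enorm y ^+ 2) =
  powR (1 - 4 * k * gamma) (- (d%:R / 2)) * expR (k * enorm a ^+ 2 / (1 - 4 * k * gamma)) *
  gdens (gamma / (1 - 4 * k * gamma)) (y - (1 - 4 * k * gamma)^-1 *: a).
Proof.
move=> g0 kg; have u0 : 0 < 1 - 4 * k * gamma by rewrite subr_gt0.
rewrite /gdens.
rewrite (_ : 4 * pi * gamma = (1 - 4 * k * gamma) * (4 * pi * (gamma / (1 - 4 * k * gamma)))); last first.
  by field; rewrite gt_eqF.
rewrite [in LHS]powRM; last 2 first.
- exact: ltW.
- by rewrite ltW// !mulr_gt0 ?pi_gt0// invr_gt0.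
move: (powR _ _) (powR _ _) => p q.
rewrite [LHS](_ : _ = p * q * (expR (- enorm (y - a) ^+ 2 / (4 * gamma)) * expR (k * enorm y ^+ 2))); last by ring.
rewrite [RHS](_ : _ = p * q * (expR (k * enorm a ^+ 2 / (1 - 4 * k * gamma)) *
   expR (- enorm (y - (1 - 4 * k * gamma)^-1 *: a) ^+ 2 / (4 * (gamma / (1 - 4 * k * gamma)))))); last by ring.
congr (_ * _); rewrite -!expRD; congr expR.
rewrite !enormE !edotE (edotC a y).
by field; rewrite !gt_eqF.
Qed.

Lemma integral_gdens_exp gamma k a : 0 < gamma -> 4 * k * gamma < 1 ->
  (\int[@lebRV R d]_y (gdens gamma (y - a) * expR (k * enorm y ^+ 2))%:E =
  (powR (1 - 4 * k * gamma) (- (d%:R / 2)) * expR (k * enorm a ^+ 2 / (1 - 4 * k * gamma)))%:E)%E.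
Proof.
move=> g0 kg; have u0 : 0 < 1 - 4 * k * gamma by rewrite subr_gt0.
have g1 : 0 < gamma / (1 - 4 * k * gamma) by rewrite divr_gt0.
under eq_integral do rewrite gdens_exp// EFinM.
rewrite ge0_integralZl_EFin//.
- by rewrite integral_gdens// mule1.
- by move=> y _; rewrite lee_fin ltW// gdens_gt0.
- apply/measurable_EFinP; apply: measurable_gdens; exact: measurable_rv_shift.
- by rewrite mulr_ge0 ?powR_ge0 ?expR_ge0.
Qed.

(* [E exp (|z|^2 / 4)] for a standard Gaussian [z] on [R^d]. *)
Definition gmom : R := powR 2^-1 (- (d%:R / 2)).

Lemma gmom_ge0 : 0 <= gmom. Proof. exact: powR_ge0. Qed.

Lemma integral_gdens_moment gamma a : 0 < gamma ->
  (\int[@lebRV R d]_y (gdens gamma (y + a) * expR (enorm (y + a) ^+ 2 / (8 * gamma)))%:E =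
  gmom%:E)%E.
Proof.
move=> g0.
rewrite (integral_shift a (f := fun w => (gdens gamma w * expR (enorm w ^+ 2 / (8 * gamma)))%:E)).
- have k1 : 1 - 4 * (8 * gamma)^-1 * gamma = 2^-1 :> R by field; rewrite gt_eqF.
  have := @integral_gdens_exp gamma (8 * gamma)^-1 0 g0.
  rewrite k1 enorm0 expr0n/= mulr0 mul0r expR0 mulr1 -/gmom => <-.
    by apply: eq_integral => y _; rewrite subr0 [_ / _]mulrC.
  by move: k1; lra.
- apply/measurable_EFinP; apply: measurable_funM; first exact: measurable_gdens.
  apply: (measurableT_comp (@measurable_expR R)); apply: measurable_funM => //.
  exact: measurable_enorm.
- by move=> w; rewrite lee_fin mulr_ge0 ?expR_ge0// ltW// gdens_gt0.
Qed.

(** Integrand of the chi-square divergence of two translated Gaussians. Its mass can be read off,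
    since the right-hand side is a constant times a Gaussian density. *)
Lemma gdens_sqr_div gamma w v : 0 < gamma ->
  gdens gamma w ^+ 2 / gdens gamma (w + v) =
  expR (enorm v ^+ 2 / (2 * gamma)) * gdens gamma (w - v).
Proof.
move=> g0.
have p0 : 0 < powR (4 * pi * gamma) (- (d%:R / 2)) by rewrite powR_gt0// !mulr_gt0// pi_gt0.
have n0 : gdens gamma (w + v) != 0 by rewrite gt_eqF// gdens_gt0.
apply: (mulIf n0); rewrite divfK//.
rewrite /gdens; set c := powR _ _.
rewrite (_ : (c * _) ^+ 2 = c ^+ 2 * (expR (- enorm w ^+ 2 / (4 * gamma)) * expR (- enorm w ^+ 2 / (4 * gamma)))); last by ring.
rewrite [RHS](_ : _ = c ^+ 2 * (expR (enorm v ^+ 2 / (2 * gamma)) *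
   expR (- enorm (w - v) ^+ 2 / (4 * gamma)) * expR (- enorm (w + v) ^+ 2 / (4 * gamma)))); last by ring.
congr (_ * _); rewrite -!expRD; congr expR.
rewrite !enormE !edotE (edotC v w).
by field; rewrite gt_eqF.
Qed.

End gauss_exp.

(** Serves to absorb the cubic factors of the trapezoid error, in the noise and in [|x|], into a
    Gaussian moment and into [V]. It follows from [(1 + u)^3 <= 4 (1 + u^2)^2] and
    [c (1 + u^2) <= exp (k u^2 / 2)]. *)
Lemma cube_le_exp (R : realType) (k : R) : 0 < k ->
  exists C, 0 <= C /\ forall u, 0 <= u -> (1 + u) ^+ 3 <= C * expR (k * u ^+ 2).
Proof.
move=> k0; pose c := Num.min 1 (k / 2).
have c0 : 0 < c by rewrite lt_min ltr01/= divr_gt0.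
exists (4 / c ^+ 2); split; first by rewrite divr_ge0// exprn_ge0// ltW.
move=> u u0; pose v := u ^+ 2.
have v0 : 0 <= v by rewrite sqr_ge0.
have h1 : c * (1 + v) <= expR (k / 2 * v).
  apply: le_trans (expR_ge1Dx _).
  have : c <= 1 by rewrite ge_min lexx.
  have : c <= k / 2 by rewrite ge_min lexx orbT.
  by move=> /(ler_wpM2r v0); lra.
have h2 : (c * (1 + v)) ^+ 2 <= expR (k * v).
  rewrite (_ : k * v = k / 2 * v + k / 2 * v); last by field.
  rewrite expRD expr2; apply: ler_pM => //; by rewrite mulr_ge0 ?addr_ge0// ltW.
have h3 : (1 + u) ^+ 3 <= 4 * (1 + v) ^+ 2.
  have h : (1 + u) ^+ 2 <= 2 * (1 + v) by rewrite /v; have := sqr_ge0 (u - 1); lra.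
  have h4 : (1 + u) ^+ 4 <= 4 * (1 + v) ^+ 2.
    rewrite (_ : (1 + u) ^+ 4 = (1 + u) ^+ 2 * (1 + u) ^+ 2); last by ring.
    rewrite (_ : 4 * _ = (2 * (1 + v)) * (2 * (1 + v))); last by ring.
    by apply: ler_pM; rewrite ?sqr_ge0.
  apply: le_trans h4; rewrite [leRHS]exprS ler_peMl ?exprn_ge0 ?addr_ge0//; lra.
apply: le_trans h3 _; rewrite -mulrA ler_pM2l// mulrC ler_pdivlMr ?exprn_gt0//.
by rewrite mulrC -exprMn.
Qed.

Lemma one_sub_min_exp (R : realType) (l B : R) : 0 <= B -> - B <= l -> 1 - Num.min 1 (expR l) <= B.
Proof.
move=> B0 Bl; have := expR_ge1Dx l; rewrite minEle; case: ifP => _; lra.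
Qed.

(** * The target density and the acceptance ratio *)

(* The only consequences of (i)-(iii) used about the chain. *)
Record regular_potential (R : realType) (d : nat) (U : 'rV[R]_d -> R) (L M m K : R) : Prop := {
  rp_L0 : 0 <= L; rp_M0 : 0 <= M; rp_m0 : 0 < m; rp_K0 : 0 <= K;
  rp_mU : measurable_fun setT U;
  rp_mg : measurable_fun setT (grad U);
  rp_g0 : grad U 0 = 0;
  rp_lip : forall x y, enorm (grad U y - grad U x) <= L * enorm (y - x);
  rp_dissip : forall x, m * enorm x ^+ 2 - (L + m) * K * enorm x <= edot (grad U x) x;
  rp_lb : forall x, U 0 + m / 2 * enorm x ^+ 2 - (L + m) * K * enorm x <= U x;
  rp_ub : forall x, U x <= U 0 + L * enorm x ^+ 2;
  rp_bregman : forall x h, (forall t : R, 0 <= t <= 1 -> K <= enorm (x + t *: h)) ->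
    m / 2 * enorm h ^+ 2 <= U x - U (x + h) + edot (grad U (x + h)) h;
  rp_trapezoid : forall x h,
    `|U x - U (x + h) + edot (grad U x + grad U (x + h)) h / 2| <= M * enorm h ^+ 3 }.

Lemma regular_potentialP (R : realType) (d : nat) (U : 'rV[R]_d -> R) (L M m K : R) :
  C2 U -> grad U 0 = 0 -> 0 <= L ->
  (forall x y z, `| D2 U x y z | <= L * enorm y * enorm z) ->
  C3 U -> 0 <= M ->
  (forall x a b c, `| D3 U x a b c | <= M * enorm a * enorm b * enorm c) ->
  0 < m -> 0 <= K ->
  (forall x y, K <= enorm x -> enorm y = 1 -> m <= D2 U x y y) ->
  regular_potential U L M m K.
Proof.
move=> U2 gU0 L0 UL U3 M0 UM m0 K0 Um; split => //.
- exact: measurable_U.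
- exact: measurable_grad.
- exact: grad_lip.
- exact: grad_dissip.
- exact: U_lb.
- exact: U_ub.
- by move=> x h; exact: bregman_ge.
- exact: trapezoid_le.
Qed.

Section mala_density.
Context (R : realType) (d : nat) (U : 'rV[R]_d -> R) (L M m K : R).
Hypothesis H : regular_potential U L M m K.
Implicit Types (x y : 'rV[R]_d) (gamma : R).

Local Notation g := (grad U).
Local Notation V := (@Vexp R d (m / 16)).
Local Notation mu := (@lebRV R d).

Let m0 : 0 < m := rp_m0 H.
Let L0 : 0 <= L := rp_L0 H.
Let M0 : 0 <= M := rp_M0 H.

Lemma Vexp_ge1 x : 1 <= V x.
Proof.
by rewrite /Vexp -[X in X <= _]expR0 ler_expR mulr_ge0 ?exprn_ge0 ?enorm_ge0// divr_ge0// ltW.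
Qed.

Lemma measurable_Vexp : measurable_fun setT V.
Proof.
apply: (measurableT_comp (@measurable_expR R)); apply: measurable_funM => //.
by apply: measurable_enorm.
Qed.

Lemma measurable_expU : measurable_fun setT (fun x => expR (- U x)).
Proof.
apply: (measurableT_comp (@measurable_expR R)); apply: measurableT_comp => //.
exact: rp_mU H.
Qed.

(** [U] grows like [m |x|^2 / 2] and the exponent of [V] is [m |x|^2 / 16]: there is room for the
    Gaussian exponent [- m |x|^2 / 8], that of [gamma = 2 / m], and for the linear defect, absorbed
    by completing a square. *)
Lemma expU_V_le : exists C, 0 <= C /\ forall x, expR (- U x) * V x <= C * gdens (2 / m) x.
Proof.
have gm : 0 < 2 / m by rewrite divr_gt0.
pose p := powR (4 * pi * (2 / m)) (- (d%:R / 2)).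
have p0 : 0 < p by rewrite powR_gt0// !mulr_gt0// ?pi_gt0// invr_gt0.
pose c1 := (L + m) * K.
exists (expR (- U 0 + c1 ^+ 2 / m) / p); split; first by rewrite divr_ge0 ?expR_ge0// ltW.
move=> x; rewrite /gdens -/p mulrA divfK ?gt_eqF// /Vexp -!expRD ler_expR.
have := rp_lb H x; rewrite -/c1; move: (enorm x) => X h.
have -> : - X ^+ 2 / (4 * (2 / m)) = - (m / 8) * X ^+ 2 by field; rewrite gt_eqF.
have : 0 <= m * (X / 2 - c1 / m) ^+ 2 by rewrite mulr_ge0 ?sqr_ge0// ltW.
have -> : m * (X / 2 - c1 / m) ^+ 2 = m * X ^+ 2 / 4 - c1 * X + c1 ^+ 2 / m.
  by field; rewrite gt_eqF.
have : 0 <= m * X ^+ 2 by rewrite mulr_ge0 ?sqr_ge0// ltW.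
move: (c1 ^+ 2 / m) h => q; move: (U x) (U 0) => Ux Uz; lra.
Qed.

(** This lower bound makes the normalizing constant positive; [L + 1] in place of [L] keeps the
    variance defined when [L = 0]. *)
Lemma expU_ge : exists c, 0 < c /\ forall x, c * gdens (4 * (L + 1))^-1 x <= expR (- U x).
Proof.
have gm : 0 < (4 * (L + 1))^-1 by rewrite invr_gt0 mulr_gt0// ltr_wpDl.
pose p := powR (4 * pi * (4 * (L + 1))^-1) (- (d%:R / 2)).
have p0 : 0 < p by rewrite powR_gt0// !mulr_gt0// ?pi_gt0// invr_gt0.
exists (expR (- U 0) / p); split; first by rewrite divr_gt0 ?expR_gt0.
move=> x; rewrite /gdens -/p mulrA divfK ?gt_eqF// -!expRD ler_expR.
have := rp_ub H x; move: (enorm x) => X h.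
have -> : - X ^+ 2 / (4 * (4 * (L + 1))^-1) = - (L + 1) * X ^+ 2.
  by field; rewrite gt_eqF// ltr_wpDl.
have := sqr_ge0 X; move: h; move: (U x) (U 0) => Ux Uz; lra.
Qed.

Lemma measurable_gdens0 gamma : measurable_fun setT (fun x : 'rV[R]_d => gdens gamma (x + 0)).
Proof. by apply: measurable_gdens; exact: measurable_rv_shift. Qed.

Lemma integral_scale_gdens gamma c : 0 < gamma -> 0 <= c ->
  (\int[mu]_x (c * gdens gamma (x + 0))%:E = c%:E)%E.
Proof.
move=> g0 c0; rewrite integral_scale//; last 2 first.
- exact: measurable_gdens0.
- by move=> x; rewrite ltW// gdens_gt0.
by rewrite integral_gdens// mule1.
Qed.

Lemma measurable_expU_V : measurable_fun setT (fun x => expR (- U x) * V x).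
Proof. by apply: measurable_funM; [exact: measurable_expU|exact: measurable_Vexp]. Qed.

Lemma integral_expU_V : exists C, (\int[mu]_x (expR (- U x) * V x)%:E <= C%:E)%E.
Proof.
have [C [C0 hC]] := expU_V_le; exists C.
have gm : 0 < 2 / m by rewrite divr_gt0.
rewrite -[leRHS](integral_scale_gdens gm C0); apply: le_integral_real => [| |x|x].
- exact: measurable_expU_V.
- by apply: measurable_funM => //; exact: measurable_gdens0.
- by rewrite mulr_ge0 ?expR_ge0.
- by rewrite addr0.
Qed.

(** [Zconst] is a [fine], which is 0 on an infinite integral; the Gaussian bounds from both sides
    exclude an infinite as well as a null integral. *)
Lemma Zconst_gt0E : 0 < Zconst U /\ (\int[mu]_x (expR (- U x))%:E = (Zconst U)%:E)%E.
Proof.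
have [C hC] := integral_expU_V; have [c [c0 hc]] := expU_ge.
have gm : 0 < (4 * (L + 1))^-1 by rewrite invr_gt0 mulr_gt0// ltr_wpDl.
have ub : (\int[mu]_x (expR (- U x))%:E <= C%:E)%E.
  apply: le_trans hC; apply: le_integral_real => [| |x|x].
  - exact: measurable_expU.
  - exact: measurable_expU_V.
  - exact: expR_ge0.
  - by rewrite ler_peMr ?expR_ge0// Vexp_ge1.
have lb : (c%:E <= \int[mu]_x (expR (- U x))%:E)%E.
  rewrite -[leLHS](integral_scale_gdens gm (ltW c0)); apply: le_integral_real => [| |x|x].
  - by apply: measurable_funM => //; exact: measurable_gdens0.
  - exact: measurable_expU.
  - by rewrite mulr_ge0// ltW// gdens_gt0.
  - by rewrite addr0.
have fin : (\int[mu]_x (expR (- U x))%:E \is a fin_num)%E.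
  by rewrite fin_numElt (lt_le_trans _ lb) ?ltNyr//= (le_lt_trans ub) ?ltry.
rewrite /Zconst fineK//; split=> //.
by rewrite -lte_fin fineK// (lt_le_trans _ lb)// lte_fin.
Qed.

Lemma pidens_gt0 x : 0 < pidens U x.
Proof. by have [Z0 _] := Zconst_gt0E; rewrite divr_gt0 ?expR_gt0. Qed.

Lemma measurable_pidens : measurable_fun setT (pidens U).
Proof. by apply: measurable_funM => //; exact: measurable_expU. Qed.

Lemma integral_pidens : (\int[mu]_x (pidens U x)%:E = 1)%E.
Proof.
have [Z0 ZE] := Zconst_gt0E.
under eq_integral do rewrite /pidens mulrC.
rewrite integral_scale ?invr_ge0 1?ltW//; last exact: measurable_expU.
by rewrite ZE -EFinM mulVf ?gt_eqF.
Qed.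

Lemma integral_pidens_V : exists A, (\int[mu]_x (pidens U x * V x)%:E <= A%:E)%E.
Proof.
have [Z0 _] := Zconst_gt0E; have [C hC] := integral_expU_V.
exists ((Zconst U)^-1 * C).
under eq_integral do rewrite /pidens mulrAC mulrC.
rewrite integral_scale.
- by rewrite EFinM lee_pmul2l// lte_fin invr_gt0.
- by rewrite invr_ge0 ltW.
- exact: measurable_expU_V.
- by move=> x; rewrite mulr_ge0 ?expR_ge0.
Qed.

Definition logacc gamma x y := U x - U y +
  (enorm (y - x + gamma *: g x) ^+ 2 - enorm (x - y + gamma *: g y) ^+ 2) / (4 * gamma).

Lemma acceptE gamma x y : 0 < gamma -> accept U gamma x y = Num.min 1 (expR (logacc gamma x y)).
Proof.
have ratio (p Z u v a b : R) : p != 0 -> Z != 0 ->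
    expR (- v) / Z * (p * expR b) / (expR (- u) / Z * (p * expR a)) = expR (u - v + (b - a)).
  move=> p0 Z0; rewrite !expRD !expRN.
  have := gt_eqF (expR_gt0 u); have := gt_eqF (expR_gt0 v); have := gt_eqF (expR_gt0 a).
  move: (expR u) (expR v) (expR a) (expR b) => eu ev ea eb /negbT a0 /negbT v0 /negbT u0.
  by field; rewrite a0 v0 u0 p0 Z0.
have split (u v a b c : R) : u - v + (a - b) / c = u - v + (- b / c - - a / c) by ring.
move=> g0; congr (Num.min 1 _).
have [Z0 _] := Zconst_gt0E.
have p0 : 0 < powR (4 * pi * gamma) (- (d%:R / 2)) by rewrite powR_gt0// !mulr_gt0// pi_gt0.
rewrite /logacc split; apply: ratio; by rewrite gt_eqF.
Qed.

Lemma rprop_gt0 gamma x y : 0 < gamma -> 0 < rprop U gamma x y.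
Proof. exact: gdens_gt0. Qed.

Lemma accept_itv gamma x y : 0 < gamma -> 0 <= accept U gamma x y <= 1.
Proof. by move=> g0; rewrite acceptE// le_min ler01 expR_ge0/= ge_min lexx. Qed.

(** Detailed balance: both sides are the minimum of the joint densities [pi(x) r(x, y)] and
    [pi(y) r(y, x)]. *)
Lemma accept_sym gamma x y : 0 < gamma ->
  pidens U x * (accept U gamma x y * rprop U gamma x y) =
  pidens U y * (accept U gamma y x * rprop U gamma y x).
Proof.
have minM (p a r b : R) : 0 < p * r -> a = Num.min 1 (b / (p * r)) -> p * (a * r) = Num.min (p * r) b.
  move=> pr0 ->; rewrite mulrCA minr_pMl ?mul1r ?divfK//; first by rewrite gt_eqF.
  exact: ltW.
move=> g0; have h u v : pidens U u * (accept U gamma u v * rprop U gamma u v) =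
    Num.min (pidens U u * rprop U gamma u v) (pidens U v * rprop U gamma v u).
  by apply: minM; first exact: mulr_gt0 (pidens_gt0 u) (rprop_gt0 u v g0).
exact: etrans (h x y) (etrans (minC _ _) (esym (h y x))).
Qed.

(** Trapezoid form: the potential part is of third order in [y - x], the last term is [gamma] times
    a first-order one. For [y - x] of order [sqrt gamma], both are of order [gamma^(3/2)]. *)
Lemma logaccE gamma x y : 0 < gamma -> logacc gamma x y =
  U x - U y + edot (g x + g y) (y - x) / 2 + gamma / 4 * (enorm (g x) ^+ 2 - enorm (g y) ^+ 2).
Proof.
move=> g0; have id (u v : R) (h a b : 'rV[R]_d) :
    u - v + (enorm (h + gamma *: a) ^+ 2 - enorm (- h + gamma *: b) ^+ 2) / (4 * gamma) =
    u - v + edot (a + b) h / 2 + gamma / 4 * (enorm a ^+ 2 - enorm b ^+ 2).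
  rewrite !enormE !edotE !(edotC h).
  move: (edot h h) (edot a a) (edot b b) (edot a h) (edot b h) => r1 r2 r3 r4 r5.
  by field; rewrite gt_eqF.
by have := id (U x) (U y) (y - x) (g x) (g y); rewrite opprB; apply.
Qed.

Lemma grad_le_rp x : enorm (g x) <= L * enorm x.
Proof. by have := rp_lip H 0 x; rewrite (rp_g0 H) !subr0. Qed.

Lemma disp_le gamma x y : 0 < gamma ->
  enorm (y - x) <= enorm (y - x + gamma *: g x) + gamma * L * enorm x.
Proof.
move=> g0; have id (h a : 'rV[R]_d) : enorm h <= enorm (h + gamma *: a) + gamma * enorm a.
  have := enormD (h + gamma *: a) (- (gamma *: a)).
  by rewrite addrK enormN enormZ gtr0_norm.
apply: le_trans (id (y - x) (g x)) _; rewrite lerD2l -mulrA ler_pM2l//.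
exact: grad_le_rp.
Qed.

(** Bregman form: the remaining terms involve only the increment of the gradient, so no factor
    growing with [|x|] appears. *)
Lemma logacc_tail gamma x y : 0 < gamma -> logacc gamma x y = U x - U y + edot (g y) (y - x)
  - edot (g y - g x) (y - x + gamma *: g x) / 2 - gamma / 4 * enorm (g y - g x) ^+ 2.
Proof.
move=> g0; rewrite logaccE//.
have id (u v : R) (h a b : 'rV[R]_d) : u - v + edot (a + b) h / 2 + gamma / 4 * (enorm a ^+ 2 - enorm b ^+ 2) =
    u - v + edot b h - edot (b - a) (h + gamma *: a) / 2 - gamma / 4 * enorm (b - a) ^+ 2.
  rewrite !enormE !edotE (edotC a b).
  move: (edot a a) (edot b b) (edot a h) (edot b h) (edot b a) => r2 r3 r4 r5 r6.
  by field.
exact: id.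
Qed.

Lemma accept_ge_tail gamma x y : 0 < gamma -> gamma * L <= 4^-1 -> gamma * L ^+ 2 <= m ->
  1 <= enorm x -> 2 * K <= enorm x ->
  1 - accept U gamma x y <= (16 + L ^+ 2 / (4 * m)) * enorm (y - x + gamma *: g x) ^+ 2.
Proof.
move=> g0 gL gL2 X1 XK.
have C0 : 0 <= L ^+ 2 / (4 * m) by rewrite divr_ge0 ?sqr_ge0// mulr_ge0// ltW.
have hle := disp_le x y g0.
have breg := rp_bregman H (x := x) (h := y - x).
rewrite (addrC x (y - x)) subrK in breg.
have Dle := rp_lip H x y.
have Dw := edot_le (g y - g x) (y - x + gamma *: g x).
have ell := logacc_tail x y g0.
have seg t : 0 <= t <= 1 -> enorm x - enorm (y - x) <= enorm (x + t *: (y - x)).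
  move=> /andP[t0 t1]; have id (h : 'rV[R]_d) : enorm x - enorm h <= enorm (x + t *: h).
    have := enormD (x + t *: h) (- (t *: h)); rewrite addrK enormN enormZ ger0_norm//.
    have := ler_wpM2r (enorm_ge0 h) t1; rewrite mul1r.
    move: (enorm x) (enorm h) (enorm (x + _)) => r1 r2 r3; lra.
  exact: id.
have := accept_itv x y g0; rewrite acceptE// => /andP[acc0 _].
have w0 := enorm_ge0 (y - x + gamma *: g x); have h0 := enorm_ge0 (y - x).
have D0 := enorm_ge0 (g y - g x).
move: (enorm (y - x + gamma *: g x)) (enorm (g y - g x)) (edot (g y - g x) _) w0 D0 ell hle Dle Dw => w D Dw' w0 D0 ell hle Dle Dw.
(* A noise above [|x| / 4 >= 1 / 4] makes the bound trivial, as [16 w^2 >= 1]. Otherwise the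
   displacement is at most [|x| / 2], the segment stays outside the ball of radius [K], and the
   Bregman term [m h^2 / 2] absorbs the gradient square with one half and the mixed term, up to
   [L^2 w^2 / (4 m)], with the other. *)
have [wX|wX] := leP w (enorm x / 4); last first.
  have : 1 <= 16 * w ^+ 2.
    have h : 1 <= 4 * w by move: X1 wX; move: (enorm x) => X; lra.
    have := ler_pM ler01 ler01 h h; lra.
  have := mulr_ge0 C0 (sqr_ge0 w); move: acc0; move: (Num.min _ _) (L ^+ 2 / _) => A q; lra.
have hX : enorm (y - x) <= enorm x / 2.
  have : gamma * L * enorm x <= 4^-1 * enorm x by rewrite ler_wpM2r// enorm_ge0.
  move: hle wX; move: (enorm x) (enorm (y - x)) => X h; lra.
have {}breg : m / 2 * enorm (y - x) ^+ 2 <= U x - U y + edot (g y) (y - x).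
  apply: breg => t t01; apply: le_trans (seg t t01).
  by move: hX XK; move: (enorm x) (enorm (y - x)) => X h; lra.
move: (enorm (y - x)) h0 hle Dle hX breg => h h0 hle Dle hX breg.
apply: le_trans (one_sub_min_exp (B := L ^+ 2 / (4 * m) * w ^+ 2) _ _) _.
- by rewrite mulr_ge0// sqr_ge0.
- rewrite ell; move: breg Dw; move: (U x - U y + _) => u breg Dw.
  have h1 : D * w <= L * h * w by rewrite ler_wpM2r.
  have h2 : gamma * D ^+ 2 <= m * h ^+ 2.
    apply: (@le_trans _ _ (gamma * (L * h) ^+ 2)).
      by rewrite ler_pM2l// lerXn2r ?nnegrE// mulr_ge0.
    by rewrite exprMn mulrA ler_wpM2r// sqr_ge0.
  have h3 : 0 <= m * (h / 2 - L * w / (2 * m)) ^+ 2 by rewrite mulr_ge0 ?sqr_ge0// ltW.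
  have h4 : m * (h / 2 - L * w / (2 * m)) ^+ 2 =
      m * h ^+ 2 / 4 - L * h * w / 2 + L ^+ 2 / (4 * m) * w ^+ 2.
    by field; rewrite gt_eqF.
  rewrite h4 in h3; move: (L ^+ 2 / (4 * m) * w ^+ 2) h3 => q h3; lra.
- by rewrite ler_wpM2r ?sqr_ge0// lerDr.
Qed.

(** Here [s = sqrt gamma], [z] is the noise in units of [s], [X = |x|] and [h] is the displacement,
    bounded by [s (1 + L) Q] with [Q = (1 + z) (1 + X)]. The second term already has [s^2], so only
    its leading factor [h] has to supply another [s]. *)
Lemma accept_ge_arith (s X z h : R) : 0 < s -> s <= 1 -> 0 <= X -> 0 <= z -> 0 <= h ->
  h <= s * z + s ^+ 2 * L * X ->
  M * h ^+ 3 + s ^+ 2 / 4 * (L * h * (2 * L * X + L * h)) <=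
  (M * (1 + L) ^+ 3 + L ^+ 2 * (1 + L) * (3 + L) / 4) * s ^+ 3 * ((1 + z) ^+ 3 * (1 + X) ^+ 3).
Proof.
move=> s0 s1 X0 z0 h0 hle.
have s0' := ltW s0.
pose Q := (1 + z) * (1 + X).
have zX := mulr_ge0 z0 X0.
have Q1 : 1 <= Q by rewrite /Q; lra.
have XQ : X <= Q by rewrite /Q; lra.
have L1 : 0 <= 1 + L by rewrite addr_ge0.
have hQ : h <= s * ((1 + L) * Q).
  apply: le_trans hle _.
  have : 0 <= s * (1 - s) * (L * X) by rewrite !mulr_ge0// subr_ge0.
  have : 0 <= s * (L * z + 1 + L + X + z * X + L * z * X).
    by rewrite mulr_ge0// !addr_ge0// ?mulr_ge0.
  by rewrite /Q; lra.
have Q0 : 0 <= Q by lra.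
have hQ' : h <= (1 + L) * Q.
  by apply: le_trans hQ _; rewrite ler_piMl// mulr_ge0.
rewrite -exprMn -/Q.
have e1 : M * h ^+ 3 <= M * (1 + L) ^+ 3 * s ^+ 3 * Q ^+ 3.
  rewrite (_ : _ * Q ^+ 3 = M * (s * ((1 + L) * Q)) ^+ 3); last by ring.
  rewrite ler_wpM2l//; apply: lerXn2r => //; rewrite nnegrE; exact: mulr_ge0 s0' (mulr_ge0 L1 Q0).
have e2 : L * h * (2 * L * X + L * h) <= L ^+ 2 * (s * ((1 + L) * Q)) * ((3 + L) * Q).
  rewrite (_ : L * h * _ = L ^+ 2 * (h * (2 * X + h))); last by ring.
  rewrite -mulrA ler_wpM2l ?sqr_ge0// ler_pM ?addr_ge0 ?mulr_ge0//; lra.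
have e3 : s ^+ 2 / 4 * (L * h * (2 * L * X + L * h)) <= L ^+ 2 * (1 + L) * (3 + L) / 4 * s ^+ 3 * Q ^+ 3.
  apply: (@le_trans _ _ (L ^+ 2 * (1 + L) * (3 + L) / 4 * s ^+ 3 * Q ^+ 2)).
    rewrite (_ : _ * Q ^+ 2 = s ^+ 2 / 4 * (L ^+ 2 * (s * ((1 + L) * Q)) * ((3 + L) * Q))); last by ring.
    by rewrite ler_wpM2l// divr_ge0 ?sqr_ge0.
  rewrite ler_wpM2l//; first by rewrite !mulr_ge0 ?invr_ge0 ?exprn_ge0 ?addr_ge0.
  by rewrite [leRHS]exprS ler_peMl ?exprn_ge0.
by apply: le_trans (lerD e1 e3) _; rewrite -!mulrDl lexx.
Qed.

Lemma accept_ge_global : exists C, 0 <= C /\ forall gamma x y, 0 < gamma <= 1 ->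
  1 - accept U gamma x y <=
  C * (gamma * Num.sqrt gamma) * V x * expR (enorm (y - x + gamma *: g x) ^+ 2 / (8 * gamma)).
Proof.
have e8 : 0 < 8^-1 :> R by rewrite invr_gt0.
have m16 : 0 < m / 16 by rewrite divr_gt0.
(* The rate 1/8 in [z = w / sqrt gamma] matches the moment [exp (w^2 / (8 gamma))], and [m / 16]
   matches [V]. *)
have [C1 [C10 hC1]] := cube_le_exp e8.
have [C2 [C20 hC2]] := cube_le_exp m16.
pose C0 := M * (1 + L) ^+ 3 + L ^+ 2 * (1 + L) * (3 + L) / 4.
have L1 : 0 <= 1 + L by rewrite addr_ge0.
have C00 : 0 <= C0.
  rewrite addr_ge0//; first by rewrite mulr_ge0// exprn_ge0.
  by rewrite !mulr_ge0 ?invr_ge0 ?exprn_ge0 ?addr_ge0.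
exists (C0 * (C1 * C2)); split; first by rewrite !mulr_ge0.
move=> gamma x y /andP[g0 g1].
pose s := Num.sqrt gamma; have s0 : 0 < s by rewrite sqrtr_gt0.
have s2 : s ^+ 2 = gamma by rewrite sqr_sqrtr// ltW.
have s1 : s <= 1 by rewrite -sqrtr1 ler_wsqrtr.
have real_bound (w h X a b u : R) : 0 <= w -> 0 <= h -> 0 <= X -> 0 <= a -> 0 <= b ->
    h <= w + gamma * L * X -> `|u| <= M * h ^+ 3 -> a <= L * X -> b <= a + L * h -> a <= b + L * h ->
    1 - Num.min 1 (expR (u + gamma / 4 * (a ^+ 2 - b ^+ 2))) <=
    C0 * (C1 * C2) * (gamma * s) * expR (m / 16 * X ^+ 2) * expR (w ^+ 2 / (8 * gamma)).
  move=> w0 h0 X0 a0 b0 hle trap aX ba ab.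
  pose z := w / s; have z0 : 0 <= z by rewrite divr_ge0// ltW.
  have wz : w = s * z by rewrite /z mulrC divfK// gt_eqF.
  have hz : h <= s * z + s ^+ 2 * L * X by rewrite -wz s2.
  have core := accept_ge_arith s0 s1 X0 z0 h0 hz.
  have -> : w ^+ 2 / (8 * gamma) = 8^-1 * z ^+ 2 by rewrite -s2 wz; field; rewrite gt_eqF.
  have prod : (1 + z) ^+ 3 * (1 + X) ^+ 3 <= C1 * expR (8^-1 * z ^+ 2) * (C2 * expR (m / 16 * X ^+ 2)).
    by rewrite ler_pM ?exprn_ge0 ?addr_ge0// ?hC1 ?hC2.
  have B0 : 0 <= M * h ^+ 3 + s ^+ 2 / 4 * (L * h * (2 * L * X + L * h)).
    by rewrite addr_ge0// !mulr_ge0 ?invr_ge0 ?addr_ge0 ?mulr_ge0 ?exprn_ge0// ltW.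
  apply: le_trans (one_sub_min_exp B0 _) _.
    have sq : `|a ^+ 2 - b ^+ 2| <= L * h * (2 * L * X + L * h).
      rewrite (_ : a ^+ 2 - b ^+ 2 = (a - b) * (a + b)); last by ring.
      by rewrite normrM ler_pM// ler_norml; apply/andP; split; lra.
    move: sq trap; rewrite !ler_norml s2 => /andP[q1 q2] /andP[t1 t2].
    have := ler_wpM2l (ltW g0) q1; move: (M * h ^+ 3) t1 t2 (L * h * _) q1 q2 => r t1 t2 q q1 q2.
    by move: (a ^+ 2 - b ^+ 2) q1 q2 => c q1 q2; lra.
  apply: le_trans core _.
  rewrite -/C0 -/s -s2 (_ : C0 * (C1 * C2) * _ * _ * _ = C0 * s ^+ 3 *
     (C1 * expR (8^-1 * z ^+ 2) * (C2 * expR (m / 16 * X ^+ 2)))); last by ring.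
  by rewrite ler_wpM2l// mulr_ge0// exprn_ge0// ltW.
have hle := disp_le x y g0.
have trap := rp_trapezoid H x (y - x).
rewrite (addrC x (y - x)) subrK in trap.
have Gle := grad_le_rp x.
have tri (a b : 'rV[R]_d) : enorm b <= enorm a + enorm (b - a).
  by have := enormD a (b - a); rewrite (addrC a) subrK.
have G1 : enorm (g y) <= enorm (g x) + L * enorm (y - x).
  by apply: le_trans (tri (g x) (g y)) _; rewrite lerD2l; exact: rp_lip H x y.
have G2 : enorm (g x) <= enorm (g y) + L * enorm (y - x).
  apply: le_trans (tri (g y) (g x)) _; rewrite lerD2l enormB; exact: rp_lip H x y.
rewrite acceptE// logaccE//.
exact: (@real_bound (enorm (y - x + gamma *: g x)) (enorm (y - x)) (enorm x) (enorm (g x)) (enorm (g y))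
  (U x - U y + edot (g x + g y) (y - x) / 2) (enorm_ge0 _) (enorm_ge0 _) (enorm_ge0 _) (enorm_ge0 _)
  (enorm_ge0 _) hle trap Gle G1 G2).
Qed.

End mala_density.

(** * The proposal and the Metropolis-adjusted operators *)

Section mala_operators.
Context (R : realType) (d : nat) (U : 'rV[R]_d -> R) (L M m K : R).
Hypothesis H : regular_potential U L M m K.
Implicit Types (x y : 'rV[R]_d) (gamma : R) (f : 'rV[R]_d -> R).

Local Notation g := (grad U).
Local Notation V := (@Vexp R d (m / 16)).
Local Notation mu := (@lebRV R d).
Local Notation T := 'rV[R]_d.

Let m0 : 0 < m := rp_m0 H.
Let L0 : 0 <= L := rp_L0 H.

Definition acc_kernel gamma x y := accept U gamma x y * rprop U gamma x y.
Definition rej_kernel gamma x y := (1 - accept U gamma x y) * rprop U gamma x y.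
Definition Qop gamma f := kop mu (rprop U gamma) f.
Definition rej gamma x := kop mu (rej_kernel gamma) (fun _ => 1) x.
Definition Rop gamma f x := kop mu (acc_kernel gamma) f x + f x * rej gamma x.

(** [gamma * m <= 1] keeps the Gaussian factor [1 - gamma m / 4] away from 0; [gamma * L <= 4^-1]
    keeps a proposal with moderate noise within [|x| / 2] of [x]; [gamma * L ^+ 2 <= m / 4] lets
    dissipativity absorb the squared gradient. *)
Definition small gamma := [/\ 0 < gamma, gamma <= 1, gamma * m <= 1, gamma * L <= 4^-1
  & gamma * L ^+ 2 <= m / 4].

(** The first term comes from the Gaussian normalization in dimension [d], the second from the
    linear defect [(L + m) K |x|] of dissipativity. *)
Definition b0 : R := m / 4 * d%:R + ((L + m) * K) ^+ 2 / 2.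

Lemma b0_ge0 : 0 <= b0.
Proof.
apply: addr_ge0; last by rewrite divr_ge0// sqr_ge0.
by apply: mulr_ge0 => //; rewrite divr_ge0// ltW.
Qed.

Lemma measurable_noise gamma :
  measurable_fun setT (fun z : T * T => z.2 - z.1 + gamma *: g z.1).
Proof.
have mN : measurable_fun setT (fun z : T * T => - z.1).
  by under eq_fun do rewrite -scaleN1r; apply: measurable_rvZ.
apply: measurable_rvD; first exact: measurable_rvD.
by apply: measurable_rvZ; apply: (measurableT_comp (rp_mg H)).
Qed.

Lemma measurable_rprop gamma : measurable_fun setT (fun z : T * T => rprop U gamma z.1 z.2).
Proof. exact: measurable_gdens (measurable_noise gamma). Qed.

Lemma measurable_accept gamma : 0 < gamma ->
  measurable_fun setT (fun z : T * T => accept U gamma z.1 z.2).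
Proof.
move=> g0; under eq_fun do rewrite (acceptE H)//.
have mw := measurable_enorm (measurable_noise gamma).
have mw' : measurable_fun setT (fun z : T * T => enorm (z.1 - z.2 + gamma *: g z.2) ^+ 2).
  exact: (measurableT_comp mw (measurable_fun_pair measurable_snd measurable_fst)).
have mU1 : measurable_fun setT (fun z : T * T => U z.1).
  exact: (measurableT_comp (rp_mU H) measurable_fst).
have mU2 : measurable_fun setT (fun z : T * T => U z.2).
  exact: (measurableT_comp (rp_mU H) measurable_snd).
apply: measurable_minr; first exact: measurable_cst.
apply: (measurableT_comp (@measurable_expR R)); apply: measurable_funD.
  exact: measurable_funB mU1 mU2.
apply: measurable_funM; first exact: measurable_funB mw mw'.
exact: measurable_cst.
Qed.

Lemma integral_rprop gamma x : 0 < gamma -> (\int[mu]_y (rprop U gamma x y)%:E = 1)%E.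
Proof.
move=> g0; rewrite -(integral_gdens (- x + gamma *: g x) g0).
by apply: eq_integral => y _; rewrite addrA.
Qed.

(** Reduces to [- ln (1 - v) <= v / (1 - v) <= 2 v]. *)
Lemma powR_dim_le (v : R) : 0 <= v -> v <= 2^-1 -> powR (1 - v) (- (d%:R / 2)) <= expR (d%:R * v).
Proof.
move=> v0 v2; have u0 : 0 < 1 - v by lra.
rewrite /powR gt_eqF// ler_expR mulNr -mulrN -mulrA ler_wpM2l//.
rewrite -(@ler_pM2l _ 2)// mulrA divff// mul1r -lnV ?posrE//.
have -> : (1 - v)^-1 = 1 + v / (1 - v) by field; rewrite gt_eqF.
have h : 0 <= v / (1 - v) by rewrite divr_ge0// ltW.
apply: le_trans (le_ln1Dx _) _; first by lra.
by rewrite ler_pdivrMr//; nra.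
Qed.

Lemma proposal_mean_le gamma x : small gamma ->
  enorm (x - gamma *: g x) ^+ 2 <=
  enorm x ^+ 2 * (1 - 3 / 2 * (gamma * m)) + 4 * gamma * (((L + m) * K) ^+ 2 / m).
Proof.
move=> [gam0 gam1 gm gL gL2].
have -> : enorm (x - gamma *: g x) ^+ 2 =
    enorm x ^+ 2 - 2 * gamma * edot (g x) x + gamma ^+ 2 * enorm (g x) ^+ 2.
  have id (a b : T) : enorm (a - gamma *: b) ^+ 2 =
      enorm a ^+ 2 - 2 * gamma * edot b a + gamma ^+ 2 * enorm b ^+ 2.
    by rewrite !enormE !edotE (edotC a b); ring.
  exact: id.
have dis := rp_dissip H x.
have gle : enorm (g x) ^+ 2 <= L ^+ 2 * enorm x ^+ 2.
  by rewrite -exprMn lerXn2r ?nnegrE ?mulr_ge0 ?enorm_ge0// (grad_le_rp H).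
have arith (X e G c : R) : 0 <= X -> m * X ^+ 2 - c * X <= e -> G <= L ^+ 2 * X ^+ 2 ->
    X ^+ 2 - 2 * gamma * e + gamma ^+ 2 * G <=
    X ^+ 2 * (1 - 3 / 2 * (gamma * m)) + 4 * gamma * (c ^+ 2 / m).
  move=> X0 h1 h2.
  have h3 : gamma ^+ 2 * G <= gamma * (m / 4 * X ^+ 2).
    apply: (@le_trans _ _ (gamma ^+ 2 * (L ^+ 2 * X ^+ 2))).
      by rewrite ler_wpM2l// sqr_ge0.
    rewrite (_ : _ * (_ * _) = gamma * (gamma * L ^+ 2 * X ^+ 2)); last by ring.
    by rewrite ler_pM2l// ler_wpM2r// sqr_ge0.
  have h4 : 2 * c * X <= m / 4 * X ^+ 2 + 4 * (c ^+ 2 / m).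
    rewrite -subr_ge0 (_ : _ - _ = m * (X / 2 - 2 * c / m) ^+ 2); last by field; rewrite gt_eqF.
    by rewrite mulr_ge0 ?sqr_ge0// ltW.
  have h5 := ler_wpM2l (ltW gam0) h4.
  have h6 := ler_wpM2l (ltW gam0) h1.
  by move: (c ^+ 2 / m) h5 => q h5; lra.
by apply: arith => //; exact: enorm_ge0.
Qed.

(** The Gaussian integral has exponent [m |x - gamma grad U x|^2 / (16 u)] with
    [u = 1 - gamma m / 4]. The contraction [1 - 3/2 gamma m] of the squared mean beats the inflation
    [1 / u] and leaves [1 - gamma m]. *)
Lemma integral_rprop_V gamma x : small gamma ->
  (\int[mu]_y (rprop U gamma x y * V y)%:E <=
   (expR (- (gamma * (m ^+ 2 / 16 * enorm x ^+ 2 - b0))) * V x)%:E)%E.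
Proof.
move=> sg; have [gam0 gam1 gm gL gL2] := sg.
pose u := 1 - 4 * (m / 16) * gamma.
have uE : u = 1 - gamma * m / 4 by rewrite /u; field.
have u1 : 4 * (m / 16) * gamma < 1 by move: uE; rewrite /u; lra.
have := integral_gdens_exp (x - gamma *: g x) gam0 u1; rewrite -/u.
have -> : (\int[mu]_y (gdens gamma (y - (x - gamma *: g x)) * expR (m / 16 * enorm y ^+ 2))%:E)%E =
    (\int[mu]_y (rprop U gamma x y * V y)%:E)%E.
  by apply: eq_integral => y _; rewrite opprB addrA addrAC.
move=> ->; rewrite lee_fin /Vexp -expRD.
have h1 : powR u (- (d%:R / 2)) <= expR (d%:R * (gamma * m / 4)).
  have gm0 : 0 < gamma * m by rewrite mulr_gt0.
  by rewrite uE; apply: powR_dim_le; move: gm0 gm; move: (gamma * m) => q; lra.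
apply: le_trans (ler_wpM2r (expR_ge0 _) h1) _.
rewrite -expRD ler_expR /b0.
have := proposal_mean_le x sg.
move: (enorm (x - gamma *: g x) ^+ 2) (enorm x ^+ 2) (sqr_ge0 (enorm x)) => A X X0 h.
have u0 : 0 < u by move: uE gm; lra.
have u2 : 2^-1 <= u by move: uE gm; lra.
set q := ((L + m) * K) ^+ 2 in h *.
have q0 : 0 <= q by rewrite sqr_ge0.
have h2 : A / u <= X * (1 - gamma * m) + 8 * gamma * (q / m).
  rewrite ler_pdivrMr//; apply: le_trans h _.
  have gm0 : 0 <= gamma * m by rewrite mulr_ge0// ltW.
  have e1 : X * (1 - 3 / 2 * (gamma * m)) <= X * (1 - gamma * m) * u.
    rewrite -[leRHS]mulrA ler_wpM2l// uE.
    have := sqr_ge0 (gamma * m); move: (gamma * m) gm0 => r r0; lra.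
  have e2 : 4 * gamma * (q / m) <= 8 * gamma * (q / m) * u.
    have : 0 <= gamma * (q / m) * (u - 2^-1).
      have qm : 0 <= q / m by rewrite divr_ge0// ltW.
      by apply: mulr_ge0; [exact: mulr_ge0 (ltW gam0) qm|rewrite subr_ge0].
    by move: (q / m) => r; lra.
  by rewrite mulrDl; lra.
have h3 : m / 16 * A / u <= m / 16 * (X * (1 - gamma * m)) + gamma * q / 2.
  rewrite -mulrA; apply: le_trans (ler_wpM2l (_ : 0 <= m / 16) h2) _.
    by rewrite divr_ge0// ltW.
  rewrite mulrDr lerD2l (_ : m / 16 * _ = gamma * q / 2)//.
  by field; rewrite gt_eqF.
rewrite -lerBrDl; apply: le_trans h3 _.
lra.
Qed.

End mala_operators.

(** * Rejection probability and drift of the adjusted chain *)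

Section mala_drift.
Context (R : realType) (d : nat) (U : 'rV[R]_d -> R) (L M m K : R).
Hypothesis H : regular_potential U L M m K.
Implicit Types (x y : 'rV[R]_d) (gamma : R) (f : 'rV[R]_d -> R).

Local Notation g := (grad U).
Local Notation V := (@Vexp R d (m / 16)).
Local Notation mu := (@lebRV R d).
Local Notation T := 'rV[R]_d.
Local Notation small := (small L m).
Local Notation b0 := (b0 d L m K).

Let m0 : 0 < m := rp_m0 H.
Let V1 := Vexp_ge1 H.
Let mV := measurable_Vexp m : measurable_fun setT V.

Lemma small_gt0 gamma : small gamma -> 0 < gamma. Proof. by case. Qed.

Lemma good_rprop gamma : small gamma -> kgood mu V (rprop U gamma).
Proof.
move=> sg; have [gam0 gam1 _ _ _] := sg; split.
- exact: measurable_rprop H gamma.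
- by move=> x y; exact: ltW (rprop_gt0 U x y gam0).
- exists (expR b0) => x; apply: le_trans (integral_rprop_V H x sg) _.
  rewrite lee_fin ler_wpM2r//; first by rewrite (le_trans ler01).
  have bb := b0_ge0 H.
  rewrite ler_expR mulrBr opprB.
  have h : 0 <= gamma * (m ^+ 2 / 16 * enorm x ^+ 2).
    by rewrite mulr_ge0 ?(ltW gam0)// mulr_ge0 ?sqr_ge0// divr_ge0// sqr_ge0.
  by have := ler_wpM2r bb gam1; move: (gamma * (_ * _)) h => q; lra.
Qed.

Lemma rej_kernel_itv gamma x y : 0 < gamma -> 0 <= rej_kernel U gamma x y <= rprop U gamma x y.
Proof.
move=> gam0; have /andP[a0 a1] := accept_itv H x y gam0.
have r0 := ltW (rprop_gt0 U x y gam0).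
by rewrite mulr_ge0 ?subr_ge0//= ler_piMl// gerBl.
Qed.

Lemma acc_kernel_itv gamma x y : 0 < gamma -> 0 <= acc_kernel U gamma x y <= rprop U gamma x y.
Proof.
move=> gam0; have /andP[a0 a1] := accept_itv H x y gam0.
have r0 := ltW (rprop_gt0 U x y gam0).
by rewrite mulr_ge0//= ler_piMl.
Qed.

Lemma measurable_acc_kernel gamma : 0 < gamma ->
  measurable_fun setT (fun z : T * T => acc_kernel U gamma z.1 z.2).
Proof.
by move=> gam0; exact: measurable_funM (measurable_accept H gam0) (measurable_rprop H gamma).
Qed.

Lemma measurable_rej_kernel gamma : 0 < gamma ->
  measurable_fun setT (fun z : T * T => rej_kernel U gamma z.1 z.2).
Proof.
move=> gam0; apply: (measurable_funM _ (measurable_rprop H gamma)).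
exact: measurable_funB (measurable_cst _) (measurable_accept H gam0).
Qed.

Lemma good_acc gamma : small gamma -> kgood mu V (acc_kernel U gamma).
Proof.
move=> sg; have gam0 := small_gt0 sg.
apply: (kgood_le mV V1 (good_rprop sg)); first exact: measurable_acc_kernel.
by move=> x y; exact: acc_kernel_itv.
Qed.

Lemma good_rej gamma : small gamma -> kgood mu V (rej_kernel U gamma).
Proof.
move=> sg; have gam0 := small_gt0 sg.
apply: (kgood_le mV V1 (good_rprop sg)); first exact: measurable_rej_kernel.
by move=> x y; exact: rej_kernel_itv.
Qed.

Lemma Qop_split gamma f x : small gamma -> adm V f ->
  Qop U gamma f x = kop mu (acc_kernel U gamma) f x + kop mu (rej_kernel U gamma) f x.
Proof.
move=> sg af; rewrite /Qop /kop -RintegralD//; last 2 first.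
- exact: (kop_integrable mV V1 (good_acc sg)).
- exact: (kop_integrable mV V1 (good_rej sg)).
apply: eq_Rintegral => y _; rewrite -mulrDl; congr (_ * _).
by rewrite /acc_kernel /rej_kernel -mulrDl addrC subrK mul1r.
Qed.

Lemma Qop_1 gamma x : 0 < gamma -> Qop U gamma (fun _ => 1) x = 1.
Proof.
move=> gam0; rewrite /Qop /kop /Rintegral; under eq_integral do rewrite mulr1.
by rewrite integral_rprop.
Qed.

Lemma rej_ge0 gamma x : 0 < gamma -> 0 <= rej U gamma x.
Proof.
move=> gam0; apply: Rintegral_ge0 => y _; rewrite mulr1.
by have /andP[] := rej_kernel_itv x y gam0.
Qed.

Lemma acc_rej_1 gamma x : small gamma -> kop mu (acc_kernel U gamma) (fun _ => 1) x + rej U gamma x = 1.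
Proof.
move=> sg; rewrite -[RHS](Qop_1 x (small_gt0 sg)) Qop_split//.
exact: adm_cst.
Qed.

Lemma rej_le1 gamma x : small gamma -> rej U gamma x <= 1.
Proof.
move=> sg; have := acc_rej_1 x sg => <-; rewrite lerDr; apply: Rintegral_ge0 => y _.
by rewrite mulr1; have /andP[] := acc_kernel_itv x y (small_gt0 sg).
Qed.

Lemma adm_rej gamma f : small gamma -> adm V f -> adm V (fun x => f x * rej U gamma x).
Proof.
move=> sg af; have [mf _] := af.
have [mr _] : adm V (rej U gamma).
  by apply: (kop_adm mV V1 (good_rej sg)); exact: adm_cst.
apply: (adm_le (C := 1) _ af); first exact: measurable_funM.
move=> x; rewrite normrM mul1r ler_piMr// ger0_norm ?rej_le1//.
by apply: rej_ge0; exact: small_gt0.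
Qed.

Lemma markov_Qop gamma : small gamma -> markov_op V (Qop U gamma).
Proof.
move=> sg; have gd := good_rprop sg; split.
- by move=> f af; exact: (kop_adm mV V1 gd).
- by move=> a f h af ah x; exact: (kop_lin mV V1 gd).
- by move=> f h af ah fh x; exact: (kop_le mV V1 gd).
- by move=> x; rewrite Qop_1//; exact: small_gt0.
Qed.

Lemma markov_Rop gamma : small gamma -> markov_op V (Rop U gamma).
Proof.
move=> sg; have gd := good_acc sg; split.
- move=> f af; apply: adm_D; first exact: (kop_adm mV V1 gd).
  exact: adm_rej.
- by move=> a f h af ah x; rewrite /Rop (kop_lin mV V1 gd)//; ring.
- move=> f h af ah fh x; apply: lerD; first exact: (kop_le mV V1 gd).
  by apply: ler_wpM2r => //; apply: rej_ge0; exact: small_gt0.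
- by move=> x; rewrite /Rop mul1r acc_rej_1.
Qed.

Lemma Rop_sub_Qop gamma f x : small gamma -> adm V f ->
  Rop U gamma f x - Qop U gamma f x = f x * rej U gamma x - kop mu (rej_kernel U gamma) f x.
Proof.
move=> sg af; rewrite Qop_split// /Rop.
by move: (kop _ _ _ _) (kop _ _ _ _) (f x * _) => a b c; ring.
Qed.

(** Against the proposal density, the factor [exp (w^2 / (8 gamma))] integrates to [gmom] whatever
    [gamma] and [x]. *)
Lemma rej_le gamma x c : small gamma -> 0 <= c ->
  (forall y, 1 - accept U gamma x y <= c * expR (enorm (y - x + gamma *: g x) ^+ 2 / (8 * gamma))) ->
  rej U gamma x <= c * gmom R d.
Proof.
move=> sg c0 hc; have gam0 := small_gt0 sg.
apply: (kop_ub mV V1 (good_rej sg)); first exact: adm_cst.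
pose e y := gdens gamma (y + (- x + gamma *: g x)) *
  expR (enorm (y + (- x + gamma *: g x)) ^+ 2 / (8 * gamma)).
have e0 y : 0 <= e y by rewrite mulr_ge0 ?expR_ge0// ltW// gdens_gt0.
have mw : measurable_fun setT (fun y : T => y + (- x + gamma *: g x)) by exact: measurable_rv_shift.
have me : measurable_fun setT e.
  apply: measurable_funM; first exact: measurable_gdens mw.
  apply: (measurableT_comp (@measurable_expR R)); apply: measurable_funM => //.
  exact: measurable_enorm mw.
have mrej : measurable_fun setT (rej_kernel U gamma x).
  exact: measurable_section (measurable_rej_kernel gam0).
rewrite EFinM -(integral_gdens_moment (- x + gamma *: g x) gam0) -integral_scale//.
apply: le_integral_real => [| |y|y].
- exact: measurable_funM.
- exact: measurable_funM.
- by rewrite mulr1; have /andP[] := rej_kernel_itv x y gam0.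
- rewrite mulr1 /rej_kernel /e addrA [leRHS]mulrCA [leLHS]mulrC.
  by apply: ler_wpM2l; [exact: ltW (rprop_gt0 U x y gam0)|exact: hc].
Qed.

Lemma rej_le_global : exists C, 0 <= C /\ forall gamma x, small gamma ->
  rej U gamma x <= C * (gamma * Num.sqrt gamma) * V x.
Proof.
have [C [C0 hC]] := accept_ge_global H.
exists (C * gmom R d); split; first by rewrite mulr_ge0// gmom_ge0.
move=> gamma x sg; have [gam0 gam1 _ _ _] := sg.
rewrite (_ : _ * V x = C * (gamma * Num.sqrt gamma) * V x * gmom R d); last by ring.
apply: rej_le => // [|y]; last by apply: hC; rewrite gam0.
by rewrite !mulr_ge0 ?sqrtr_ge0// ?(ltW gam0)// (le_trans ler01).
Qed.

(** On the ball of radius [1 + 2 K] the weight [V] is bounded and the global bound applies. Outside,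
    the tail bound is quadratic in the noise [w], and [w^2 <= 8 gamma exp (w^2 / (8 gamma))]
    supplies the factor [gamma]. *)
Lemma rej_le_gamma : exists C, 0 <= C /\ forall gamma x, small gamma -> rej U gamma x <= C * gamma.
Proof.
have [C1 [C10 hC1]] := rej_le_global.
pose K1 := 1 + 2 * K.
have K0 := rp_K0 H.
pose v1 := expR (m / 16 * K1 ^+ 2).
pose C2 := 8 * (16 + L ^+ 2 / (4 * m)) * gmom R d.
have g0 := gmom_ge0 R d.
have C20 : 0 <= C2.
  by rewrite mulr_ge0// mulr_ge0// addr_ge0// divr_ge0 ?sqr_ge0// mulr_ge0// ltW.
have v0 : 0 <= v1 by exact: expR_ge0.
exists (C1 * v1 + C2); split; first by rewrite addr_ge0// mulr_ge0.
move=> gamma x sg; have [gam0 gam1 _ gL gL2] := sg.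
have [xK|Kx] := leP (enorm x) K1.
  apply: le_trans (hC1 gamma x sg) _.
  have Vx : V x <= v1.
    have m16 : 0 <= m / 16 by rewrite divr_ge0// ltW.
    have K10 : 0 <= K1 by rewrite /K1; lra.
    rewrite ler_expR; apply: ler_wpM2l => //; apply: lerXn2r => //.
    by rewrite nnegrE enorm_ge0.
  have s1 : Num.sqrt gamma <= 1 by rewrite -sqrtr1 ler_wsqrtr.
  have Cg : 0 <= C2 * gamma by rewrite mulr_ge0// ltW.
  rewrite mulrDl -[leLHS]addr0 lerD//.
  have e : Num.sqrt gamma * V x <= v1.
    by rewrite -[leRHS]mul1r ler_pM ?sqrtr_ge0//; exact: le_trans (V1 x).
  rewrite (_ : _ * V x = C1 * gamma * (Num.sqrt gamma * V x)); last by ring.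
  rewrite (_ : C1 * v1 * gamma = C1 * gamma * v1); last by ring.
  by apply: ler_wpM2l => //; rewrite mulr_ge0// ltW.
apply: (@le_trans _ _ (C2 * gamma)); last first.
  by rewrite ler_pM2r// lerDr mulr_ge0.
rewrite (_ : C2 * gamma = 8 * (16 + L ^+ 2 / (4 * m)) * gamma * gmom R d); last by rewrite /C2; ring.
have c0 : 0 <= 16 + L ^+ 2 / (4 * m) by rewrite addr_ge0// divr_ge0 ?sqr_ge0// mulr_ge0// ltW.
apply: rej_le => // [|y]; first by rewrite !mulr_ge0// ltW.
have X1 : 1 <= enorm x by move: Kx; rewrite /K1; move: (enorm x) => X; lra.
have XK : 2 * K <= enorm x by move: Kx; rewrite /K1; move: (enorm x) => X; lra.
have gL2' : gamma * L ^+ 2 <= m by move: gL2; move: (gamma * _) => q; move: m0; lra.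
apply: le_trans (accept_ge_tail H y gam0 gL gL2' X1 XK) _.
move: (16 + _) c0 (enorm (y - x + gamma *: g x) ^+ 2) => c c0 w.
rewrite (_ : 8 * c * gamma * _ = c * (8 * gamma * expR (w / (8 * gamma)))); last by ring.
rewrite ler_wpM2l//.
have g8 : 0 < 8 * gamma by rewrite mulr_gt0.
have /(ler_wpM2l (ltW g8)) h := expR_ge1Dx (w / (8 * gamma)); apply: le_trans h.
by rewrite mulrDr mulr1 [8 * gamma * (w / _)]mulrC divfK ?gt_eqF// lerDr ltW.
Qed.

Lemma mala_drift : exists Gam b, [/\ 0 < Gam, 0 < b & forall gamma x, small gamma -> gamma <= Gam ->
  Rop U gamma V x <= (1 - gamma) * V x + gamma * b].
Proof.
have [C3 [C30 hC3]] := rej_le_gamma.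
have bb := b0_ge0 H.
(* If [A >= A0], then [exp (- gamma A) <= 1 - gamma (C3 + 1)], which pays the rejection term
   [C3 gamma] and leaves [1 - gamma]. If [A < A0], then [V x <= exp ((A0 + b0) / m)], whence the
   additive constant. [Gam] ensures [gamma A0 <= 1] and [gamma b0 <= 1 / 2]. *)
pose A0 := 2 * (C3 + 1).
pose Gam := (A0 + 2 * b0 + 1)^-1.
have A00 : 0 < A0 by rewrite mulr_gt0// ltr_wpDl.
have V00 : 0 < expR ((A0 + b0) / m) by exact: expR_gt0.
have den : 0 < A0 + 2 * b0 + 1 by move: A00 bb; lra.
exists Gam, ((2 * b0 + C3 + 1) * expR ((A0 + b0) / m)); split.
- by rewrite invr_gt0.
- by rewrite mulr_gt0//; move: bb C30; lra.
move=> gamma x sg gG; have gam0 := small_gt0 sg.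
have gA : gamma * (A0 + 2 * b0 + 1) <= 1 by rewrite -ler_pdivlMr// div1r.
have aV : adm V V by exact: adm_V.
have Vx1 := V1 x; have Vx0 : 0 < V x by exact: lt_le_trans Vx1.
pose A := m ^+ 2 / 16 * enorm x ^+ 2 - b0.
have QV : Rop U gamma V x <= V x * (expR (- (gamma * A)) + C3 * gamma).
  rewrite mulrDr /Rop; apply: lerD; last by rewrite ler_wpM2l ?hC3// ltW.
  apply: (@le_trans _ _ (Qop U gamma V x)).
    rewrite Qop_split// lerDl; apply: Rintegral_ge0 => y _.
    rewrite mulr_ge0//; last exact: le_trans (V1 y).
    by have /andP[] := rej_kernel_itv x y gam0.
  apply: (kop_ub mV V1 (good_rprop sg)) => //.
  have E : V x * expR (- (gamma * A)) = expR (- (gamma * A)) * V x by exact: mulrC.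
  rewrite E; have h := integral_rprop_V H x sg; exact: h.
apply: le_trans QV _.
have g0A : 0 <= gamma * A0 by rewrite mulr_ge0// ltW.
have g0b : 0 <= gamma * b0 by rewrite mulr_ge0// ltW.
have gC : 0 <= gamma * C3 by rewrite mulr_ge0// ltW.
have [AA|AA] := leP A0 A.
  have e1 : expR (- (gamma * A)) <= 1 - gamma * A0 / 2.
    apply: (@le_trans _ _ (expR (- (gamma * A0)))); first by rewrite ler_expR lerN2 ler_pM2l.
    have := expR_ge1Dx (gamma * A0); rewrite expRN => e.
    have q1 : gamma * A0 <= 1 by move: gA g0b gam0; lra.
    rewrite -[leLHS]mul1r ler_pdivrMr ?expR_gt0//.
    apply: le_trans (_ : 1 <= (1 - gamma * A0 / 2) * (1 + gamma * A0)) _.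
      by move: (gamma * A0) g0A q1 => q; nra.
    by rewrite ler_wpM2l//; lra.
  apply: (@le_trans _ _ ((1 - gamma) * V x)).
    rewrite mulrC ler_pM2r//; move: e1; rewrite /A0; lra.
  by rewrite lerDl !mulr_ge0 ?expR_ge0// ?(ltW gam0)//; move: bb C30; lra.
have Vle : V x <= expR ((A0 + b0) / m).
  rewrite ler_expR ler_pdivlMr//.
  by move: AA; rewrite /A; move: (enorm x) => X; nra.
have e1 : expR (- (gamma * A)) <= 1 + 2 * (gamma * b0).
  apply: (@le_trans _ _ (expR (gamma * b0))).
    rewrite ler_expR /A mulrBr opprB lerBlDr lerDl mulr_ge0 ?(ltW gam0)// mulr_ge0 ?sqr_ge0//.
    by rewrite divr_ge0 ?sqr_ge0.
  have := expR_ge1Dx (- (gamma * b0)); rewrite expRN => e.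
  have q1 : 0 < 1 - gamma * b0 by move: gA g0A gam0; lra.
  have q2 : gamma * b0 <= 2^-1 by move: gA g0A gam0; lra.
  rewrite -(ler_pM2r q1); apply: (@le_trans _ _ 1).
    by rewrite -ler_pdivlMl ?expR_gt0// mulr1; exact: e.
  by move: (gamma * b0) q1 q2 g0b => q q1 q2 q0; nra.
have e2 : V x * (expR (- (gamma * A)) + C3 * gamma) <= V x * (1 + 2 * (gamma * b0) + C3 * gamma).
  by rewrite ler_pM2l// lerD2r.
apply: le_trans e2 _.
have : 0 <= gamma * (2 * b0 + C3 + 1) * (expR ((A0 + b0) / m) - V x).
  rewrite mulr_ge0 ?subr_ge0// mulr_ge0 ?(ltW gam0)//; move: bb C30; lra.
by move: (expR _) (V x) => E v; lra.
Qed.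

End mala_drift.

(** * Harnack inequality for the unadjusted chain *)

Section iterates.
Context d (T : measurableType d) (R : realType) (V : T -> R).
Hypothesis mV : measurable_fun setT V.
Hypothesis V1 : forall x, 1 <= V x.
Context (P Q : (T -> R) -> T -> R) (gamma b : R).
Hypotheses (mkP : markov_op V P) (mkQ : markov_op V Q).
Hypotheses (gam0 : 0 < gamma) (gam1 : gamma <= 1) (b0 : 0 < b).
Hypothesis drift : forall x, P V x <= (1 - gamma) * V x + gamma * b.

Let aV : adm V V := adm_V mV V1.

Lemma adm_iter f k : adm V f -> adm V (iter k P f).
Proof. by move=> af; have [h _ _ _] := markov_iter mkP k; exact: h. Qed.

Let r0 : 0 <= 1 - gamma. Proof. by rewrite subr_ge0. Qed.

Lemma iter_drift k x :
  iter k P V x <= (1 - gamma) ^+ k * V x + (1 - (1 - gamma) ^+ k) * b.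
Proof.
elim: k x => [|k IH] x; first by rewrite expr0 mul1r subrr mul0r addr0.
have ak : adm V (iter k P V) by exact: adm_iter.
have aW c e : adm V (fun y => c * V y + e).
  by apply: adm_D; [exact: adm_Z|exact: adm_cst].
rewrite iterS_fun; apply: le_trans (markov_le mkP ak (aW _ _) IH x) _.
rewrite (markov_D mkP)//; [|exact: adm_Z|exact: adm_cst].
rewrite (markov_cst V1 mkP) (markov_Z V1 mkP)//.
have rk0 : 0 <= (1 - gamma) ^+ k by exact: exprn_ge0.
by have := ler_wpM2l rk0 (drift x); rewrite exprSr; lra.
Qed.

Lemma iter_drift_le k x : iter k P V x <= V x + b.
Proof.
apply: le_trans (iter_drift k x) _.
have rk0 : 0 <= (1 - gamma) ^+ k by exact: exprn_ge0.
have rk1 : (1 - gamma) ^+ k <= 1 by rewrite exprn_ile1// gerBl ltW.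
apply: lerD; first by rewrite ler_piMl// (le_trans ler01).
by rewrite ler_piMl ?(ltW b0)// gerBl.
Qed.

Lemma iter_drift_half n x : 1 <= gamma * n%:R -> iter n P V x <= V x / 2 + b.
Proof.
move=> gn; apply: le_trans (iter_drift n x) _.
have rk0 : 0 <= (1 - gamma) ^+ n by exact: exprn_ge0.
have rk2 : (1 - gamma) ^+ n <= 2^-1.
  apply: (@le_trans _ _ (expR (- gamma) ^+ n)).
    by rewrite lerXn2r ?nnegrE ?expR_ge0//; have := expR_ge1Dx (- gamma); lra.
  rewrite -expRM_natl; apply: (@le_trans _ _ (expR (- 1))).
    by rewrite ler_expR; move: gn; lra.
  rewrite expRN lef_pV2 ?posrE ?expR_gt0//.
  by have := expR_ge1Dx (1 : R); lra.
apply: lerD; first by rewrite mulrC ler_wpM2l// (le_trans ler01).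
by rewrite ler_piMl ?(ltW b0)// gerBl.
Qed.

Lemma markov_unit (S : (T -> R) -> T -> R) f : markov_op V S -> adm V f ->
  (forall x, 0 <= f x <= 1) -> forall x, 0 <= S f x <= 1.
Proof.
move=> mkS af f01 x; have [_ _ mono S1] := mkS; apply/andP; split.
  rewrite -(markov_0 V1 mkS x); apply: mono => //; first exact: adm_cst.
  by move=> y; case/andP: (f01 y).
rewrite -(S1 x); apply: mono => //; first exact: adm_cst.
by move=> y; case/andP: (f01 y).
Qed.

Lemma markov_norm_le f h x : adm V f -> adm V h -> (forall y, `|f y| <= h y) -> `|P f x| <= P h x.
Proof.
move=> af ah fh; rewrite ler_norml; apply/andP; split; last first.
  by apply: (markov_le mkP) => // y; exact: le_trans (ler_norm _) (fh y).
have := markov_Z V1 mkP (-1) x ah; rewrite mulN1r => <-.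
apply: (markov_le mkP) => //; first exact: adm_Z.
by move=> y; have := fh y; rewrite mulN1r ler_norml => /andP[].
Qed.

(** Telescoping: each one-step discrepancy [del V] is carried by iterates of [P], and each
    application of [P] raises [V] by at most [gamma b]. For [k] of order [1 / gamma] and [del] of
    order [gamma^(3/2)] the total is of order [sqrt gamma]. *)
Lemma iter_compare (del : R) : 0 <= del ->
  (forall f, adm V f -> (forall x, 0 <= f x <= 1) -> forall x, `|P f x - Q f x| <= del * V x) ->
  forall f, adm V f -> (forall x, 0 <= f x <= 1) -> forall k x,
  `|iter k P f x - iter k Q f x| <= del * (k%:R * V x + k%:R ^+ 2 * (gamma * b)).
Proof.
move=> del0 PQ f af f01; elim=> [|k IH] x.
  by rewrite /= subrr normr0 expr0n/= !mul0r addr0 mulr0.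
have aP : adm V (iter k P f) by exact: adm_iter.
have aQ : adm V (iter k Q f) by have [h _ _ _] := markov_iter mkQ k; exact: h.
have Q01 : forall y, 0 <= iter k Q f y <= 1.
  by apply: markov_unit => //; exact: markov_iter.
rewrite !iterS_fun.
(* In this splitting the one-step comparison is applied to [iter k Q f], which stays in [0, 1], and
   the earlier error is propagated by [P], for which the drift holds. *)
have -> : P (iter k P f) x - Q (iter k Q f) x =
    P (fun y => iter k P f y - iter k Q f y) x + (P (iter k Q f) x - Q (iter k Q f) x).
  by rewrite (markov_B mkP)//; ring.
apply: le_trans (ler_normD _ _) _.
have aW c e : adm V (fun y => c * V y + e).
  by apply: adm_D; [exact: adm_Z|exact: adm_cst].
have h1 : `|P (fun y => iter k P f y - iter k Q f y) x| <=
    del * k%:R * ((1 - gamma) * V x + gamma * b) + del * (k%:R ^+ 2 * (gamma * b)).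
  apply: (@le_trans _ _ (P (fun y => del * k%:R * V y + del * (k%:R ^+ 2 * (gamma * b))) x)).
    apply: markov_norm_le => //; first exact: adm_B.
    by move=> y; have := IH y; rewrite mulrDr mulrA.
  rewrite (markov_D mkP)//; [|exact: adm_Z|exact: adm_cst].
  rewrite (markov_cst V1 mkP) (markov_Z V1 mkP)// lerD2r ler_wpM2l//.
  by rewrite mulr_ge0.
have h2 := PQ _ aQ Q01 x.
apply: le_trans (lerD h1 h2) _.
have Vx : 0 <= V x by exact: le_trans (V1 x).
have k0 : 0 <= k%:R :> R by exact: ler0n.
have e1 : 0 <= del * k%:R * (gamma * V x) by rewrite !mulr_ge0// ltW.
have e2 : 0 <= del * ((k%:R + 1) * (gamma * b)) by rewrite !mulr_ge0 ?addr_ge0// ltW.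
rewrite -natr1; move: (k%:R) e1 e2 => r e1 e2; lra.
Qed.

End iterates.

(* Optimizing over [t] gives [a^2 <= b E]. *)
Lemma overlap_le (R : realType) (a b E : R) : 0 <= a <= 1 -> 0 <= b -> 2 <= E ->
  (forall t, 0 < t -> 2 * a <= t * b + t^-1 * E) -> a - b <= 1 - E^-1.
Proof.
move=> /andP[a0 a1] b0 E2 h; have E0 : 0 < E by lra.
have Ei : E^-1 <= 2^-1 by rewrite lef_pV2 ?posrE.
have Ei0 : 0 < E^-1 by rewrite invr_gt0.
have [->|an0] := eqVneq a 0; first by move: Ei b0; lra.
have ap : 0 < a by rewrite lt0r an0.
have := h (E / a) (divr_gt0 E0 ap); rewrite invf_div divfK ?gt_eqF// => h1.
have h2 : a ^+ 2 * E^-1 <= b.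
  rewrite ler_pdivrMr//; have := ler_wpM2r a0 h1.
  have -> : (E / a * b + a) * a = b * E + a ^+ 2 by field.
  by lra.
move: (E^-1) Ei Ei0 h2 => e e2 e0 h2.
(* This product equals [1 - e - (a - a^2 e)], and [b >= a^2 e]; its second factor is nonnegative
   because [E >= 2]. *)
have : 0 <= (1 - a) * (1 - (1 + a) * e).
  apply: mulr_ge0; first by rewrite subr_ge0.
  have : (1 + a) * e <= 2 * e by rewrite ler_pM2r//; lra.
  by lra.
by lra.
Qed.

Section integral_add.
Context d (T : measurableType d) (R : realType) (mu : {measure set T -> \bar R}).
Lemma integral_add_real (f h : T -> R) : measurable_fun setT f -> measurable_fun setT h ->
  (forall x, 0 <= f x) -> (forall x, 0 <= h x) ->
  (\int[mu]_x (f x + h x)%:E = \int[mu]_x (f x)%:E + \int[mu]_x (h x)%:E)%E.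
Proof.
move=> mf mh f0 h0; under eq_integral do rewrite EFinD.
rewrite ge0_integralD//.
- by move=> x _; rewrite lee_fin.
- exact/measurable_EFinP.
- by move=> x _; rewrite lee_fin.
- exact/measurable_EFinP.
Qed.
End integral_add.

Section harnack.
Context (R : realType) (d : nat) (U : 'rV[R]_d -> R) (L M m K : R).
Hypothesis H : regular_potential U L M m K.
Local Notation g := (grad U).
Local Notation V := (@Vexp R d (m / 16)).
Local Notation mu := (@lebRV R d).
Local Notation T := 'rV[R]_d.
Implicit Types (x y v s : T) (gamma : R) (f : T -> R).

Let L0 : 0 <= L := rp_L0 H.
Let V1 := Vexp_ge1 H.
Let mV := measurable_Vexp m : measurable_fun setT V.

(* Translating the noise of the chain started at [x] so that its next position
   is [s] behind that of the chain started at [y] costs the chi-square factor of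
   two Gaussian densities; the hypothesis on [f] is the inequality
   [(f z)^2 <= e f (z + s)] linearized by [tau], which survives integration. *)
Lemma Qop_harnack_step gamma f x y s (e t : R) : small L m gamma -> adm V f -> (forall z, 0 <= f z) ->
  0 <= e -> 0 < t ->
  (forall (tau : R) z, 0 < tau -> 2 * f z <= tau * f (z + s) + tau^-1 * e) ->
  2 * Qop U gamma f x <= t * Qop U gamma f y + t^-1 * (e *
    expR (enorm (s - (y - x) + gamma *: (g y - g x)) ^+ 2 / (2 * gamma))).
Proof.
move=> sg af f0 e0 t0 hf; have gam0 := small_gt0 sg.
have [mf _] := af.
pose r1 (u : T) : R := rprop U gamma x u; pose r2 (u : T) : R := rprop U gamma y (u + s).
have r10 u : 0 < r1 u by exact: rprop_gt0.
have r20 u : 0 < r2 u by exact: rprop_gt0.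
pose vd := s - (y - x) + gamma *: (g y - g x).
have ratio u : r1 u ^+ 2 / r2 u = expR (enorm vd ^+ 2 / (2 * gamma)) *
    gdens gamma (u + (- x + gamma *: g x - vd)).
  have id (a b : T) : (u + s - y + gamma *: b) = (u - x + gamma *: a) + (s - (y - x) + gamma *: (b - a)).
    by apply/rowP => i; rewrite !mxE; ring.
  have -> : r2 u = gdens gamma ((u - x + gamma *: g x) + vd) by rewrite /r2 rpropE (id (g x)).
  by rewrite (gdens_sqr_div _ _ gam0) /vd !addrA.
have mr1 : measurable_fun setT r1 by exact: measurable_section (measurable_rprop H gamma).
have mr2' : measurable_fun setT (rprop U gamma y) by exact: measurable_section (measurable_rprop H gamma).
have msh := measurable_rv_shift s.
have mr2 : measurable_fun setT r2 by exact: (measurableT_comp mr2' msh).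
have mfs : measurable_fun setT (fun u : T => f (u + s)) by exact: (measurableT_comp mf msh).
pose c := t^-1 * e * expR (enorm vd ^+ 2 / (2 * gamma)).
have c0 : 0 <= c by rewrite !mulr_ge0 ?expR_ge0// invr_ge0 ltW.
pose A (u : T) : R := r2 u * f (u + s).
pose B (u : T) : R := gdens gamma (u + (- x + gamma *: g x - vd)).
have A0 (u : T) : 0 <= A u := mulr_ge0 (ltW (r20 u)) (f0 (u + s)).
have B0 (u : T) : 0 <= B u := ltW (gdens_gt0 _ gam0).
have mA : measurable_fun setT A := measurable_funM mr2 mfs.
have mB : measurable_fun setT B := measurable_gdens gamma (measurable_rv_shift _).
have mtA : measurable_fun setT (fun u : T => t * A u) := measurable_funM (measurable_cst t) mA.
have mcB : measurable_fun setT (fun u : T => c * B u) := measurable_funM (measurable_cst c) mB.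
have mrf : measurable_fun setT (fun u : T => rprop U gamma y u * f u) := measurable_funM mr2' mf.
have mr1f : measurable_fun setT (fun u : T => r1 u * f u) := measurable_funM mr1 mf.
have m2r1f : measurable_fun setT (fun u : T => 2 * (r1 u * f u)) :=
  measurable_funM (measurable_cst (2 : R)) mr1f.
have r1f0 (u : T) : 0 <= r1 u * f u := mulr_ge0 (ltW (r10 u)) (f0 u).
have intA : (\int[mu]_u (A u)%:E = (Qop U gamma f y)%:E)%E.
  rewrite /Qop -(kopE mV V1 (good_rprop H sg) y af).
  apply: (integral_shift s (f := fun u : T => (rprop U gamma y u * f u)%:E)).
    refine (iffRL (measurable_EFinP _ _) mrf).
  move=> u; rewrite lee_fin; refine (mulr_ge0 (ltW (rprop_gt0 U y u gam0)) (f0 u)).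
have intB : (\int[mu]_u (B u)%:E = 1)%E by exact: integral_gdens.
have intL : (\int[mu]_u (2 * (r1 u * f u))%:E = (2 * Qop U gamma f x)%:E)%E.
  rewrite (integral_scale _ (ler0n R 2) mr1f r1f0).
  by rewrite /r1 (kopE mV V1 (good_rprop H sg) x af) EFinM.
have intR : (\int[mu]_u (t * A u + c * B u)%:E = (t * Qop U gamma f y + c)%:E)%E.
  rewrite (integral_add_real _ mtA mcB); last 2 first.
  - by move=> u; exact: mulr_ge0 (ltW t0) (A0 u).
  - by move=> u; exact: mulr_ge0 c0 (B0 u).
  rewrite (integral_scale _ (ltW t0) mA A0) (integral_scale _ c0 mB B0) intA intB mule1.
  by rewrite -EFinM -EFinD.
rewrite [t^-1 * (e * _)]mulrA -lee_fin -intL -/c -intR.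
apply: le_integral_real => [| |u|u].
- exact: m2r1f.
- exact: (measurable_funD mtA mcB).
- exact: mulr_ge0 (ler0n R 2) (r1f0 u).
(* This [tau] depends on [u]: after multiplication by [r1 u], the right-hand side of [hf] is
   [t r2 f (u + s) + t^-1 e r1^2 / r2], and the last quotient is given by [ratio]. *)
have tau0 : 0 < t * r2 u / r1 u := divr_gt0 (mulr_gt0 t0 (r20 u)) (r10 u).
have arith (p q fu fs G B' : R) : 0 < p -> 0 < q -> p ^+ 2 / q = G * B' ->
    2 * fu <= t * q / p * fs + (t * q / p)^-1 * e -> 2 * (p * fu) <= t * (q * fs) + t^-1 * e * G * B'.
  move=> p0 q0 pq h.
  have -> : t^-1 * e * G * B' = t^-1 * e * (p ^+ 2 / q) by rewrite pq mulrA.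
  have := ler_wpM2r (ltW p0) h.
  have -> : (t * q / p * fs + (t * q / p)^-1 * e) * p = t * (q * fs) + t^-1 * e * (p ^+ 2 / q).
    by field; rewrite !gt_eqF.
  by lra.
exact: arith (r10 u) (r20 u) (ratio u) (hf _ u tau0).
Qed.

(** Here [k] counts the steps left and [(k / n) v] is the current gap. A step closes [v / n] of it;
    as [1 / n <= gamma], this shift and the difference of the gradient terms displace the noise by
    at most [gamma (1 + L) |v|], whence the exponent per step. *)
Lemma Qop_harnack gamma n v f : small L m gamma -> (0 < n)%N -> n%:R^-1 <= gamma ->
  adm V f -> (forall z, 0 <= f z <= 1) -> forall k, (k <= n)%N -> forall x (t : R), 0 < t ->
  2 * iter k (Qop U gamma) f x <= t * iter k (Qop U gamma) f (x + (k%:R / n%:R) *: v) +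
    t^-1 * expR (k%:R * (gamma * ((1 + L) * enorm v) ^+ 2 / 2)).
Proof.
move=> sg n0 ng af f01; have gam0 := small_gt0 sg.
have mk := markov_Qop H sg.
elim=> [_ x t t0|k IH kn x t t0].
  (* With no step left, expand [t^-1 (1 - t f x)^2 >= 0] and use [f^2 <= f]. *)
  rewrite /= mul0r scale0r addr0 mul0r expR0 mulr1.
  have /andP[fx0 fx1] := f01 x.
  have h : 0 <= t^-1 * (1 - t * f x) ^+ 2 by rewrite mulr_ge0 ?sqr_ge0// invr_ge0 ltW.
  have h' : t^-1 * (1 - t * f x) ^+ 2 = t^-1 - 2 * f x + t * f x ^+ 2.
    by field; rewrite gt_eqF.
  have h2 : t * f x ^+ 2 <= t * f x by rewrite ler_pM2l// expr2 ler_piMl.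
  by move: h; rewrite h'; lra.
have ak : adm V (iter k (Qop U gamma) f) by have [h _ _ _] := markov_iter mk k; exact: h.
have k01 z : 0 <= iter k (Qop U gamma) f z <= 1.
  exact: (markov_unit V1 (markov_iter mk k)).
pose y := x + (k.+1%:R / n%:R) *: v; pose s := (k%:R / n%:R) *: v.
have nR : 0 < n%:R :> R by rewrite ltr0n.
pose e := expR (k%:R * (gamma * ((1 + L) * enorm v) ^+ 2 / 2)).
have e0 : 0 <= e by exact: expR_ge0.
have IH' (tau : R) z : 0 < tau -> 2 * iter k (Qop U gamma) f z <=
    tau * iter k (Qop U gamma) f (z + s) + tau^-1 * e.
  by move=> tau0; apply: IH => //; exact: ltnW.
have k0 z : 0 <= iter k (Qop U gamma) f z by case/andP: (k01 z).
have := Qop_harnack_step x y sg ak k0 e0 t0 IH'.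
move=> h; rewrite !iterS_fun; apply: le_trans h _.
apply: lerD; first exact: lexx. rewrite ler_pM2l ?invr_gt0// -expRD ler_expR.
have kq (q : R) : k.+1%:R * q = k%:R * q + q by rewrite -natr1 mulrDl mul1r.
rewrite kq lerD2l.
have yx : y - x = (k.+1%:R / n%:R) *: v by rewrite /y addrC addKr.
have sy : s - (y - x) = (- n%:R^-1) *: v.
  by rewrite yx /s -scalerBl; congr (_ *: v); rewrite -natr1; field; rewrite gt_eqF.
have nv : enorm (s - (y - x) + gamma *: (g y - g x)) <= gamma * ((1 + L) * enorm v).
  apply: le_trans (enormD _ _) _; rewrite sy !enormZ normrN !ger0_norm ?invr_ge0 ?(ltW gam0)// ?(ltW nR)//.
  have lip := rp_lip H x y; rewrite yx enormZ ger0_norm in lip; last by rewrite divr_ge0.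
  have kn1 : k.+1%:R / n%:R <= 1 :> R by rewrite ler_pdivrMr// mul1r ler_nat.
  have v0 := enorm_ge0 v.
  have h1 : n%:R^-1 * enorm v <= gamma * enorm v by rewrite ler_wpM2r.
  have h2 : gamma * enorm (g y - g x) <= gamma * (L * enorm v).
    rewrite ler_pM2l//; apply: le_trans lip _; rewrite ler_wpM2l// ler_piMl//.
  by have := lerD h1 h2; rewrite -mulrDr mulrDl mul1r.
rewrite ler_pdivrMr ?mulr_gt0//.
have w0 : 0 <= (1 + L) * enorm v by rewrite mulr_ge0 ?enorm_ge0// addr_ge0.
apply: (@le_trans _ _ ((gamma * ((1 + L) * enorm v)) ^+ 2)).
  by apply: lerXn2r => //; rewrite nnegrE ?enorm_ge0// mulr_ge0// ltW.
by move: (((1 + L) * enorm v)) => w; rewrite le_eqVlt; apply/orP; left; apply/eqP; field.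
Qed.

End harnack.

(** * Contraction of the adjusted chain *)

Lemma norm_sub_le (R : realDomainType) (p q r : R) :
  0 <= p <= r -> 0 <= q <= r -> `|p - q| <= r.
Proof.
by move=> /andP[p0 pr] /andP[q0 qr]; rewrite ler_norml; apply/andP; split; lra.
Qed.

Section contraction.
Context (R : realType) (d : nat) (U : 'rV[R]_d -> R) (L M m K : R).
Hypothesis H : regular_potential U L M m K.
Local Notation V := (@Vexp R d (m / 16)).
Local Notation T := 'rV[R]_d.
Implicit Types (x y v : T) (gamma : R) (f : T -> R).

Let m0 : 0 < m := rp_m0 H.
Let L0 : 0 <= L := rp_L0 H.
Let V1 := Vexp_ge1 H.
Let mV := measurable_Vexp m : measurable_fun setT V.

Lemma small_near0 : exists Gam, 0 < Gam /\ forall gamma, 0 < gamma <= Gam -> small L m gamma.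
Proof.
pose s := 1 + m + 4 * L + 4 * L ^+ 2 / m.
have q0 : 0 <= 4 * L ^+ 2 / m by rewrite divr_ge0 ?(ltW m0)// mulr_ge0 ?sqr_ge0.
have s0 : 0 < s by rewrite /s; move: m0 L0; lra.
exists s^-1; split=> [|gamma /andP[gam0 gs]]; first by rewrite invr_gt0.
have gs1 : gamma * s <= 1 by rewrite -ler_pdivlMr// div1r.
have g1 : 0 <= gamma * m by rewrite mulr_ge0// ltW.
have g2 : 0 <= gamma * L by rewrite mulr_ge0// ltW.
have g3 : 0 <= gamma * (4 * L ^+ 2 / m) by rewrite mulr_ge0// ltW.
have gs2 : gamma + gamma * m + 4 * (gamma * L) + gamma * (4 * L ^+ 2 / m) <= 1.
  by move: gs1; rewrite /s; move: (4 * L ^+ 2 / m) => q; lra.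
have gam0' := ltW gam0.
split => //; [by lra|by lra|by lra|].
have : gamma * (4 * L ^+ 2 / m) <= 1 by lra.
by rewrite mulrA ler_pdivrMr// mul1r => h; lra.
Qed.

Lemma Qop_overlap gamma n (D : R) x y f : small L m gamma -> (0 < n)%N -> n%:R^-1 <= gamma ->
  gamma * n%:R <= 2 -> enorm (y - x) ^+ 2 <= D ->
  adm V f -> (forall z, 0 <= f z <= 1) ->
  iter n (Qop U gamma) f x - iter n (Qop U gamma) f y <= 1 - (1 + expR ((1 + L) ^+ 2 * D))^-1.
Proof.
move=> sg n0 ng gn xyD af f01.
have mk := markov_iter (markov_Qop H sg) n.
have F01 := markov_unit V1 mk af f01.
have D0 : 0 <= (1 + L) ^+ 2 * D by rewrite mulr_ge0 ?sqr_ge0// (le_trans (sqr_ge0 _) xyD).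
have E1 : 1 <= expR ((1 + L) ^+ 2 * D) by rewrite -[leLHS]expR0 ler_expR.
(* The added 1 ensures [E >= 2]. Over the block the exponent is [gamma n (1 + L)^2 |y - x|^2 / 2],
   and [gamma n <= 2] bounds it independently of [gamma]. *)
apply: overlap_le => [| | |t t0].
- exact: F01.
- by case/andP: (F01 y).
- by lra.
have := Qop_harnack H (y - x) sg n0 ng af f01 (leqnn n) x t0.
have nn : n%:R / n%:R = 1 :> R by rewrite divff// pnatr_eq0 -lt0n.
rewrite nn scale1r (addrC x) subrK => h; apply: le_trans h _.
rewrite lerD2l ler_pM2l ?invr_gt0//.
apply: le_trans (_ : expR ((1 + L) ^+ 2 * D) <= _); last by rewrite lerDr.
rewrite ler_expR exprMn.
apply: (@le_trans _ _ ((1 + L) ^+ 2 * enorm (y - x) ^+ 2)); last first.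
  by rewrite ler_wpM2l// sqr_ge0.
have w0 : 0 <= (1 + L) ^+ 2 * enorm (y - x) ^+ 2 by rewrite mulr_ge0 ?sqr_ge0.
move: (_ * enorm _ ^+ 2) w0 => w w0.
have := ler_wpM2r w0 gn; rewrite (mulrC gamma); lra.
Qed.

Lemma Rop_Qop_le gamma c : small L m gamma -> (forall x, rej U gamma x <= c * V x) ->
  forall f, adm V f -> (forall x, 0 <= f x <= 1) ->
  forall x, `|Rop U gamma f x - Qop U gamma f x| <= c * V x.
Proof.
move=> sg hc f af f01 x; apply: le_trans (hc x).
rewrite (Rop_sub_Qop H)//.
have gd := good_rej H sg; have gam0 := small_gt0 sg.
have r0 : 0 <= rej U gamma x := rej_ge0 H x gam0.
have /andP[fx0 fx1] := f01 x.
have k0 : 0 <= kop (@lebRV R d) (rej_kernel U gamma) f x.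
  apply: Rintegral_ge0 => y _; apply: mulr_ge0; last by case/andP: (f01 y).
  by case/andP: (rej_kernel_itv H x y gam0).
have k1 : kop (@lebRV R d) (rej_kernel U gamma) f x <= rej U gamma x.
  apply: (kop_le mV V1 gd) => //; first exact: adm_cst.
  by move=> y; case/andP: (f01 y).
have p0 : 0 <= f x * rej U gamma x by exact: mulr_ge0.
have p1 : f x * rej U gamma x <= rej U gamma x by rewrite ler_piMl.
by apply: norm_sub_le; [rewrite p0|rewrite k0].
Qed.

Lemma Rop_minor : exists Gam b eps, [/\ 0 < Gam, 0 < b, 0 < eps <= 2^-1 &
  forall gamma, 0 < gamma <= Gam -> small L m gamma /\
    (forall x, Rop U gamma V x <= (1 - gamma) * V x + gamma * b) /\
    forall n, (0 < n)%N -> n%:R^-1 <= gamma -> gamma * n%:R <= 2 ->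
    forall x y f, V x + V y <= 8 * b -> adm V f -> (forall z, 0 <= f z <= 1) ->
    iter n (Rop U gamma) f x - iter n (Rop U gamma) f y <= 1 - eps].
Proof.
have [G1 [G10 hG1]] := small_near0.
have [G2 [b [G20 b_gt0 drift]]] := mala_drift H.
have [C [C0 hC]] := rej_le_global H.
(* From [|y - x|^2 <= 2 (|x|^2 + |y|^2)] and [m |x|^2 / 16 <= V x] on the set [V x + V y <= 8 b]. *)
pose D := 16 * 16 * b / m.
pose E := 1 + expR ((1 + L) ^+ 2 * D).
have D0 : 0 <= D by rewrite /D; apply: divr_ge0; [rewrite !mulr_ge0// ltW|exact: ltW].
have E2 : 2 <= E.
  have : 1 <= expR ((1 + L) ^+ 2 * D) by rewrite -[leLHS]expR0 ler_expR mulr_ge0// sqr_ge0.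
  by rewrite /E; lra.
have E0 : 0 < E by lra.
have Ei : E^-1 <= 2^-1 by rewrite lef_pV2 ?posrE.
have Ei0 : 0 < E^-1 by rewrite invr_gt0.
(* The comparison errors at [x] and [y] add up to [C sqrt gamma (2 (V x + V y) + 8 b)], at most
   [24 b C sqrt gamma]; [sqrt gamma <= s] makes this at most [E^-1 / 2], half of the overlap. *)
pose s := (48 * b * C * E + 1)^-1.
have den : 0 < 48 * b * C * E + 1 by rewrite ltr_wpDl// !mulr_ge0// ltW.
have s0 : 0 < s by rewrite invr_gt0.
pose Gam := Num.min (Num.min G1 G2) (s ^+ 2).
have Gam0 : 0 < Gam by rewrite !lt_min G10 G20/= exprn_gt0.
exists Gam, b, (E^-1 / 2); split => //.
  by apply/andP; split; lra.
move=> gamma /andP[gam0 gG].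
have [gG1 gG2 gs] : [/\ gamma <= G1, gamma <= G2 & gamma <= s ^+ 2].
  by move: gG; rewrite !le_min => /andP[/andP[]].
have sg : small L m gamma by apply: hG1; rewrite gam0.
have drift' x := drift gamma x sg gG2.
split=> //; split=> // n n0 ng gn x y f xyb af f01.
have mkR := markov_Rop H sg; have mkQ := markov_Qop H sg.
have [_ gam1 _ _ _] := sg.
pose del := C * (gamma * Num.sqrt gamma).
have sq0 : 0 <= Num.sqrt gamma by exact: sqrtr_ge0.
have del0 : 0 <= del by rewrite !mulr_ge0// ltW.
have cmp z := iter_compare mV V1 mkR mkQ gam0 b_gt0 drift' del0
   (Rop_Qop_le sg (fun x => hC gamma x sg)) af f01 n z.
have xyD : enorm (y - x) ^+ 2 <= D.
  have id (a e : T) : enorm (e - a) ^+ 2 <= 2 * (enorm a ^+ 2 + enorm e ^+ 2).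
    have := edot_ge0 (a + e); rewrite !enormE !edotE (edotC e a).
    by move: (edot a a) (edot e e) (edot a e) => r1 r2 r3; lra.
  apply: le_trans (id x y) _.
  have ex : 1 + m / 16 * enorm x ^+ 2 <= V x := expR_ge1Dx _.
  have ey : 1 + m / 16 * enorm y ^+ 2 <= V y := expR_ge1Dx _.
  rewrite /D ler_pdivlMr//; move: xyb ex ey.
  move: (V x) (V y) (enorm x ^+ 2) (enorm y ^+ 2) => r1 r2 X Y; lra.
have ov := Qop_overlap sg n0 ng gn xyD af f01.
have ss : Num.sqrt gamma <= s by have := ler_wsqrtr gs; rewrite sqrtr_sqr (gtr0_norm s0).
have small_err : 24 * b * C * Num.sqrt gamma <= E^-1 / 2.
  apply: (@le_trans _ _ (24 * b * C * s)); first by rewrite ler_wpM2l// !mulr_ge0// ltW.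
  have EE : E^-1 / 2 * E = 2^-1 by field; rewrite gt_eqF.
  rewrite -(ler_pM2r E0) EE /s.
  have : 48 * b * C * E / (48 * b * C * E + 1) <= 1 by rewrite ler_pdivrMr// mul1r lerDl.
  by move: (_^-1) => r; lra.
have err z : del * (n%:R * V z + n%:R ^+ 2 * (gamma * b)) <= C * Num.sqrt gamma * (2 * V z + 4 * b).
  rewrite (_ : _ * (_ + _) = C * Num.sqrt gamma * ((gamma * n%:R) * V z + (gamma * n%:R) ^+ 2 * b)); last first.
    by rewrite /del; ring.
  have gn0 : 0 <= gamma * n%:R by rewrite mulr_ge0// ltW.
  apply: ler_wpM2l; first exact: mulr_ge0.
  apply: lerD; first by rewrite ler_wpM2r// (le_trans ler01).
  rewrite ler_pM2r//; move: (gamma * n%:R) gn0 gn => r r0 r2; nra.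
have cx := le_trans (cmp x) (err x); have cy := le_trans (cmp y) (err y).
have tot : C * Num.sqrt gamma * (2 * V x + 4 * b) + C * Num.sqrt gamma * (2 * V y + 4 * b) <= E^-1 / 2.
  apply: le_trans small_err; rewrite -mulrDr.
  rewrite (_ : 24 * b * C * _ = C * Num.sqrt gamma * (24 * b)); last by ring.
  by apply: ler_wpM2l; [exact: mulr_ge0|lra].
move: cx cy; rewrite !ler_norml => /andP[_ cx] /andP[cy _].
by move: ov; rewrite -/E; lra.
Qed.

Lemma Rop_contract : exists Gam C rho, [/\ 0 < Gam, 0 <= C, 0 <= rho < 1 &
  forall gamma, 0 < gamma <= Gam -> small L m gamma /\
    forall k x y f, adm V f -> (forall z, `|f z| <= V z) ->
    iter k (Rop U gamma) f x - iter k (Rop U gamma) f y <= C * powR rho (gamma * k%:R) * (V x + V y)].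
Proof.
have [Gam [b [eps [Gam0 b_gt0 /andP[eps0 eps2] minor]]]] := Rop_minor.
pose beta := eps / (2 * b).
have beta0 : 0 < beta by rewrite divr_gt0// mulr_gt0.
pose th := 1 - eps / 4.
have th0 : 0 < th by rewrite /th; lra.
have th1 : th < 1 by rewrite /th; lra.
(* A block of [n] steps has [gamma n <= 2], so a factor [th] per block is [th^(1/2)] per unit of
   [gamma k]. *)
pose rho := powR th 2^-1.
have rho0 : 0 < rho by rewrite powR_gt0.
have rho1 : rho < 1.
  by rewrite /rho /powR gt_eqF// -[ltRHS]expR0 ltr_expR nmulr_llt0// ln_lt0// th0.
(* Then [a beta = 1 + b], the factor by which [V] may grow over the incomplete block. *)
pose a := (1 + b) / beta.
have a0 : 0 < a by rewrite divr_gt0// addr_gt0.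
exists Gam, (a * (1 + beta) * th^-1), rho; split=> //.
- exact: mulr_ge0 (mulr_ge0 (ltW a0) (addr_ge0 ler01 (ltW beta0))) (eqbRL (invr_ge0 _) (ltW th0)).
- by rewrite (ltW rho0).
move=> gamma gG; have [sg [drift mn]] := minor gamma gG; split=> //.
have [gam0 gam1 _ _ _] := sg.
have mkR := markov_Rop H sg.
pose n := (Num.truncn gamma^-1).+1.
have gi0 : 0 <= gamma^-1 by rewrite invr_ge0 ltW.
have n0 : (0 < n)%N by [].
have nR : 0 < n%:R :> R by rewrite ltr0n.
have ng : gamma^-1 <= n%:R by apply: ltW; exact: truncnS_gt.
have ng' : n%:R^-1 <= gamma by rewrite -[leRHS]invrK lef_pV2 ?posrE// invr_gt0.
have gn1 : 1 <= gamma * n%:R by rewrite -ler_pdivrMl// mulr1.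
have gn2 : gamma * n%:R <= 2.
  have : n%:R <= gamma^-1 + 1 by rewrite /n -natr1 lerD2r truncn_le.
  by move/(ler_wpM2l (ltW gam0)); rewrite mulrDr mulfV ?gt_eqF// mulr1; lra.
have drift2 x : iter n (Rop U gamma) V x <= V x / 2 + b.
  exact: (iter_drift_half mV V1 mkR gam1 b_gt0 drift).
have mn' x y f : V x + V y <= 8 * b -> adm V f -> (forall z, 0 <= f z <= 1) ->
    iter n (Rop U gamma) f x - iter n (Rop U gamma) f y <= 1 - eps.
  exact: mn.
move=> k x y f af fV.
have aV : adm V V by exact: adm_V.
pose q := (k %/ n)%N; pose r := (k %% n)%N.
have kE : k = (q * n + r)%N by exact: divn_eq.
pose h := iter r (Rop U gamma) f.
have ah : adm V h by exact: (adm_iter mkR).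
have hV z : `|h z| <= (1 + b) * V z.
  have h1 : `|h z| <= iter r (Rop U gamma) V z.
    exact: (markov_norm_le V1 (markov_iter mkR r)).
  apply: le_trans h1 _; apply: le_trans (iter_drift_le mV V1 mkR gam0 gam1 b_gt0 drift r z) _.
  by have := V1 z; move: (V z) => v v1; rewrite mulrDl mul1r lerD2l ler_peMr// ltW.
have osc u v : h u - h v <= a * (2 + beta * (V u + V v)).
  have := hV u; have := hV v; rewrite !ler_norml => /andP[hv _] /andP[_ hu].
  have -> : a * (2 + beta * (V u + V v)) = 2 * a + (1 + b) * (V u + V v).
    by rewrite /a; field; rewrite gt_eqF.
  by move: (h u) (h v) hu hv => hu' hv' hu hv; move: a0; lra.
have := harris mV V1 (markov_iter mkR n) b_gt0 eps0 eps2 drift2 mn' q a0 ah osc x y.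
have itE : iter q (iter n (Rop U gamma)) h = iter k (Rop U gamma) f.
  by rewrite -iterM -iterD -kE.
rewrite itE -/beta -/th => hh; apply: le_trans hh _.
(* The factor [th^-1] of the constant turns [q] into [q + 1], for which
   [gamma k <= gamma n (q + 1) <= 2 (q + 1)]. *)
have thq : th ^+ q <= th^-1 * powR rho (gamma * k%:R).
  rewrite ler_pdivlMl// -exprS -(powR_mulrn _ (ltW th0)).
  rewrite /rho -powRrM; apply: ger_powR; first by rewrite th0 ltW.
  have kq : (k%:R : R) <= q.+1%:R * n%:R.
    by rewrite -natrM ler_nat kE mulSn addnC leq_add2r ltnW// ltn_pmod.
  have := ler_wpM2l (ltW gam0) kq.
  have : q.+1%:R * (gamma * n%:R) <= q.+1%:R * 2 by rewrite ler_wpM2l.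
  by move: (q.+1%:R) => Q; lra.
have S2 : 2 + beta * (V x + V y) <= (1 + beta) * (V x + V y).
  by have := V1 x; have := V1 y; move: (V x) (V y) => vx vy; lra.
rewrite (_ : a * (1 + beta) * _ * _ * _ =
   a * (th^-1 * powR rho (gamma * k%:R)) * ((1 + beta) * (V x + V y))); last by ring.
apply: ler_pM => //.
- by rewrite mulr_ge0 ?exprn_ge0// ltW.
- by rewrite addr_ge0// mulr_ge0 ?addr_ge0 ?(ltW beta0)// (le_trans ler01).
- by rewrite ler_pM2l.
Qed.

End contraction.

(** * Identification with the measures *)

Section mixture.
Context d1 d2 (X : measurableType d1) (Z : measurableType d2) (R : realType).
Context (mu : {measure set X -> \bar R}) (k : X -> {measure set Z -> \bar R}).
Hypothesis mk : forall A, measurable A -> measurable_fun setT (k ^~ A).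
Local Open Scope ereal_scope.

Definition mixture (A : set Z) : \bar R := \int[mu]_x k x A.

Let mixture0 : mixture set0 = 0.
Proof. by rewrite /mixture integral0_eq// => x _; rewrite measure0. Qed.

Let mixture_ge0 A : 0 <= mixture A.
Proof. by apply: integral_ge0 => x _; exact: measure_ge0. Qed.

Let mixture_sigma : semi_sigma_additive mixture.
Proof.
move=> F mF tF mUF; rewrite [X in _ --> X](_ : _ = \sum_(n <oo) mixture (F n)); last first.
  rewrite -integral_nneseries//; last by move=> n; exact: mk.
  apply: eq_integral => x _.
  by apply/esym/cvg_lim => //; exact: measure_semi_sigma_additive.
by apply: is_cvg_nneseries => n _ _; exact: mixture_ge0.
Qed.

HB.instance Definition _ := isMeasure.Build _ _ _ mixture mixture0 mixture_ge0 mixture_sigma.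

Import HBNNSimple.

Let integral_mixture_nnsfun (f : {nnsfun Z >-> R}) :
  \int[mixture]_z (f z)%:E = \int[mu]_x \int[k x]_z (f z)%:E.
Proof.
rewrite integralT_nnsfun sintegralE.
under [RHS]eq_integral do rewrite integralT_nnsfun sintegralE.
rewrite ge0_integral_fsum//; last 2 first.
- by move=> r; apply: measurable_funeM; exact: mk.
- move=> r x _; have [r0|r0] := leP 0%R r; first exact: mule_ge0.
  by rewrite preimage_nnfun0// measure0 mule0.
apply: eq_fsbigr => r _.
have [r0|r0] := leP 0%R r; first by rewrite ge0_integralZl//; exact: mk.
rewrite preimage_nnfun0// measure0 mule0 integral0_eq// => x _.
by rewrite measure0 mule0.
Qed.

Let integral_mixture (f : Z -> \bar R) : (forall z, 0 <= f z) -> measurable_fun setT f ->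
  \int[mixture]_z f z = \int[mu]_x \int[k x]_z f z.
Proof.
move=> f0 mf; pose f_ := nnsfun_approx measurableT mf.
have f_ub n z : 0 <= (f_ n z)%:E by rewrite lee_fin.
have f_m n : measurable_fun setT (fun z => (f_ n z)%:E) by exact/measurable_EFinP.
have f_nd z : {homo (fun n => (f_ n z)%:E) : a b / (a <= b)%N >-> a <= b}.
  by move=> a b ab; rewrite lee_fin; exact/lefP/nd_nnsfun_approx.
have int_lim (nu : {measure set Z -> \bar R}) :
    \int[nu]_z f z = limn (fun n => \int[nu]_z (f_ n z)%:E).
  rewrite -monotone_convergence//; apply: eq_integral => z _.
  by apply/esym/cvg_lim => //; exact: cvg_nnsfun_approx.
rewrite int_lim; under [RHS]eq_integral do rewrite int_lim.
rewrite monotone_convergence//.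
- by under eq_fun do rewrite integral_mixture_nnsfun.
- by move=> n; exact: measurable_fun_integral_kernel.
- by move=> n x _; exact: integral_ge0.
- by move=> x _ a b ab; apply: ge0_le_integral => // z _; exact: f_nd.
Qed.

(** The kernels and iterates in the definitions are bare set functions; a measure with the same
    values can be substituted for them, which opens them to integration theory. *)
Lemma mixture_measure : exists nu : {measure set Z -> \bar R},
  (forall A, nu A = \int[mu]_x k x A) /\
  forall f : Z -> \bar R, (forall z, 0 <= f z) -> measurable_fun setT f ->
    \int[nu]_z f z = \int[mu]_x \int[k x]_z f z.
Proof. by exists mixture. Qed.

End mixture.

Section density.
Context d (T : measurableType d) (R : realType) (mu : {measure set T -> \bar R}) (p : T -> R).
Hypotheses (mp : measurable_fun setT p) (p0 : forall x, 0 <= p x).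
Local Open Scope ereal_scope.

Lemma density_measure : exists nu : {measure set T -> \bar R},
  (forall A, nu A = \int[mu]_(x in A) (p x)%:E) /\
  forall f : T -> R, measurable_fun setT f -> (forall x, 0 <= f x)%R ->
    \int[nu]_x (f x)%:E = \int[mu]_x (p x * f x)%:E.
Proof.
(* A measure with density [p] is the mixture of the point masses [p x] at [x]. *)
pose k x : {measure set T -> \bar R} := mscale (NngNum (p0 x)) \d_x.
have mk A : measurable A -> measurable_fun setT (k ^~ A).
  move=> mA; rewrite /k /mscale/=; apply: emeasurable_funM; first exact/measurable_EFinP.
  by apply/measurable_EFinP; exact: measurable_indic.
have [nu [nuE nuI]] := mixture_measure mu mk; exists nu; split=> [A|f mf f0].
  rewrite nuE [RHS]integral_mkcond; apply: eq_integral => x _.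
  rewrite (_ : k x A = (p x)%:E * \d_x A)// diracE patchE.
  by case: (x \in A); rewrite ?mule1 ?mule0.
rewrite nuI; last 2 first.
- by move=> x; rewrite lee_fin.
- exact/measurable_EFinP.
have mf' : measurable_fun setT (fun x => (f x)%:E) by exact/measurable_EFinP.
apply: eq_integral => x _; rewrite ge0_integral_mscale//; last by move=> z _; rewrite lee_fin.
by rewrite integral_dirac// diracT mul1e.
Qed.

End density.

Section mala_measures.
Context (R : realType) (d : nat) (U : 'rV[R]_d -> R) (L M m K : R).
Hypothesis H : regular_potential U L M m K.
Implicit Types (x y : 'rV[R]_d) (gamma : R) (f : 'rV[R]_d -> R).

Local Notation V := (@Vexp R d (m / 16)).
Local Notation mu := (@lebRV R d).
Local Notation T := 'rV[R]_d.
Local Notation small := (small L m).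

Let V1 := Vexp_ge1 H.
Let mV := measurable_Vexp m : measurable_fun setT V.

Lemma adm_indic (A : set T) : measurable A -> adm V (\1_A : T -> R).
Proof.
move=> mA; apply: (adm_bounded V1 (C := 1)); first exact: measurable_indic.
by move=> x; rewrite indicE ger0_norm// lern1 leq_b1.
Qed.

Lemma malaK_measure gamma x : small gamma -> exists nu : {measure set T -> \bar R},
  (forall A, nu A = malaK U gamma x A) /\
  forall f, adm V f -> (forall y, 0 <= f y) ->
    (\int[nu]_y (f y)%:E = (Rop U gamma f x)%:E)%E.
Proof.
move=> sg; have gam0 := small_gt0 sg.
have [nu [nuE nuI]] := density_measure mu
  (measurable_section x (measurable_acc_kernel H gam0))
  (fun y => proj1 (andP (acc_kernel_itv H x y gam0))).
have rejE : (\int[mu]_y (rej_kernel U gamma x y)%:E = (rej U gamma x)%:E)%E.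
  rewrite /rej -(kopE mV V1 (good_rej H sg)); last exact: (adm_cst V1).
  by under [RHS]eq_integral do rewrite mulr1.
exists (measure_add nu (mscale (NngNum (rej_ge0 H x gam0)) \d_x)); split=> [A|f af f0].
  rewrite -[LHS]/(measure_add _ _ A) measure_addE nuE /malaK; congr (_ + _)%E.
  by rewrite rejE muleC.
have [mf _] := af.
have mf' : measurable_fun setT (fun x => (f x)%:E) by exact/measurable_EFinP.
rewrite ge0_integral_measure_add//; last by move=> y _; rewrite lee_fin.
rewrite nuI// (kopE mV V1 (good_acc H sg))// ge0_integral_mscale//; last first.
  by move=> y _; rewrite lee_fin.
rewrite integral_dirac// diracT mul1e -EFinM -EFinD /Rop.
by rewrite [rej _ _ _ * _]mulrC.
Qed.

Lemma malaIter_measure gamma x k : small gamma -> exists nu : {measure set T -> \bar R},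
  malaIter U gamma x k = nu /\
  forall f, adm V f -> (forall y, 0 <= f y) ->
    (\int[nu]_y (f y)%:E = (iter k (Rop U gamma) f x)%:E)%E.
Proof.
move=> sg; have mkR := markov_Rop H sg.
have /choice[kn knP] := fun y => malaK_measure y sg.
have mkn A : measurable A -> measurable_fun setT (kn ^~ A).
  (* The mass given to [A] is [Rop] of an indicator, hence measurable in the starting point. *)
  move=> mA; rewrite (_ : kn ^~ A = fun y => (Rop U gamma \1_A y)%:E).
    apply/measurable_EFinP; exact: proj1 (markov_adm mkR (adm_indic mA)).
  apply/funext => y; have [_ <-] := knP y.
  - by rewrite integral_indic// setIT.
  - exact: adm_indic.
  - by move=> z; rewrite indicE.
elim: k => [|k [nu [nuE nuI]]].
  exists \d_x; split=> // f [mf _] f0.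
  by rewrite integral_dirac// ?diracT ?mul1e//; exact/measurable_EFinP.
have [nu' [nuE' nuI']] := mixture_measure nu mkn.
exists nu'; split=> [|f af f0].
  apply/funext => A /=; rewrite nuE' nuE.
  by apply: eq_integral => y _; have [-> _] := knP y.
have [mf _] := af.
rewrite nuI'//; last by exact/measurable_EFinP.
(* The last step of the chain is the first operator applied to [f]. *)
rewrite iterSr -nuI.
- by apply: eq_integral => y _; have [_ ->] := knP y.
- exact: (markov_adm mkR af).
- by move=> y; rewrite -(markov_0 V1 mkR y); apply: (markov_le mkR (adm_cst V1 0) af).
Qed.

End mala_measures.

(** * Invariance *)

Section nonneg_parts.
Context d (T : measurableType d) (R : realType) (V : T -> R).
Hypotheses (mV : measurable_fun setT V) (V1 : forall x, 1 <= V x).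
Implicit Types f : T -> R.

Lemma adm_shift f : adm V f -> exists C, forall x, 0 <= f x + C * V x.
Proof.
move=> [_ [C fC]]; exists C => x; have := fC x.
by rewrite ler_norml => /andP[]; move: (C * V x) => c; lra.
Qed.

(** Adding a multiple of [V] makes an admissible function nonnegative, and [P], [Q] agree on [V]
    itself. *)
Lemma markov_op_ge0_ext P Q x : markov_op V P -> markov_op V Q ->
  (forall f, adm V f -> (forall y, 0 <= f y) -> P f x = Q f x) ->
  forall f, adm V f -> P f x = Q f x.
Proof.
move=> mkP mkQ PQ f af; have [C fC] := adm_shift af.
have aV := adm_V mV V1; have aCV := adm_Z V1 C aV; have af' := adm_D af aCV.
have := PQ _ af' fC; rewrite (markov_D mkP)// (markov_D mkQ)// (markov_Z V1 mkP)// (markov_Z V1 mkQ)//.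
have -> : P V x = Q V x by apply: PQ => // y; rewrite ltW// (V_gt0 V1).
exact: addIr.
Qed.

Lemma integral_markov_op (nu : {measure set T -> \bar R}) P x : markov_op V P ->
  (forall f, adm V f -> (forall y, 0 <= f y) -> (\int[nu]_y (f y)%:E = (P f x)%:E)%E) ->
  forall f, adm V f -> (\int[nu]_y (f y)%:E = (P f x)%:E)%E.
Proof.
move=> mkP PE f af; have [C fC] := adm_shift af.
have aV := adm_V mV V1; have aCV := adm_Z V1 C aV; have af' := adm_D af aCV.
have intg h : adm V h -> nu.-integrable setT (EFin \o h).
  move=> [mh [D hD]]; apply/integrableP; split; first exact/measurable_EFinP.
  have aN : adm V (fun y => `|h y|).
    split; first exact: measurableT_comp.
    by exists D => y; rewrite normr_id.
  have := PE _ aN (fun y => normr_ge0 _); rewrite /= => ->; exact: ltry.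
have fE y : f y = f y + C * V y - C * V y by rewrite addrK.
under eq_integral do rewrite fE EFinB.
rewrite integralB_EFin//; [|exact: intg|exact: intg].
rewrite PE//; have -> : (\int[nu]_y (C * V y)%:E = (C * P V x)%:E)%E.
  under eq_integral do rewrite EFinM.
  rewrite integralZl//; last exact: intg.
  by rewrite PE// => y; rewrite ltW// (V_gt0 V1).
by rewrite -EFinB (markov_D mkP)// (markov_Z V1 mkP)// addrK.
Qed.

End nonneg_parts.

Section invariance.
Context (R : realType) (d : nat) (U : 'rV[R]_d -> R) (L M m K : R).
Hypothesis H : regular_potential U L M m K.
Implicit Types (x y : 'rV[R]_d) (gamma : R) (f : 'rV[R]_d -> R).

Local Notation V := (@Vexp R d (m / 16)).
Local Notation mu := (@lebRV R d).
Local Notation T := 'rV[R]_d.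
Local Notation small := (small L m).
Local Notation Pi := (kop mu (fun _ => pidens U)).

Let V1 := Vexp_ge1 H.
Let mV := measurable_Vexp m : measurable_fun setT V.

(** The target is treated as a kernel that ignores its starting point, so that the theory of [kop]
    covers it. *)
Lemma good_pidens : kgood mu V (fun _ => pidens U).
Proof.
have [A hA] := integral_pidens_V H; split.
- exact: (measurableT_comp (measurable_pidens H) measurable_snd).
- by move=> _ y; exact: ltW (pidens_gt0 H y).
- exists A => x; apply: (le_trans hA); rewrite lee_fin ler_peMr//.
  rewrite -lee_fin; apply: le_trans hA; apply: integral_ge0 => y _.
  by rewrite lee_fin mulr_ge0 ?(ltW (pidens_gt0 H _))// ltW// (V_gt0 V1).
Qed.

Lemma markov_Pi : markov_op V Pi.
Proof.
have gd := good_pidens; split.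
- by move=> f af; exact: (kop_adm mV V1 gd).
- by move=> a f h af ah x; exact: (kop_lin mV V1 gd).
- by move=> f h af ah fh x; exact: (kop_le mV V1 gd).
- move=> x; rewrite /kop /Rintegral; under eq_integral do rewrite mulr1.
  by rewrite (integral_pidens H).
Qed.

Lemma integral_piM x f : adm V f -> (\int[piM U]_y (f y)%:E = (Pi f x)%:E)%E.
Proof.
have [nu [nuE nuI]] := density_measure mu (measurable_pidens H)
  (fun y => ltW (pidens_gt0 H y)).
have -> : piM U = nu by apply/funext => A; rewrite nuE.
apply: (integral_markov_op mV V1 markov_Pi) => h ah h0.
by have [mh _] := ah; rewrite nuI// (kopE mV V1 good_pidens x ah).
Qed.

Lemma integral_malaIter gamma x k f : small gamma -> adm V f ->
  (\int[malaIter U gamma x k]_y (f y)%:E = (iter k (Rop U gamma) f x)%:E)%E.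
Proof.
move=> sg af; have [nu [-> nuI]] := malaIter_measure H x k sg.
have mkI := markov_iter (markov_Rop H sg) k.
exact: (integral_markov_op mV V1 (x := x) mkI nuI af).
Qed.

Lemma Rop_invariant gamma x f : small gamma -> adm V f -> Pi (Rop U gamma f) x = Pi f x.
Proof.
move=> sg; have gam0 := small_gt0 sg.
have mkR := markov_Rop H sg.
have mkPR : markov_op V (fun f => Pi (Rop U gamma f)).
  have mkP := markov_Pi; split.
  - by move=> h ah; exact: (markov_adm mkP (markov_adm mkR ah)).
  - move=> a h h' ah ah' z; rewrite -(markov_lin mkP a (markov_adm mkR ah) (markov_adm mkR ah')).
    by congr (Pi _ z); apply/funext => y; exact: (markov_lin mkR).
  - move=> h h' ah ah' hh' z; apply: (markov_le mkP (markov_adm mkR ah) (markov_adm mkR ah')).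
    exact: (markov_le mkR ah ah' hh').
  - move=> z; rewrite (_ : Rop _ _ _ = fun _ => 1) ?(markov_1 mkP)//.
    by apply/funext => y; exact: (markov_1 mkR).
apply: (markov_op_ge0_ext mV V1 mkPR markov_Pi) => {}f af f0.
have ga := good_acc H sg; have gr := good_rej H sg.
have a1 : adm V (fun _ => 1 : R) by exact: adm_cst.
have aK := kop_adm mV V1 ga af.
have aK1 : adm V (fun y => f y * kop mu (acc_kernel U gamma) (fun _ => 1) y).
  have := adm_B af (adm_rej H sg af); congr adm; apply/funext => y.
  have := acc_rej_1 H y sg; move: (kop _ _ _ y) (rej _ _ y) => a r e.
  by have -> : a = 1 - r; [rewrite -e addrK|ring].
(* Under [Pi], detailed balance and Tonelli turn the accepted part into [f] times the acceptance
   probability; the rejected part adds [f] times the complementary one. *)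
have balance : Pi (kop mu (acc_kernel U gamma) f) x =
    Pi (fun y => f y * kop mu (acc_kernel U gamma) (fun _ => 1) y) x.
  have [mf _] := af.
  apply: EFin_inj; rewrite -(kopE mV V1 good_pidens x aK) -(kopE mV V1 good_pidens x aK1).
  have macc := measurable_acc_kernel H gam0.
  have acc0 y z := proj1 (andP (acc_kernel_itv H y z gam0)).
  have swap (p q a b c : R) : p * a = q * b -> p * (a * c) = q * c * (b * 1).
    by move=> h; rewrite mulrA h mulr1 mulrAC.
  pose F (z : T * T) := (pidens U z.1 * (acc_kernel U gamma z.1 z.2 * f z.2))%:E.
  have mF : measurable_fun setT F.
    apply/measurable_EFinP; apply: measurable_funM.
      exact: (measurableT_comp (measurable_pidens H) measurable_fst).
    by apply: measurable_funM => //; exact: (measurableT_comp mf measurable_snd).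
  have F0 z : (0 <= F z)%E.
    by rewrite lee_fin mulr_ge0 ?(ltW (pidens_gt0 H _))// mulr_ge0.
  transitivity (\int[mu]_y \int[mu]_z F (y, z))%E.
    apply: eq_integral => y _; rewrite EFinM -(kopE mV V1 ga y af).
    rewrite -integral_scale.
    - by apply: eq_integral.
    - exact: ltW (pidens_gt0 H y).
    - exact: measurable_funM (measurable_section y macc) mf.
    - by move=> z; exact: mulr_ge0 (acc0 y z) (f0 z).
  rewrite fubini_tonelli//; apply: eq_integral => z _.
  rewrite mulrA EFinM -(kopE mV V1 ga z a1) -integral_scale.
  - apply: eq_integral => y _.
    exact (congr1 EFin (swap _ _ _ _ (f z) (accept_sym H y z gam0))).
  - exact: mulr_ge0 (ltW (pidens_gt0 H z)) (f0 z).
  - exact: measurable_funM (measurable_section z macc) (@measurable_cst _ _ T R setT 1).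
  - by move=> y; rewrite mulr1; exact: acc0.
rewrite [LHS](markov_D markov_Pi) ?balance//; last exact: (adm_rej H sg af).
rewrite -(markov_D markov_Pi)//; last exact: (adm_rej H sg af).
by congr (Pi _ x); apply/funext => y; rewrite -mulrDr (acc_rej_1 H y sg) mulr1.
Qed.

Lemma iter_Rop_invariant gamma x k f : small gamma -> adm V f ->
  Pi (iter k (Rop U gamma) f) x = Pi f x.
Proof.
move=> sg af; elim: k => // k IH; rewrite iterS Rop_invariant//.
exact: (markov_adm (markov_iter (markov_Rop H sg) k) af).
Qed.

End invariance.

Theorem theorem2 (R : realType) (d : nat) (U : 'rV[R]_d -> R)
    (L M m K : R) :
  (* (i) *)
  C2 U -> grad U 0 = 0 -> 0 <= L ->
  (forall x y z, `| D2 U x y z | <= L * enorm y * enorm z) ->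
  (* (ii) *)
  C3 U -> 0 <= M ->
  (forall x a b c, `| D3 U x a b c | <= M * enorm a * enorm b * enorm c) ->
  (* (iii) *)
  0 < m -> 0 <= K ->
  (forall x y, K <= enorm x -> enorm y = 1 -> m <= D2 U x y y) ->
  let eta := m / 16 in
  let V := Vexp eta in
  exists (Gamma Abar : R), 0 < Gamma /\ 0 < Abar /\
    (\int[piM U]_x (V x)%:E <= Abar%:E)%E /\
    forall gbar : R, 0 < gbar <= Gamma ->
      exists (C rho : R), 0 <= C /\ 0 <= rho < 1 /\
        forall (x : 'rV[R]_d) (gamma : R) (k : nat), 0 < gamma <= gbar ->
          (Vnorm V (malaIter U gamma x k) (piM U)
           <= (C * powR rho (gamma * k%:R))%:E * ((V x)%:E + \int[piM U]_y (V y)%:E))%E.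

Proof.
move=> C2U g0 L0 D2L C3U M0 D3M m0 K0 D2m eta V.
have H := regular_potentialP C2U g0 L0 D2L C3U M0 D3M m0 K0 D2m.
have [Gam [C [rho [Gam0 C0 rho01 contr]]]] := Rop_contract H.
have V1 : forall x, 1 <= V x := Vexp_ge1 H.
have mV : measurable_fun setT V := measurable_Vexp m.
have aV : adm V V := adm_V mV V1.
pose Pi f := kop (@lebRV R d) (fun _ => pidens U) f (0 : 'rV[R]_d).
have mkPi : markov_op V (fun f _ => Pi f) by have [h1 h2 h3 h4] := markov_Pi H; split => *; [apply: (adm_cst V1)|exact: h2|exact: h3|exact: h4].
have piE f : adm V f -> (\int[piM U]_y (f y)%:E = (Pi f)%:E)%E := integral_piM H 0 (f := f).
have PiV1 : 1 <= Pi V.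
  by have <- := markov_1 mkPi (0 : 'rV[R]_d); apply: (markov_le mkPi (adm_cst V1 1) aV _ (0 : 'rV[R]_d)).
exists Gam, (Pi V); split=> //; split; first exact: lt_le_trans PiV1.
split; first by rewrite piE.
(* [C] and [rho] were obtained together with [Gam], so one pair serves every [gbar]. *)
move=> gbar /andP[gbar0 gbarG]; exists C, rho; split=> //; split=> // x gamma k /andP[gam0 gamb].
have gG : 0 < gamma <= Gam by rewrite gam0 (le_trans gamb).
have [sg ctr] := contr gamma gG.
have mkI := markov_iter (markov_Rop H sg) k.
pose r := C * powR rho (gamma * k%:R).
rewrite piE// -EFinD -EFinM -/r.
apply: ge_ereal_sup => _ [f [mf fV] <-].
have af : adm V f by split => //; exists 1 => y; rewrite mul1r.
have aI := markov_adm mkI af.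
rewrite (integral_malaIter H x k sg af) piE// -EFinB abse_EFin lee_fin.
(* Invariance replaces the target mean of [f] by that of its [k]-th iterate, leaving only
   differences of values of that iterate, to which the contraction applies. *)
have <- : Pi (iter k (Rop U gamma) f) = Pi f := iter_Rop_invariant H 0 k sg af.
set h := iter k (Rop U gamma) f in aI *.
have aW : adm V (fun y => r * V x + r * V y) by apply: adm_D; [exact: adm_cst|exact: adm_Z].
have PiW : Pi (fun y => r * V x + r * V y) = r * (V x + Pi V).
  rewrite (markov_D mkPi 0 (adm_cst V1 _) (adm_Z V1 r aV)).
  by rewrite (markov_cst V1 mkPi (r * V x) 0) (markov_Z V1 mkPi r 0 aV) mulrDr.
have osc y z : h y - h z <= r * V y + r * V z by rewrite -mulrDr; exact: ctr.
rewrite -PiW ler_norml; apply/andP; split.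
- rewrite lerNl opprB -[X in _ - X](markov_cst V1 mkPi _ (0 : 'rV[R]_d)).
  rewrite -(markov_B mkPi 0 aI (adm_cst V1 _)).
  apply: (markov_le mkPi _ aW _ 0) => [|y]; first exact: adm_B aI (adm_cst V1 _).
  by rewrite [leRHS]addrC; exact: osc.
- rewrite -[X in X - _](markov_cst V1 mkPi _ (0 : 'rV[R]_d)).
  rewrite -(markov_B mkPi 0 (adm_cst V1 _) aI).
  apply: (markov_le mkPi _ aW _ 0) => [|y]; first exact: adm_B (adm_cst V1 _) aI.
  exact: osc.
Qed.
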